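(* \textsc{Multi-Layer Cluster Editing} (MLCE) is fixed-parameter tractable with respect to the combined parameter $(k,d)$, where $k$ is the number of edge modifications allowed per layer and $d$ is the number of marked vertices. More precisely, it can be solved in $k^{O(k+d)}\cdot n^3\cdot \ell$ time, where $n=|V|$ is the number of vertices and $\ell$ the number of layers.
   Context: A multi-layer graph is a set of graphs $G_1=(V,E_1),\dots,G_\ell=(V,E_\ell)$ (layers) on the same vertex set $V$. An edit for a graph $G=(V,E)$ is an unordered pair of vertices of $V$. A set $M$ of edits is a cluster editing set for $G$ if $(V,E\oplus M)$ is a cluster graph, i.e. a disjoint union of cliques ($\oplus$ denotes symmetric difference). A clustering of the multi-layer graph is a sequence $(M_i)_{i\in[\ell]}$ with $M_i$ a cluster editing set for $G_i$; it is $k$-bounded if $|M_i|\le k$ for all $i$. Writing $G_i'=(V,E_i\oplus M_i)$, the clustering is totally $d$-consistent if there is a set $D\subseteq V$ with $|D|\le d$ such that $G_i'[V\setminus D]=G_j'[V\setminus D]$ for all $i,j\in[\ell]$. MLCE: given a multi-layer graph and integers $k,d$, decide whether there is a totally $d$-consistent $k$-bounded clustering. *)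

(* Defs.v *)
From mathcomp Require Import all_boot.

Set Implicit Arguments.
Unset Strict Implicit.
Unset Printing Implicit Defensive.

(** * Multi-layer cluster editing *)

Section Graphs.

Variable V : finType.
Implicit Types (E M : {set {set V}}) (D : {set V}).

(* A set of unordered pairs of distinct vertices.  Both the edge set of a
   simple graph on V and a set of edits are such sets. *)
Definition vertex_pairs E : Prop := forall e, e \in E -> #|e| = 2.

Definition symdiff E M : {set {set V}} := (E :\: M) :|: (M :\: E).

(* (V, E) is a disjoint union of cliques: the blocks of P are the cliques. *)
Definition cluster_graph E : Prop :=
  exists P : {set {set V}},
    partition P [set: V] /\
    forall e, e \in E <-> #|e| = 2 /\ exists2 C, C \in P & e \subset C.

Definition cluster_editing_set E M : Prop :=
  vertex_pairs M /\ cluster_graph (symdiff E M).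

(* The edge set of the subgraph induced by V \ D. *)
Definition edges_avoiding E D : {set {set V}} := [set e in E | e \subset ~: D].

Variable l : nat.
Implicit Types G N : 'I_l -> {set {set V}}.

Definition multilayer_graph G : Prop := forall i, vertex_pairs (G i).

Definition clustering G N : Prop := forall i, cluster_editing_set (G i) (N i).

Definition bounded k N : Prop := forall i, #|N i| <= k.

Definition totally_consistent d G N : Prop :=
  exists D : {set V}, #|D| <= d /\
    forall i j, edges_avoiding (symdiff (G i) (N i)) D
              = edges_avoiding (symdiff (G j) (N j)) D.

Definition MLCE G k d : Prop :=
  exists N, [/\ clustering G N, bounded k N & totally_consistent d G N].

End Graphs.

(** * Word RAM

   Structured programs over one random-access memory of natural numbers;
   registers are cells at constant addresses.  Every operation has unit cost.
   The parameter B bounds the machine words: a program that handles a number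
   (constant, address, memory content or result) that is not below B is stuck.
   Programs have no access to B. *)

Inductive binop := OAdd | OSub | OMul | ODiv | OMod | OEq | OLt.

Definition binop_fun (o : binop) (x y : nat) : nat :=
  match o with
  | OAdd => x + y
  | OSub => x - y (* truncated *)
  | OMul => x * y
  | ODiv => x %/ y
  | OMod => x %% y
  | OEq => x == y
  | OLt => x < y
  end.

Inductive expr :=
  | EConst of nat
  | ELoad of expr
  | EOp of binop & expr & expr.

Inductive cmd :=
  | CSkip
  | CStore of expr & expr (* CStore a e : write the value of e at address a *)
  | CSeq of cmd & cmd
  | CIf of expr & cmd & cmd
  | CWhile of expr & cmd.

Definition memory := nat -> nat.

Definition update (m : memory) (a v : nat) : memory :=
  fun x => if x == a then v else m x.

Definition word (B v : nat) : option nat := if v < B then Some v else None.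

Fixpoint eval (B : nat) (m : memory) (e : expr) : option nat :=
  match e with
  | EConst c => word B c
  | ELoad a => if eval B m a is Some x then word B (m x) else None
  | EOp o e1 e2 =>
      match eval B m e1, eval B m e2 with
      | Some x, Some y => word B (binop_fun o x y)
      | _, _ => None
      end
  end.

Fixpoint cost (e : expr) : nat :=
  match e with
  | EConst _ => 1
  | ELoad a => (cost a).+1
  | EOp _ e1 e2 => (cost e1 + cost e2).+1
  end.

(* exec B c m m' t : started in memory m, the program c halts in memory m'
   after exactly t steps. *)
Inductive exec (B : nat) : cmd -> memory -> memory -> nat -> Prop :=
  | ExecSkip m :
      exec B CSkip m m 1
  | ExecStore m a e x v :
      eval B m a = Some x -> eval B m e = Some v ->
      exec B (CStore a e) m (update m x v) (cost a + cost e).+1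
  | ExecSeq c1 c2 m m1 m2 t1 t2 :
      exec B c1 m m1 t1 -> exec B c2 m1 m2 t2 ->
      exec B (CSeq c1 c2) m m2 (t1 + t2)
  | ExecIf e c1 c2 m m' v t :
      eval B m e = Some v ->
      exec B (if v != 0 then c1 else c2) m m' t ->
      exec B (CIf e c1 c2) m m' (cost e + t).+1
  | ExecWhileEnd e c m :
      eval B m e = Some 0 ->
      exec B (CWhile e c) m m (cost e).+1
  | ExecWhileStep e c m m1 m2 v t1 t2 :
      eval B m e = Some v -> v != 0 ->
      exec B c m m1 t1 -> exec B (CWhile e c) m1 m2 t2 ->
      exec B (CWhile e c) m m2 (cost e + t1 + t2).+1.

(** * Solving MLCE within a time bound *)

(* Cells 0-3 hold n, l, k, d; the row-major n x n adjacency matrices of the l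
   layers follow.  All other cells are 0. *)
Definition encode n l (G : 'I_l -> {set {set 'I_n}}) (k d : nat) : memory :=
  fun a => match a with
  | 0 => n
  | 1 => l
  | 2 => k
  | 3 => d
  | b.+4 => [exists i : 'I_l, exists u : 'I_n, exists v : 'I_n,
              (b == (i * n + u) * n + v) && ([set u; v] \in G i)]
  end.

(* The number of cells occupied by the input. *)
Definition input_size (n l : nat) : nat := 4 + l * n * n.

(* A single program decides all instances, on words of O(log (n + l + k + d))
   bits; the answer is "yes" iff cell 0 is nonzero at the end. *)
Definition MLCE_solvable_in (T : nat -> nat -> nat -> nat -> nat) : Prop :=
  exists (p : cmd) (w : nat),
  forall (n l : nat) (G : 'I_l -> {set {set 'I_n}}) (k d : nat),
    multilayer_graph G ->
    exists (m : memory) (t : nat),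
      [/\ exec ((n + l + k + d + 2) ^ w) p (encode G k d) m t,
          t <= T n l k d
        & m 0 != 0 <-> MLCE G k d].

(* The bound B is existential: there is no limit on the word size here, and
   since programs cannot observe B the result does not depend on it. *)
Definition computable2 (f : nat -> nat -> nat) : Prop :=
  exists p : cmd, forall x y : nat,
    exists (B : nat) (m : memory) (t : nat),
      exec B p (fun a => if a == 0 then x else if a == 1 then y else 0) m t
      /\ m 0 = f x y.

Definition MLCE_FPT : Prop :=
  exists (f : nat -> nat -> nat) (c : nat),
    computable2 f /\
    MLCE_solvable_in (fun n l k d => f k d * input_size n l ^ c).

(* Main.v *)
Require Import Defs.
From mathcomp Require Import all_boot zify ring.

(* Represent a cluster graph by a labelling of the vertices.  An instance is
   solvable iff there are a graph H and a set D of at most d vertices such that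
   every layer is "completable": some cluster graph agrees with H outside D and
   differs from the layer in at most k pairs.

   The search starts from H = first layer and D = empty.  If a layer is not
   completable, this is already witnessed by a set W of unmarked vertices, and an
   inclusion-minimal such W has O(k^2) elements: take w in W and a completion of
   W \ w; all but 2k vertices are untouched by it, a class of untouched twins has
   at most 2k + 1 elements, and only O(k) untouched cliques see w.  A solution has
   to mark a vertex of W or to differ from H on a pair of W, which gives k^O(1)
   branches, and every branch decreases the distance 2k + d to the solution.
   Greedy minimisation finds W with n completability tests, and each test is a
   bounded search that repairs a violated triple, found in O(n^2) time, in one of
   three ways.  Both searches enumerate all strings of choices with an odometer,
   so the program needs no stack. *)

Set Implicit Arguments.
Unset Strict Implicit.
Unset Printing Implicit Defensive.

(** A set of vertices is used as the obstruction, rather than a bad pair or triple, because the edit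
    budget of a layer is a global constraint and no single pair can be blamed for exceeding it. The
    graph [H] of a solution is arbitrary on pairs that meet the marked set, so progress is measured
    against a completion of the first layer instead: it agrees with [H] off the marks and lies
    within 2k ordered pairs of the starting graph. Words have logarithmic length, which rules out
    unbounded counters. Hence every loop has a bound fixed by the instance, and counters saturate.
    Each string of choices is replayed from scratch, at the price of a factor linear in its length.
    Base 64 (k+1)^2 with 2 (2k+d+1) digits gives k^O(k+d) outer strings, and each test adds only
    3^(2k+1) inner ones. One outer step makes at most n + l tests, each quadratic in n for fixed k,
    whence the factor n^3 l. *)

(** * Completability of one layer, expressed by vertex labellings *)

Section Completion.

Variable V : finType.
Implicit Types (S D W : {set V}) (A G H : {set V * V}) (p : V * V).

(* Graphs are sets of ordered pairs, so every edit is counted twice; loops are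
   ignored. *)
Definition dpairs S : {set V * V} :=
  [set p | [&& p.1 \in S, p.2 \in S & p.1 != p.2]].

Definition diffs S A G : {set V * V} :=
  [set p in dpairs S | (p \in A) != (p \in G)].

Definition same_label (T : eqType) (f : V -> T) : {set V * V} :=
  [set p | f p.1 == f p.2].

(** Marked vertices are exempt from agreeing with [H], but their edits still count. Restricting
    everything to [W :|: D] makes the property inherited by subsets of [W]. *)
Definition completable k G H D W :=
  [exists f : {ffun V -> V},
     (diffs W (same_label f) H == set0) &&
     (#|diffs (W :|: D) (same_label f) G| <= k.*2)].

Definition symmetric_pairs A := forall x y, ((x, y) \in A) = ((y, x) \in A).

Lemma in_diffs S A G x y :
  ((x, y) \in diffs S A G) =
  [&& x \in S, y \in S, x != y & ((x, y) \in A) != ((x, y) \in G)].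
Proof. by rewrite !inE /= -!andbA. Qed.

Lemma in_same_label (T : eqType) (f : V -> T) x y :
  ((x, y) \in same_label f) = (f x == f y).
Proof. by rewrite inE. Qed.

Lemma same_label_sym (T : eqType) (f : V -> T) : symmetric_pairs (same_label f).
Proof. by move=> x y; rewrite !in_same_label eq_sym. Qed.

Lemma diffs0P S A G :
  reflect (forall x y, x \in S -> y \in S -> x != y -> ((x, y) \in A) = ((x, y) \in G))
          (diffs S A G == set0).
Proof.
apply: (iffP eqP) => [/setP e x y xS yS xy | e].
  by have := e (x, y); rewrite in_diffs xS yS xy in_set0 /= => /negbT; rewrite negbK => /eqP.
apply/setP => -[x y]; rewrite in_diffs in_set0.
by apply/and4P => -[xS yS xy]; rewrite (e _ _ xS yS xy) eqxx.
Qed.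

(** Replacing each label by a chosen vertex that carries it turns any labelling into one with values
    in [V]. Freedom in the label type allows fresh labels, numbers and blocks later on. *)
Lemma completableP (T : eqType) k G H D W (f : V -> T) :
  diffs W (same_label f) H = set0 -> #|diffs (W :|: D) (same_label f) G| <= k.*2 ->
  completable k G H D W.
Proof.
move=> eH leG; pose g := [ffun x => odflt x [pick y | f y == f x]].
have eg : same_label g = same_label f.
  apply/setP => -[x y]; rewrite !in_same_label !ffunE.
  apply/eqP/eqP => [|fxy].
    case: pickP => [x' /eqP <-|/(_ x)]; rewrite ?eqxx //=.
    by case: pickP => [y' /eqP <- -> //|/(_ y)]; rewrite eqxx.
  rewrite fxy; case: pickP => [//|/(_ y)]; by rewrite eqxx.
by apply/existsP; exists g; rewrite eg eH eqxx.
Qed.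

Lemma completable_witness k G H D W : completable k G H D W ->
  exists f : V -> V, diffs W (same_label f) H = set0 /\
    #|diffs (W :|: D) (same_label f) G| <= k.*2.
Proof. by case/existsP => f /andP [/eqP ? ?]; exists f. Qed.

Lemma card_touched S A G : #|[set p.1 | p in diffs S A G]| <= #|diffs S A G|.
Proof. exact: leq_imset_card. Qed.

Lemma card_fibers (T : finType) (U : {set V}) (phi : V -> T) c :
  (forall y, y \in U -> #|[set x in U | phi x == phi y]| <= c) ->
  #|U| <= #|phi @: U| * c.
Proof.
move=> fib; rewrite -sum1_card (partition_big phi (mem (phi @: U))) /=; last first.
  by move=> i iU; apply: imset_f.
rewrite -sum_nat_const; apply: leq_sum => _ /imsetP [y yU ->].
rewrite sum1_card; apply: leq_trans (fib y yU); apply/eq_leq/eq_card => x.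
by rewrite !inE.
Qed.

(** * Minimal obstructions have quadratic size *)

Section MinimalObstruction.

Variables (k : nat) (G H : {set V * V}) (D W : {set V}).
Hypotheses (symG : symmetric_pairs G) (symH : symmetric_pairs H).
Hypothesis WD : [disjoint W & D].
Hypothesis notW : ~~ completable k G H D W.
Hypothesis minW : forall w, w \in W -> completable k G H D (W :\ w).

Variables (w : V) (f : V -> V).
Hypothesis wW : w \in W.
Hypothesis fH : diffs (W :\ w) (same_label f) H = set0.
Hypothesis fG : #|diffs (W :\ w :|: D) (same_label f) G| <= k.*2.

Let touched := [set p.1 | p in diffs (W :\ w :|: D) (same_label f) G].
Let clean := (W :\ w) :\: touched.

Let fHE x y : x \in W -> y \in W -> x != w -> y != w -> x != y ->
  ((x, y) \in H) = (f x == f y).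
Proof.
move=> xW yW xw yw xy; rewrite -in_same_label.
by move/eqP/diffs0P: fH => -> //; rewrite !inE ?xw ?yw.
Qed.

Let cleanE x y : x \notin touched -> x \in W :\ w :|: D -> y \in W :\ w :|: D ->
  x != y -> ((x, y) \in G) = (f x == f y).
Proof.
move=> xt xS yS xy; rewrite -in_same_label; apply/eqP; apply: contraNT xt => ne.
by apply/imsetP; exists (x, y); rewrite // in_diffs xS yS xy eq_sym.
Qed.

Let cleanW x : x \in clean -> [/\ x \in W, x != w & x \notin touched].
Proof. by rewrite !inE => /and3P []. Qed.

Let notD x : x \in W -> x \notin D.
Proof. by move=> xW; rewrite (disjointFr WD xW). Qed.

Let twin_class t := [set x in clean | [&& f x == f t, ((w, x) \in G) == ((w, t) \in G)
                         & ((w, x) \in H) == ((w, t) \in H)]].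

(* An untouched twin of a removed vertex t lends its label to t. *)
Lemma card_twin_class t : t \in clean -> #|twin_class t| <= k.*2.+1.
Proof.
move=> tC; rewrite leqNgt; apply/negP => big.
have [tW tw tt] := cleanW tC.
have [f1 [f1H f1G]] := completable_witness (minW tW).
pose touched1 := [set p.1 | p in diffs (W :\ t :|: D) (same_label f1) G].
(* More than 2k twins remain besides [t], while the completion of [W :\ t] touches at most 2k
   vertices, so some twin [t'] is untouched by it. *)
have : ~~ (twin_class t :\ t \subset touched1).
  apply: contraL big => /subset_leq_card.
  have := cardsD1 t (twin_class t); rewrite inE tC !eqxx /= => ->.
  by move/leq_trans => /(_ _ (leq_trans (card_touched _ _ _) f1G)); lia.
case/subsetPn => t'; rewrite in_setD1 inE => /andP [t't /and4P [t'C /eqP ft /eqP wtG /eqP wtH]] t'1.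
have [t'W t'w t't'] := cleanW t'C.
have f1E x : x \in W :\ t :|: D -> t' != x -> ((t', x) \in G) = (f1 t' == f1 x).
  move=> xS xt'; rewrite -in_same_label; apply/eqP; apply: contraNT t'1 => ne.
  apply/imsetP; exists (t', x); rewrite // in_diffs xS xt' eq_sym ne.
  by rewrite !inE t't t'W.
move: notW; pose f2 x := if x == t then f1 t' else f1 x.
have Sw x : x \in W :|: D -> x != w -> x \in W :\ w :|: D.
  by rewrite !inE => /orP [] -> -> //; rewrite orbT.
have St x : x \in W :|: D -> x != t -> x \in W :\ t :|: D.
  by rewrite !inE => /orP [] -> -> //; rewrite orbT.
(* Twins have the same neighbours: away from [w] both are described by [f], and at [w] they agree by
   the adjacency bits in [twin_class]. *)
have eqH x : x \in W -> x != t -> ((t, x) \in H) = (f1 t' == f1 x).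
  move=> xW xt; have [->|xt'] := eqVneq x t'.
    by rewrite eqxx fHE // ?ft 1?eq_sym // eqxx.
  have -> : (f1 t' == f1 x) = ((t', x) \in H).
    rewrite -in_same_label; move/eqP/diffs0P: f1H => -> //.
    - by rewrite !inE t't.
    - by rewrite !inE xt.
    - by rewrite eq_sym.
  have [->|xw] := eqVneq x w; first by rewrite symH -wtH symH.
  by rewrite !fHE // ?ft // eq_sym.
have eqG x : x \in W :|: D -> x != t -> ((t, x) \in G) = (f1 t' == f1 x).
  move=> xW xt; have [->|xt'] := eqVneq x t'.
    rewrite eqxx cleanE // ?ft ?eqxx // 1?eq_sym //; apply: Sw => //;
    by rewrite inE ?tW ?t'W.
  rewrite -f1E ?St // 1?eq_sym //.
  have [->|xw] := eqVneq x w; first by rewrite symG -wtG symG.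
  by rewrite !cleanE ?ft ?Sw // 1?eq_sym // inE ?tW ?t'W.
apply/negP; rewrite negbK; apply: (@completableP _ _ _ _ _ _ f2).
  apply/eqP/diffs0P => x y xW yW xy; rewrite in_same_label /f2.
  have [xt|xt] := eqVneq x t; have [yt|yt] := eqVneq y t.
  - by rewrite xt yt eqxx in xy.
  - by rewrite xt eqH.
  - by rewrite yt symH eqH // eq_sym.
  - rewrite -in_same_label; move/eqP/diffs0P: f1H => -> //;
    by rewrite !inE ?xt ?yt.
apply: leq_trans f1G; apply/subset_leq_card/subsetP => -[x y].
rewrite !in_diffs !in_same_label /f2 => /and4P [xS yS xy].
have [xt|xt] := eqVneq x t; have [yt|yt] := eqVneq y t.
- by rewrite xt yt eqxx in xy.
- by rewrite xt eqG // eqxx.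
- by rewrite yt symG eqG // [f1 x == _]eq_sym eqxx.
- by move=> ne; rewrite !St // xy ne.
Qed.

(** Having no touched member makes the class a clique component of [G] away from [w], and its part
    in [W] one of [H]; having no neighbour [w] preserves this when [w] is put back. *)
Let isolated l :=
  [forall x in W :|: D, (x != w) && (f x == l) ==>
     [&& x \notin touched, (w, x) \notin G & (x \in W) ==> ((w, x) \notin H)]].

(* A clique component not meeting w can be split off for free. *)
Lemma no_isolated y : y \in clean -> ~~ isolated (f y).
Proof.
move=> yC; apply/negP => /forall_inP iso; have [yW yw yt] := cleanW yC.
have {}iso x : x \in W :|: D -> x != w -> f x = f y ->
  [/\ x \notin touched, (w, x) \notin G & x \in W -> (w, x) \notin H].
  move=> xS xw fx; have := iso x xS; rewrite xw fx eqxx /=.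
  by case/and3P => ? ? /implyP.
have [f1 [f1H f1G]] := completable_witness (minW yW).
pose K x := (x != w) && (f x == f y).
(* [None] is a fresh label, so the class becomes a clique of its own. It contains [y], hence [f1] is
   consulted only away from [y], where it is reliable. *)
pose f2 x := if K x then None else Some (f1 x).
have Sw x : x \in W :|: D -> x != w -> x \in W :\ w :|: D.
  by rewrite !inE => /orP [] -> -> //; rewrite orbT.
have Ky : K y by rewrite /K yw eqxx.
have outK x z : x \in W :|: D -> z \in W :|: D -> x != z -> K x -> ~~ K z ->
   (x, z) \notin G /\ (x \in W -> z \in W -> (x, z) \notin H).
  move=> xS zS xz /andP [xw /eqP fx]; rewrite negb_and negbK.
  have [xt xG xH] := iso x xS xw fx.
  have [-> _|zw] := eqVneq z w.
    by rewrite symG symH; split=> // xW _; apply: xH.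
  move=> /= fz; rewrite cleanE ?Sw // fx [f y == _]eq_sym; split=> // xW zW.
  by rewrite fHE // fx [f y == _]eq_sym.
have inK x z : x \in W :|: D -> z \in W :|: D -> x != z -> K x -> K z ->
   (x, z) \in G /\ (x \in W -> z \in W -> (x, z) \in H).
  move=> xS zS xz /andP [xw /eqP fx] /andP [zw /eqP fz].
  have [xt xG xH] := iso x xS xw fx.
  by rewrite cleanE ?Sw // fx fz eqxx; split=> // xW zW; rewrite fHE // fx fz.
have WS x : x \in W -> x \in W :|: D by rewrite inE => ->.
move: notW; apply/negP; rewrite negbK; apply: (@completableP _ _ _ _ _ _ f2).
  apply/eqP/diffs0P => x z xW zW xz; rewrite in_same_label /f2.
  case Kx: (K x); case Kz: (K z).
  - by have [_ ->] := inK x z (WS _ xW) (WS _ zW) xz Kx Kz.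
  - by have [_ /(_ xW zW) /negbTE ->] := outK x z (WS _ xW) (WS _ zW) xz Kx (negbT Kz).
  - rewrite eq_sym in xz.
    by have [_ /(_ zW xW)] := outK z x (WS _ zW) (WS _ xW) xz Kz (negbT Kx);
       rewrite symH => /negbTE ->.
  - rewrite (inj_eq Some_inj) -in_same_label; move/eqP/diffs0P: f1H => -> //;
    rewrite !inE ?xW ?zW andbT; first by apply: contraFneq Kx => ->.
    by apply: contraFneq Kz => ->.
apply: leq_trans f1G; apply/subset_leq_card/subsetP => -[x z].
rewrite !in_diffs !in_same_label /f2 => /and4P [xS zS xz].
case Kx: (K x); case Kz: (K z).
- by have [-> _] := inK x z xS zS xz Kx Kz; rewrite eqxx.
- by have [/negbTE -> _] := outK x z xS zS xz Kx (negbT Kz).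
- rewrite eq_sym in xz.
  by have [/negbTE eG _] := outK z x zS xS xz Kz (negbT Kx); rewrite symG eG.
- rewrite (inj_eq Some_inj) xz => ->; rewrite andbT !inE.
  have -> : x != y by apply: contraFneq Kx => ->.
  have -> : z != y by apply: contraFneq Kz => ->.
  by move: xS zS; rewrite !inE => -> ->.
Qed.

(** By [no_isolated], the label of a clean vertex has one of three excuses: a touched member, an
    [H]-neighbour of [w] in [W], or a [G]-neighbour of [w]. The three sets of labels are counted
    separately. *)
Let labels_touched := [set f x | x in touched].

Let labels_H := [set l | [exists x in W, [&& x != w, f x == l & (w, x) \in H]]].

Let labels_G := [set l in f @: clean |
  (l \notin labels_touched) &&
  [exists x in W :|: D, [&& x != w, f x == l & (w, x) \in G]]].

(** Three [H]-neighbours of [w] in distinct classes would leave, after deleting one, an induced path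
    in [H] with centre [w], although a completion has to agree with [H] there. *)
Lemma card_labels_H : #|labels_H| <= 2.
Proof.
rewrite leqNgt; apply/negP => /card_gt2P [l0 [l1 [l2 [[]]]]].
rewrite !inE => /existsP [x0 /and4P [x0W x0w /eqP fx0 x0H]].
move=> /existsP [x1 /and4P [x1W x1w /eqP fx1 x1H]].
move=> /existsP [x2 /and4P [x2W x2w /eqP fx2 x2H]] [l01 l12 l20].
have x01 : x1 != x0 by apply: contraNneq l01 => e; rewrite -fx0 -fx1 e.
have x02 : x2 != x0 by apply: contraNneq l20 => e; rewrite -fx0 -fx2 e.
have x12 : x1 != x2 by apply: contraNneq l12 => e; rewrite -fx1 -fx2 e.
have [f1 [/eqP/diffs0P f1H _]] := completable_witness (minW x0W).
have {}f1H x y : x \in W -> y \in W -> x != x0 -> y != x0 -> x != y ->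
    (f1 x == f1 y) = ((x, y) \in H).
  by move=> xW yW x_ y_ xy; rewrite -in_same_label f1H // !inE ?x_ ?y_.
have w0 : w != x0 by rewrite eq_sym.
have /eqP e1 : f1 w == f1 x1 by rewrite f1H // eq_sym.
have /eqP e2 : f1 w == f1 x2 by rewrite f1H // eq_sym.
have : f1 x1 == f1 x2 by rewrite -e1 -e2.
by rewrite f1H // fHE // fx1 fx2 (negbTE l12).
Qed.

(* In a star whose leaves are pairwise non-adjacent, all leaves but one are
   incident with an edit, either at the centre or at a common leaf. *)
Lemma card_labels_G : #|labels_G| <= k.*2.+2.
Proof.
rewrite leqNgt; apply/negP => big.
have /card_gt0P [l0 l0G] : 0 < #|labels_G| by apply: leq_trans big.
(* The deleted vertex carries the label [l0], so the leaves chosen for all other labels survive, and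
   so does [w]. *)
have [y0 y0C fy0] : exists2 y0, y0 \in clean & l0 = f y0.
  by move: l0G; rewrite inE => /andP [/imsetP [y0 ? ->] _]; exists y0.
have [y0W y0w y0t] := cleanW y0C.
have [f1 [f1H f1G]] := completable_witness (minW y0W).
pose leaf l := odflt w [pick x in W :|: D | [&& x != w, f x == l & (w, x) \in G]].
have leafP l : l \in labels_G :\ l0 ->
  [/\ leaf l \in W :\ y0 :|: D, leaf l != w, f (leaf l) = l, (w, leaf l) \in G &
      leaf l \notin touched /\ leaf l \in W :\ w :|: D].
  rewrite in_setD1 inE => /andP [ll0 /and3P [_ lt /existsP [x0 x0P]]]; rewrite /leaf.
  case: pickP => [x /and4P [xS xw /eqP fx xG]|/(_ x0)]; last by rewrite x0P.
  split=> //=.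
  - have : x != y0 by apply: contraNneq ll0 => e; rewrite -fx fy0 e.
    by move: xS; rewrite !inE => /orP [] -> -> //; rewrite orbT.
  split; first by apply: contra lt => xt; rewrite -fx imset_f.
  by move: xS; rewrite !inE xw.
(* [l1] is a leaf that [f1] keeps with [w], if there is one. Every other such leaf is charged to its
   non-edge with this leaf, and each leaf separated from [w] to its edge with [w]. The default [l0]
   is already removed, so it removes nothing more. *)
pose l1 := odflt l0 [pick l in labels_G :\ l0 | f1 (leaf l) == f1 w].
pose g l := (if f1 (leaf l) == f1 w then leaf l1 else w, leaf l).
have sub : g @: (labels_G :\ l0 :\ l1) \subset diffs (W :\ y0 :|: D) (same_label f1) G.
  apply/subsetP => _ /imsetP [l lG ->]; move: (lG); rewrite in_setD1 => /andP [ll1 lG'].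
  have [lS lw fl wl [lt lS']] := leafP l lG'; rewrite /g in_diffs in_same_label.
  case: ifP => [/eqP e|e].
    have [l1G f1l1] : l1 \in labels_G :\ l0 /\ f1 (leaf l1) = f1 w.
      rewrite /l1; case: pickP => [l' /andP [? /eqP //]|/(_ l)].
      by rewrite lG' e eqxx.
    have [l1S l1w fl1 wl1 [l1t l1S']] := leafP l1 l1G.
    have ne : leaf l1 != leaf l by apply: contraNneq ll1 => e'; rewrite -fl -fl1 e'.
    by rewrite l1S lS ne f1l1 e eqxx cleanE // fl fl1 [l1 == _]eq_sym (negbTE ll1).
  rewrite lS [w == _]eq_sym lw [f1 w == _]eq_sym e wl /= !inE wW [w == _]eq_sym.
  by rewrite y0w.
have := subset_leq_card sub; rewrite card_in_imset; last first.
  move=> l l' /setD1P [_ lG] /setD1P [_ l'G] [_ e].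
  by have [_ _ <- _ _] := leafP l lG; have [_ _ <- _ _] := leafP l' l'G; rewrite e.
move=> le1; have le2 := leq_trans le1 f1G.
have := cardsD1 l0 labels_G; have := cardsD1 l1 (labels_G :\ l0).
rewrite l0G; move: big le2; move: (_ \in _) => b; clear; case: b; lia.
Qed.

Lemma card_clean : #|clean| <= (k.*2 + (k.*2.+2 + 2)) * 4 * k.*2.+1.
Proof.
(* The fibres of [phi] are the twin classes; the factor 4 counts the two adjacency bits at [w]. *)
pose phi x := (f x, ((w, x) \in G, (w, x) \in H)).
have cT : #|touched| <= k.*2 := leq_trans (card_touched _ _ _) fG.
apply: leq_trans (card_fibers (phi := phi) (c := k.*2.+1) _) _ => [y yC|].
  apply: leq_trans (card_twin_class yC); apply/subset_leq_card/subsetP => x.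
  by rewrite !inE /phi !xpair_eqE.
rewrite leq_mul2r; apply/orP; right.
have sub : phi @: clean \subset setX (f @: clean) [set: bool * bool].
  apply/subsetP => _ /imsetP [x xC ->]; rewrite in_setX in_setT andbT.
  exact: imset_f.
apply: leq_trans (subset_leq_card sub) _.
rewrite cardsX cardsT card_prod card_bool leq_mul2r /=.
have sub2 : f @: clean \subset labels_touched :|: (labels_G :|: labels_H).
  apply/subsetP => l lC; have /imsetP [y yC ly] := lC.
  have := no_isolated yC; rewrite -ly negb_forall => /existsP [x].
  rewrite negb_imply => /andP [xS]; rewrite negb_imply => /andP [/andP [xw /eqP fx]].
  rewrite inE; case: (boolP (l \in labels_touched)) => //= lt.
  have -> /= : x \notin touched by apply: contra lt => xt; rewrite -fx imset_f.
  rewrite negb_and negbK negb_imply negbK => /orP [xG|/andP [xW xH]].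
    rewrite inE; apply/orP; left; rewrite inE lC lt /=.
    by apply/existsP; exists x; rewrite xS xw fx eqxx xG.
  rewrite inE; apply/orP; right; rewrite inE; apply/existsP; exists x.
  by rewrite xW xw fx eqxx.
apply: leq_trans (subset_leq_card sub2) _.
apply: leq_trans (leq_card_setU _ _) _; apply: leq_add.
  exact: leq_trans (leq_imset_card _ _) cT.
apply: leq_trans (leq_card_setU _ _) _.
exact: leq_add card_labels_G card_labels_H.
Qed.

Lemma card_obstruction_aux : #|W| <= 64 * (k.+1 * k.+1).
Proof.
have cT : #|touched| <= k.*2 := leq_trans (card_touched _ _ _) fG.
have sub : W \subset [set w] :|: (touched :|: clean).
  by apply/subsetP => x xW; rewrite !inE xW; case: (x == w); case: (x \in touched).
apply: leq_trans (subset_leq_card sub) _.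
apply: leq_trans (leq_card_setU _ _) _; rewrite cards1.
have := leq_card_setU touched clean; have := card_clean; move: cT; clear.
move: #|touched| #|clean| #|touched :|: clean| => a b c.
have -> : (k.*2 + (k.*2.+2 + 2)) * 4 * k.*2.+1 = 32 * (k * k) + 48 * k + 16.
  by rewrite -muln2; ring.
have -> : 64 * (k.+1 * k.+1) = 64 * (k * k) + 128 * k + 64 by ring.
by move=> ? ? [? _]; lia.
Qed.

End MinimalObstruction.

Lemma card_minimal_obstruction k G H D W :
  symmetric_pairs G -> symmetric_pairs H -> [disjoint W & D] ->
  ~~ completable k G H D W -> (forall w, w \in W -> completable k G H D (W :\ w)) ->
  #|W| <= 64 * (k.+1 * k.+1).
Proof.
move=> symG symH WD notW minW; case: (set_0Vmem W) => [->|[w wW]]; first by rewrite cards0.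
have [f [fH fG]] := completable_witness (minW w wW).
exact: (card_obstruction_aux symG symH WD notW minW wW fH fG).
Qed.

End Completion.

(** The last hit rather than the first, because an upward scan that overwrites its result needs no
    early exit. *)
Fixpoint last_sat (P : pred nat) b : option nat :=
  if b is b'.+1 then if P b' then Some b' else last_sat P b' else None.

Lemma last_sat_some P b i : last_sat P b = Some i ->
  [/\ i < b, P i & forall j, j < b -> P j -> j <= i].
Proof.
elim: b => //= b IH; case: ifP => [Pb [<-]|Pb /IH [ib Pi max]]; first by split.
split=> // [|j]; first exact: ltnW.
by rewrite ltnS leq_eqVlt => /predU1P [->|/max //]; rewrite Pb.
Qed.

Lemma last_sat_none P b i : last_sat P b = None -> i < b -> ~~ P i.
Proof.
elim: b => //= b IH; case: ifP => // Pb /IH nP.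
by rewrite ltnS leq_eqVlt => /predU1P [->|/nP //]; rewrite Pb.
Qed.

(** * Pair codes, toggling and repair of violated triples *)

Section Search.

Variable N : nat.
Notation n := N.+1.
Notation V := 'I_N.+1.
Implicit Types (S D W : {set V}) (A G H : {set V * V}).

(** Decodes the row-major index of an adjacency matrix cell. The vertex type is nonempty so that
    [inord] is available. *)
Definition pair_of (q : nat) : V * V := (inord (q %/ n), inord (q %% n)).

Lemma pair_ofK (x y : V) : pair_of (x * n + y) = (x, y).
Proof. by rewrite /pair_of divnMDl // modnMDl divn_small // modn_small // addn0 !inord_val. Qed.

Lemma pair_code_lt (x y : V) : x * n + y < n * n.
Proof. by have := ltn_ord x; have := ltn_ord y; nia. Qed.

Definition toggle1 A (p : V * V) : {set V * V} := [set r | (r \in A) (+) (r == p)].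

(** The two flips correspond to the two stores of the program. On a loop they cancel, so symmetry is
    preserved for every [p]. *)
Definition toggle A (p : V * V) := toggle1 (toggle1 A p) (p.2, p.1).

Lemma in_toggle A x y u v : x != y -> ((u, v) \in toggle A (x, y)) =
  ((u, v) \in A) (+) (((u, v) == (x, y)) || ((u, v) == (y, x))).
Proof.
move=> xy; rewrite !inE -addbA; congr addb; rewrite !xpair_eqE.
case: eqVneq => [->|]; case: eqVneq => [->|] //=; rewrite ?(negbTE xy) ?eqxx ?andbF //.
Qed.

Lemma toggle_sym A p : symmetric_pairs A -> symmetric_pairs (toggle A p).
Proof.
case: p => x y sA u v; rewrite !inE sA -!addbA !xpair_eqE; congr addb.
by rewrite addbC; congr addb; rewrite andbC.
Qed.

Lemma card_toggle S A F x y :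
  symmetric_pairs A -> symmetric_pairs F -> (x, y) \in diffs S A F ->
  #|diffs S (toggle A (x, y)) F| < #|diffs S A F|.
Proof.
move=> sA sF xyd; move: (xyd); rewrite in_diffs => /and4P [xS yS xy ne].
apply: proper_card; apply/properP; split.
  apply/subsetP => -[u v]; rewrite !in_diffs in_toggle // => /and4P [-> -> -> /=].
  case: (boolP (_ || _)) => [|_]; last by rewrite addbF.
  by case/orP => /eqP [-> ->] _; rewrite // sA sF.
exists (x, y); rewrite // in_diffs in_toggle // eqxx /= addbT xS yS xy /=.
by move: ne; do 2!case: (_ \in _).
Qed.

(** * Bounded search for one layer *)

(* The largest element of the closed neighbourhood of u.  A is a cluster graph on
   S iff adjacency and equality of representatives coincide on S, and otherwise
   [third] completes a bad pair to a non-transitive triple. *)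
Definition rep S A (u : V) : nat :=
  odflt 0 (last_sat (fun v => (inord v \in S) &&
                             (((u, inord v) \in A) || (u == inord v))) n).

Definition violation S A (p : V * V) :=
  [&& p.1 \in S, p.2 \in S, p.1 != p.2 &
      (p \in A) != (rep S A p.1 == rep S A p.2)].

Definition last_violation S A :=
  last_sat (fun q => violation S A (pair_of q)) (n * n).

Definition third S A (p : V * V) : nat :=
  if p \in A then
    if rep S A p.1 < rep S A p.2 then rep S A p.2 else rep S A p.1
  else rep S A p.1.

Definition edit_of S A (p : V * V) (c : nat) : V * V :=
  if c is c'.+1 then
    if c' is 0 then (p.1, inord (third S A p)) else (inord (third S A p), p.2)
  else p.

Lemma rep_spec S A u : u \in S ->
  [/\ rep S A u < n, inord (rep S A u) \in S,
      ((u, inord (rep S A u)) \in A) || (u == inord (rep S A u)) &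
      forall v : V, v \in S -> ((u, v) \in A) || (u == v) -> v <= rep S A u].
Proof.
move=> uS; rewrite /rep; case E: last_sat => [i|] /=.
  have [ib /andP [iS iA] max] := last_sat_some E; split=> // v vS vA.
  by apply: max; rewrite ?ltn_ord // inord_val vS.
by have := last_sat_none E (ltn_ord u); rewrite inord_val uS eqxx orbT.
Qed.

(** If the pair is an edge, the larger representative is adjacent to one end and, by maximality, not
    to the other. If it is a non-edge, the common representative is adjacent to both ends. Either
    way exactly two of the three pairs are edges, which no labelling reproduces. *)
Lemma third_spec S A p : symmetric_pairs A -> violation S A p ->
  let z := inord (third S A p) in
  [/\ third S A p < n, z \in S, z != p.1, z != p.2 &
   forall T : eqType, forall f : V -> T,
     (p \in A) = (f p.1 == f p.2) -> ((p.1, z) \in A) = (f p.1 == f z) ->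
     ((z, p.2) \in A) = (f z == f p.2) -> False].
Proof.
case: p => u v sA /and4P [/= uS vS uv]; rewrite /third /=.
have [ru ruS ruA ru_max] := rep_spec A uS.
have [rv rvS rvA rv_max] := rep_spec A vS.
move: (rep S A u) (rep S A v) ru ruS ruA ru_max rv rvS rvA rv_max => a b an aS aA amax bn bS bA bmax.
have vi (x : V) m : m < n -> (x == inord m :> V) = (x == m :> nat).
  by move=> mn; rewrite -val_eqE /= inordK.
have iv (x : V) m : m < n -> (inord m == x :> V) = (x == m :> nat).
  by move=> mn; rewrite eq_sym vi.
have au : u <= a by apply: amax; rewrite ?eqxx ?orbT.
have bv : v <= b by apply: bmax; rewrite ?eqxx ?orbT.
case: (boolP ((u, v) \in A)) => uvA.
  have av : v <= a by apply: amax => //; rewrite uvA.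
  have bu : u <= b by apply: bmax => //; rewrite sA uvA.
  rewrite [true == _]eq_sym eqb_id neq_ltn => ab.
  case: (ltnP a b) => ltab.
    have bu' : u != b :> nat by rewrite ltn_eqF // (leq_ltn_trans au).
    have bv' : v != b :> nat by rewrite ltn_eqF // (leq_ltn_trans av).
    rewrite !iv //; split=> // T f /esym /eqP fuv fuz fzv.
    have vz : (inord b, v) \in A by move: bA; rewrite vi // (negbTE bv') orbF sA.
    have : (u, inord b) \notin A.
      by apply: contraTN ltab => h; rewrite -leqNgt -[b](@inordK N) // amax // h.
    by rewrite fuz fuv eq_sym -fzv vz.
  have {}ltab : b < a by move: ab; rewrite ltnNge ltab.
  have au' : u != a :> nat by rewrite ltn_eqF // (leq_ltn_trans bu).
  have av' : v != a :> nat by rewrite ltn_eqF // (leq_ltn_trans bv).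
  rewrite !iv //; split=> // T f /esym /eqP fuv fuz fzv.
  have uz : (u, inord a) \in A by move: aA; rewrite vi // (negbTE au') orbF.
  have : (inord a, v) \notin A.
    by apply: contraTN ltab => h; rewrite -leqNgt -[a](@inordK N) // bmax // sA h.
  by rewrite fzv -fuv eq_sym -fuz uz.
rewrite [false == _]eq_sym eqbF_neg negbK => /eqP ab; rewrite -{}ab {b} in bn bS bA bmax bv *.
have au' : u != a :> nat.
  apply/eqP => e; move: bA; rewrite -e inord_val sA (negbTE uvA) /= => /eqP vu.
  by rewrite vu eqxx in uv.
have av' : v != a :> nat.
  apply/eqP => e; move: aA; rewrite -e inord_val (negbTE uvA) /= => /eqP vu.
  by rewrite vu eqxx in uv.
rewrite !iv //; split=> // T f fuv fuz fzv.
move: aA bA; rewrite !vi // (negbTE au') (negbTE av') !orbF => uz vz.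
rewrite uz in fuz; rewrite sA vz in fzv.
by rewrite (eqP (esym fuz)) -fzv in fuv.
Qed.

Section InnerWalk.

Variables (k : nat) (G H : {set V * V}) (D W : {set V}).
Let S := W :|: D.

(** Inside [W] a completion is forced to agree with [H]. Starting from [H] there leaves only pairs
    on which the completion differs from the layer, at most 2k of them. *)
Definition start_graph : {set V * V} :=
  [set p | if (p.1 \in W) && (p.2 \in W) then p \in H else p \in G].

Definition inner_step A (c : nat) :=
  if last_violation S A is Some q then toggle A (edit_of S A (pair_of q) c) else A.

Fixpoint inner_walk (g : nat -> nat) t : {set V * V} :=
  if t is t'.+1 then inner_step (inner_walk g t') (g t') else start_graph.

Definition inner_goal A :=
  [&& last_violation S A == None, diffs W A H == set0 & #|diffs S A G| <= k.*2].

Definition inner_success g :=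
  [exists t : 'I_k.*2.+1, inner_goal (inner_walk g t)].

Lemma no_violation_label A : last_violation S A = None ->
  diffs S A (same_label (rep S A)) = set0.
Proof.
move=> none; apply/eqP/diffs0P => x y xS yS xy.
have := last_sat_none none (pair_code_lt x y).
by rewrite pair_ofK /violation /= xS yS xy /= negbK in_same_label => /eqP.
Qed.

Lemma diffsC (U : {set V}) A B : diffs U A B = diffs U B A.
Proof. by apply/setP => -[x y]; rewrite !in_diffs [(_ \in A) == _]eq_sym. Qed.

Lemma eq_diffsl (U : {set V}) A B C : diffs U A B = set0 -> diffs U A C = diffs U B C.
Proof.
move/eqP/diffs0P => e; apply/setP => -[x y]; rewrite !in_diffs.
by case: (boolP (x \in U)) => //= xU; case: (boolP (y \in U)) => //= yU;
   case: (boolP (x != y)) => //= xy; rewrite e.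
Qed.

Lemma subset_diffs0 (U U' : {set V}) A B : U' \subset U ->
  diffs U A B = set0 -> diffs U' A B = set0.
Proof.
move=> /subsetP sU /eqP/diffs0P e; apply/eqP/diffs0P => x y /sU xU /sU yU; exact: e.
Qed.

Lemma inner_sound A : inner_goal A -> completable k G H D W.
Proof.
case/and3P => /eqP /no_violation_label e0 /eqP e1 le.
apply: (@completableP _ _ _ _ _ _ _ (rep S A)).
  rewrite -e1; symmetry; apply: eq_diffsl; apply: subset_diffs0 e0; exact: subsetUl.
by rewrite -(eq_diffsl _ e0).
Qed.

Section Complete.

Hypotheses (symG : symmetric_pairs G) (symH : symmetric_pairs H).
Variable f : V -> V.
Hypothesis fH : diffs W (same_label f) H = set0.
Hypothesis fG : #|diffs S (same_label f) G| <= k.*2.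
Let F := same_label f.

(** A walk towards [F] may stop early at a different cluster graph. Lying between the start and [F],
    that graph still agrees with [H] on [W] and differs from the layer only where [F] does. *)
Let between A := forall p, p \in dpairs S ->
  (p \in A) = (p \in F) \/ (p \in A) = (p \in start_graph).

Lemma start_graph_sym : symmetric_pairs start_graph.
Proof. by move=> x y; rewrite !inE /= andbC symH symG. Qed.

Lemma card_start : #|diffs S start_graph F| <= k.*2.
Proof.
apply: leq_trans fG; apply/subset_leq_card/subsetP => -[x y].
rewrite !in_diffs !inE /= => /and4P [-> -> xy]; rewrite xy /=.
case: ifP => [/andP [xW yW]|_]; last by rewrite eq_sym.
by move/eqP/diffs0P: fH => <- //; rewrite in_same_label eqxx.
Qed.

Lemma between_goal A : between A -> last_violation S A = None -> inner_goal A.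
Proof.
move=> bA none; rewrite /inner_goal none eqxx /=.
have SW x : x \in W -> x \in S by move=> xW; rewrite inE xW.
apply/andP; split.
  apply/diffs0P => x y xW yW xy; have /diffs0P e := introT eqP fH.
  have := bA (x, y); rewrite !inE /= xW yW xy => /(_ isT) [->|//].
  by rewrite -e // in_same_label.
apply: leq_trans fG; apply/subset_leq_card/subsetP => -[x y].
rewrite !in_diffs => /and4P [xS yS xy]; rewrite xS yS xy /=.
have := bA (x, y); rewrite inE /= xS yS xy => /(_ isT) [-> //|->].
rewrite inE /=; case: ifP => [/andP [xW yW]|_]; last by rewrite eqxx.
by move/eqP/diffs0P: fH => ->.
Qed.

(** The labelling [f] cannot agree with [A] on all three pairs of the violated triple, so one of the
    three edits reduces the distance to [F]. *)
Lemma edit_towards A q : symmetric_pairs A -> last_violation S A = Some q ->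
  exists2 c, c < 3 & edit_of S A (pair_of q) c \in diffs S A F.
Proof.
move=> sA /last_sat_some [_ vio _].
have [_ zS zx zy fool] := third_spec sA vio.
move: vio zS zx zy fool; case: (pair_of q) => x y.
rewrite /violation => /and4P [/= xS yS xy _].
set z := inord _ => zS zx zy fool.
have h a b : a \in S -> b \in S -> a != b -> (a, b) \notin diffs S A F ->
    ((a, b) \in A) = (f a == f b).
  by move=> aS bS ab; rewrite in_diffs aS bS ab /= negbK in_same_label => /eqP.
case: (boolP ((x, y) \in diffs S A F)) => [|nxy]; first by exists 0.
case: (boolP ((x, z) \in diffs S A F)) => [|nxz]; first by exists 1.
case: (boolP ((z, y) \in diffs S A F)) => [|nzy]; first by exists 2.
by case: (fool _ f); rewrite h // eq_sym.
Qed.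

Lemma inner_walk_ext g g' t : (forall i, i < t -> g i = g' i) ->
  inner_walk g t = inner_walk g' t.
Proof.
elim: t => //= t IH e; rewrite e // IH // => i it; apply: e; exact: ltnW.
Qed.

(** The guide is built digit by digit. Distance to [F] plus steps made never exceeds 2k, so at
    [t = k.*2.+1] only the success alternative is possible. *)
Lemma inner_complete_upto t : t <= k.*2.+1 ->
  exists g, (forall i, g i < 3) /\
    ((exists2 s, s < t & inner_goal (inner_walk g s)) \/
     let A := inner_walk g t in
     [/\ symmetric_pairs A, between A & #|diffs S A F| + t <= k.*2]).
Proof.
elim: t => [|t IH] tk.
  exists (fun=> 0); split=> //; right; split; last by rewrite addn0 card_start.
    exact: start_graph_sym.
  by move=> p _; right.
have [g [g3 [[s st goal]|/= [sA bA le]]]] := IH (ltnW tk).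
  by exists g; split=> //; left; exists s; first exact: ltnW.
case E: (last_violation S (inner_walk g t)) => [q|]; last first.
  by exists g; split=> //; left; exists t => //; apply: between_goal.
have [c c3 cd] := edit_towards sA E.
exists (fun i => if i == t then c else g i); split; first by move=> i; case: ifP.
right; rewrite /= eqxx (@inner_walk_ext _ g); last by move=> i; rewrite ltn_neqAle => /andP [/negbTE ->].
rewrite /inner_step E; case: edit_of cd => x y cd.
split; first exact: toggle_sym.
- move: cd; rewrite in_diffs => /and4P [xS yS xy ne] [u v] uvS; rewrite in_toggle //.
  case: (boolP (_ || _)) => [|_]; last by rewrite addbF; apply: bA.
  rewrite addbT => /orP [] /eqP [-> ->]; left.
    by move: ne; do 2!case: (_ \in _).
  by rewrite sA same_label_sym; move: ne; do 2!case: (_ \in _).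
- by rewrite addnS; apply: leq_trans le; rewrite ltn_add2r card_toggle //; apply: same_label_sym.
Qed.

End Complete.

Lemma inner_searchP : symmetric_pairs G -> symmetric_pairs H ->
  reflect (exists2 g, (forall i, g i < 3) & inner_success g) (completable k G H D W).
Proof.
move=> sG sH; apply: (iffP idP) => [/completable_witness [f [fH fG]]|]; last first.
  by case=> g _ /existsP [t]; apply: inner_sound.
have [g [g3 [[s st goal]|[_ _]]]] := inner_complete_upto sG sH fH fG (leqnn _); last by lia.
by exists g => //; apply/existsP; exists (Ordinal st).
Qed.

End InnerWalk.
End Search.

Lemma subset_diffs (V : finType) (S S' : {set V}) A G : S' \subset S ->
  diffs S' A G \subset diffs S A G.
Proof.
move=> /subsetP sS; apply/subsetP => -[x y]; rewrite !in_diffs.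
by case/and4P => /sS -> /sS -> -> ->.
Qed.

Lemma completable_sub (V : finType) k (G H : {set V * V}) (D W W' : {set V}) :
  W' \subset W -> completable k G H D W -> completable k G H D W'.
Proof.
move=> sW /completable_witness [f [fH fG]]; apply: (@completableP _ _ _ _ _ _ _ f).
  by apply/eqP; rewrite -subset0 -fH subset_diffs.
by apply: leq_trans fG; apply/subset_leq_card/subset_diffs/setSU.
Qed.

(** * The outer search over graphs and marked sets *)

(** The size bound of a minimal obstruction, so one digit can name any of its elements. The proof
    yields 32 k^2 + 50 k + 17; a power of two as constant makes it easy to bound by powers later. *)
Definition digit_base k := 64 * (k.+1 * k.+1).

Section OuterSearch.

Variable N : nat.
Notation n := N.+1.
Notation V := 'I_N.+1.
Implicit Types (S D W : {set V}) (A H : {set V * V}).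

Variables (l k d : nat) (Gs : nat -> {set V * V}).

Definition last_bad_layer H D :=
  last_sat (fun i => ~~ completable k (Gs i) H D (~: D)) l.

Fixpoint shrink (i : nat) H D (v : nat) : {set V} :=
  if v is v'.+1 then
    let U := shrink i H D v' in
    if (inord v' \in U) && ~~ completable k (Gs i) H D (U :\ inord v')
    then U :\ inord v' else U
  else ~: D.

Definition listing W : seq nat := [seq v <- iota 0 n | inord v \in W].

(** Marking and toggling share one format, a pair of positions in the obstruction, so a single base
    serves for all digits and a walk of [t] steps reads [t.*2] of them. *)
Definition outer_step (HD : {set V * V} * {set V}) (a b : nat) :=
  let: (H, D) := HD in
  if last_bad_layer H D is Some i then
    let L := listing (shrink i H D n) in
    if (a < size L) && (b < size L) then
      let x := nth 0 L a in let y := nth 0 L b in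
      if x == y then (H, inord x |: D) else (toggle H (inord x, inord y), D)
    else (H, D)
  else (H, D).

Fixpoint outer_walk (g : nat -> nat) t : {set V * V} * {set V} :=
  if t is t'.+1 then outer_step (outer_walk g t') (g t'.*2) (g t'.*2.+1)
  else (Gs 0, set0).

Definition outer_goal (HD : {set V * V} * {set V}) :=
  (last_bad_layer HD.1 HD.2 == None) && (#|HD.2| <= d).

Definition outer_success g := [exists t : 'I_(k.*2 + d).+1, outer_goal (outer_walk g t)].

Definition solvable := exists (H : {set V * V}) D,
  #|D| <= d /\ forall i, i < l -> completable k (Gs i) H D (~: D).

Lemma listingP W (x : V) : x \in W ->
  exists2 a, a < size (listing W) & inord (nth 0 (listing W) a) = x.
Proof.
move=> xW; exists (index (val x) (listing W)).
  by rewrite index_mem mem_filter mem_iota inord_val xW /= ltn_ord.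
by rewrite nth_index ?inord_val // mem_filter mem_iota inord_val xW /= ltn_ord.
Qed.

Lemma size_listing W : size (listing W) = #|W|.
Proof.
rewrite cardE /listing -(size_map val); apply/perm_size/uniq_perm.
- by rewrite filter_uniq ?iota_uniq.
- by rewrite map_inj_uniq ?enum_uniq //; apply: val_inj.
move=> v; rewrite mem_filter mem_iota add0n leq0n /=; apply/andP/mapP.
  by case=> vW vn; exists (inord v); rewrite ?mem_enum //= inordK.
by case=> x; rewrite mem_enum => xW ->; rewrite inord_val xW ltn_ord.
Qed.

Lemma listing_lt W a : a < size (listing W) -> nth 0 (listing W) a < n.
Proof. by move/(mem_nth 0); rewrite mem_filter mem_iota => /andP []. Qed.

Lemma shrink_le i H D u v : u <= v -> shrink i H D v \subset shrink i H D u.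
Proof.
elim: v => [|v IH]; first by rewrite leqn0 => /eqP ->.
rewrite leq_eqVlt => /predU1P [-> //|/IH sub]; apply: subset_trans sub => /=.
by case: ifP => // _; apply: subD1set.
Qed.

Lemma shrink_not_completable i H D v : ~~ completable k (Gs i) H D (~: D) ->
  ~~ completable k (Gs i) H D (shrink i H D v).
Proof. by move=> nc; elim: v => //= v IH; case: ifP => // /andP []. Qed.

(** [w] was kept because the set without it was completable at that moment. The final set without
    [w] is even smaller, so monotonicity makes one greedy pass enough. *)
Lemma shrink_minimal i H D w : w \in shrink i H D n ->
  completable k (Gs i) H D (shrink i H D n :\ w).
Proof.
move=> wS; apply: (@completable_sub _ _ _ _ _ (shrink i H D w :\ w)).
  exact/setSD/shrink_le/ltnW/ltn_ord.
have w1 := subsetP (shrink_le i H D (ltn_ord w)) w wS.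
have w0 := subsetP (shrink_le i H D (leqnSn w)) w w1.
move: w1; rewrite /= inord_val w0 /=; case: ifP; first by rewrite !inE eqxx.
by move/negbT; rewrite negbK.
Qed.

Lemma shrink_disjoint i H D v : [disjoint shrink i H D v & D].
Proof.
by rewrite disjoints_subset; apply: (shrink_le i H D (leq0n v)).
Qed.

Lemma card_shrink i H D : symmetric_pairs (Gs i) -> symmetric_pairs H ->
  ~~ completable k (Gs i) H D (~: D) -> #|shrink i H D n| <= digit_base k.
Proof.
move=> sG sH nc; apply: (@card_minimal_obstruction _ _ (Gs i) H D) => //.
- exact: shrink_disjoint.
- exact: shrink_not_completable.
- exact: shrink_minimal.
Qed.

Lemma outer_walk_ext g g' t : (forall i, i < t.*2 -> g i = g' i) ->
  outer_walk g t = outer_walk g' t.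
Proof.
elim: t => //= t IH e; rewrite !e ?IH //; try lia.
by move=> i it; apply: e; lia.
Qed.

Section Complete.

Hypothesis symG : forall i, i < l -> symmetric_pairs (Gs i).
Hypothesis l_gt0 : 0 < l.
Variables (F : {set V * V}) (Ds : {set V}).
Hypothesis symF : symmetric_pairs F.
Hypothesis FG : #|diffs [set: V] (Gs 0) F| <= k.*2.
Hypothesis Dsd : #|Ds| <= d.
Hypothesis sol : forall i, i < l -> completable k (Gs i) F Ds (~: Ds).

(** Otherwise [W] avoids [Ds] and [H] equals [F] on [W]; the completion belonging to [F] and [Ds],
    restricted to [W :|: D], would then complete [W]. *)
Lemma obstruction_hit i H D W : i < l -> D \subset Ds ->
  ~~ completable k (Gs i) H D W ->
  (exists2 w, w \in W & w \in Ds) \/ (exists p, p \in diffs W H F).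
Proof.
move=> il DDs nc; case: (boolP [exists w in W, w \in Ds]) => [/exists_inP|nD]; first by left.
right; apply/set0Pn; apply: contra nc => /eqP e.
have WD : W \subset ~: Ds.
  by apply/subsetP => w wW; rewrite inE; apply: contra nD => wD; apply/exists_inP; exists w.
have [f [fH fG]] := completable_witness (sol il).
apply: (@completableP _ _ _ _ _ _ _ f).
  rewrite diffsC (eq_diffsl _ e) diffsC.
  by apply/eqP; rewrite -subset0 -fH subset_diffs.
apply: leq_trans fG; apply/subset_leq_card/subset_diffs/setUSS => //.
Qed.

(** Marks are placed only inside [Ds], so a walk that runs out of bad layers early has at most [d]
    of them and is accepted. Otherwise each step consumes one unit of the potential. *)
Lemma outer_complete_upto t : t <= (k.*2 + d).+1 ->
  exists g, (forall i, g i < digit_base k) /\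
    ((exists2 s, s < t & outer_goal (outer_walk g s)) \/
     let HD := outer_walk g t in
     [/\ symmetric_pairs HD.1, HD.2 \subset Ds &
      #|diffs [set: V] HD.1 F| + #|Ds :\: HD.2| + t <= k.*2 + d]).
Proof.
elim: t => [|t IH] tk.
  exists (fun=> 0); split=> //; right; split=> /=; [exact: symG| exact: sub0set|].
  by rewrite addn0 setD0 leq_add.
have [g [gb [[s st goal]|/= [sH DD le]]]] := IH (ltnW tk).
  by exists g; split=> //; left; exists s; first exact: ltnW.
move E: (outer_walk g t) sH DD le => [H D] /= sH DD le.
case B: (last_bad_layer H D) => [i|]; last first.
  exists g; split=> //; left; exists t => //; rewrite /outer_goal E /= B eqxx /=.
  exact: leq_trans (subset_leq_card DD) Dsd.
have [il nc _] := last_sat_some B.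
have small := card_shrink (symG il) sH nc; rewrite -size_listing in small.
have notc := shrink_not_completable n nc.
pose g' a b (j : nat) : nat := if j == t.*2 then a else if j == t.*2.+1 then b else g j.
have g'b a b : a < digit_base k -> b < digit_base k -> forall j, g' a b j < digit_base k.
  by move=> ? ? j; rewrite /g'; do 2!case: ifP => //.
have walk' a b : outer_step (outer_walk (g' a b) t) (g' a b t.*2) (g' a b t.*2.+1) =
    outer_step (H, D) a b.
  rewrite (@outer_walk_ext _ g) ?E; last by move=> j jt; rewrite /g' !ltn_eqF //; lia.
  by rewrite /g' eqxx eqn_leq ltnn /= eqxx.
case: (obstruction_hit il DD notc) => [[w wW wD]|[[x y] xyd]].
  (* Repeating one position encodes marking the vertex at that position. *)
  have [a aL aw] := listingP wW; exists (g' a a); split.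
    by apply: g'b; apply: leq_trans small.
  right; rewrite walk' /= B aL /= eqxx /= aw; split=> //.
    by rewrite subUset sub1set wD DD.
  have wnD : w \notin D.
    by rewrite (disjointFr (shrink_disjoint i H D n) wW).
  have -> : Ds :\: (w |: D) = (Ds :\: D) :\ w.
    by apply/setP => v; rewrite !inE; case: (v == w).
  by have := cardsD1 w (Ds :\: D); rewrite inE wnD wD /= => h; rewrite h in le; lia.
move: (xyd); rewrite in_diffs => /and4P [xW yW xy _].
have [a aL ax] := listingP xW; have [b bL bY] := listingP yW.
exists (g' a b); split; first by apply: g'b; apply: leq_trans small.
right; rewrite walk' /= B aL bL /=; case: eqP => [e|_].
  by move: xy; rewrite -ax -bY e eqxx.
rewrite ax bY; split=> //=; first exact: toggle_sym.
rewrite addnS; apply: leq_trans le; rewrite !ltn_add2r card_toggle //.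
by apply: (subsetP (subset_diffs _ _ (subsetT _))) xyd.
Qed.

End Complete.

Lemma outer_searchP : 0 < l -> (forall i, i < l -> symmetric_pairs (Gs i)) ->
  (exists2 g, (forall i, g i < digit_base k) & outer_success g) <-> solvable.
Proof.
move=> l0 sG; split=> [[g _ /existsP [t /andP [/eqP none leD]]]|[H [D [leD sol]]]].
  exists (outer_walk g t).1, (outer_walk g t).2; split=> // i il.
  by have := last_sat_none none il; rewrite negbK.
(* The target is this completion of the first layer instead of [H]: off the marks they coincide, and
   its distance to the starting graph is at most 2k on all pairs. *)
have [f [fH fG]] := completable_witness (sol 0 l0).
have [|i il|g [gb [[s st goal]|[_ _]]]] :=
    outer_complete_upto sG l0 (same_label_sym f) _ leD _ (leqnn _).
- by rewrite diffsC; move: fG; rewrite setUC setUCr.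
- have [h [hH hG]] := completable_witness (sol i il).
  apply: (@completableP _ _ _ _ _ _ _ h) => //.
  by rewrite diffsC (eq_diffsl _ fH) diffsC.
- by exists g => //; apply/existsP; exists (Ordinal st).
- by rewrite -ltnS ltnNge leq_addl.
Qed.

End OuterSearch.

(** * From edge sets and clusterings to ordered pairs and labellings *)

Section EdgeSets.

Variable V : finType.
Implicit Types (E : {set {set V}}) (D : {set V}).

Definition pairs_of E : {set V * V} := [set p | [set p.1; p.2] \in E].

Definition edges_of (A : {set V * V}) : {set {set V}} :=
  [set [set p.1; p.2] | p in [set q in A | q.1 != q.2]].

Lemma in_pairs_of E x y : ((x, y) \in pairs_of E) = ([set x; y] \in E).
Proof. by rewrite inE. Qed.

Lemma pairs_of_sym E : symmetric_pairs (pairs_of E).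
Proof. by move=> x y; rewrite !in_pairs_of setUC. Qed.

Lemma set2_eq (x y u v : V) : [set x; y] = [set u; v] -> x != y ->
  (x = u /\ y = v) \/ (x = v /\ y = u).
Proof.
move=> /setP e xy; have := e x; have := e y; rewrite !inE !eqxx orbT /=.
move=> /esym /orP [] /eqP yE /esym /orP [] /eqP xE; subst; auto;
by rewrite eqxx in xy.
Qed.

Lemma in_edges_of A x y : symmetric_pairs A -> x != y ->
  ([set x; y] \in edges_of A) = ((x, y) \in A).
Proof.
move=> sA xy; apply/imsetP/idP => [[[u v]]|xyA].
  by rewrite inE /= => /andP [uvA uv] e; have [[-> ->]|[-> ->]] := set2_eq e xy; rewrite // sA.
by exists (x, y); rewrite // inE xyA.
Qed.

Lemma edges_of_pairs A : vertex_pairs (edges_of A).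
Proof. by move=> s /imsetP [[x y]]; rewrite inE => /andP [_ /= xy] ->; rewrite cards2 xy. Qed.

Lemma card2_set2 (e : {set V}) : #|e| = 2 -> exists x y, x != y /\ e = [set x; y].
Proof. by move/eqP/cards2P => [x [y [xy ->]]]; exists x, y. Qed.

Lemma eq_edge_sets E E' : vertex_pairs E -> vertex_pairs E' ->
  (forall x y, x != y -> ([set x; y] \in E) = ([set x; y] \in E')) -> E = E'.
Proof.
move=> vE vE' e; apply/setP => s; apply/idP/idP => sE.
  by have [x [y [xy se]]] := card2_set2 (vE s sE); rewrite se -e // -se.
by have [x [y [xy se]]] := card2_set2 (vE' s sE); rewrite se e // -se.
Qed.

Lemma in_symdiff E M s : (s \in symdiff E M) = (s \in E) (+) (s \in M).
Proof. by rewrite !inE; case: (s \in E); case: (s \in M). Qed.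

Lemma symdiff_pairs E M : vertex_pairs E -> vertex_pairs M -> vertex_pairs (symdiff E M).
Proof.
move=> vE vM s; rewrite in_symdiff.
by case: (boolP (s \in E)) => [/vE //|_]; rewrite addFb => /vM.
Qed.

Lemma symdiffK E M : symdiff E (symdiff E M) = M.
Proof. by apply/setP => s; rewrite !in_symdiff addKb. Qed.

(** The map from ordered pairs to their edge has fibres of size two. *)
Lemma card_edges (A : {set V * V}) (M : {set {set V}}) : vertex_pairs M ->
  (forall x y, ((x, y) \in A) = (x != y) && ([set x; y] \in M)) -> #|A| = #|M|.*2.
Proof.
move=> vM AM.
rewrite -sum1_card (partition_big (fun p : V * V => [set p.1; p.2]) (mem M)) /=; last first.
  by case=> x y; rewrite AM => /andP [].
rewrite (eq_bigr (fun=> 2)) => [|s sM]; first by rewrite sum_nat_const muln2.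
have [x [y [xy se]]] := card2_set2 (vM s sM).
rewrite sum1_card (_ : 2 = #|[set (x, y); (y, x)]|); last first.
  by rewrite cards2 xpair_eqE (negbTE xy).
apply: eq_card => -[u v]; rewrite !inE /= -topredE /= AM.
apply/andP/orP => [[/andP [uv _] /eqP]|[] /eqP [-> ->]].
- by rewrite se => /set2_eq /(_ uv) [] [-> ->]; rewrite eqxx; [left|right].
- by rewrite xy -se sM eqxx.
- by rewrite eq_sym xy setUC -se sM eqxx.
Qed.

Lemma card_edits E F : vertex_pairs E -> symmetric_pairs F ->
  #|diffs [set: V] F (pairs_of E)| = #|symdiff E (edges_of F)|.*2.
Proof.
move=> vE sF; apply: card_edges.
  by apply: symdiff_pairs => //; apply: edges_of_pairs.
move=> x y; rewrite in_symdiff in_diffs !in_setT /=; case: eqVneq => //= xy.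
rewrite in_edges_of // in_pairs_of.
by case: (_ \in _); case: (_ \in _).
Qed.

Lemma same_label_cluster (f : V -> V) : cluster_graph (edges_of (same_label f)).
Proof.
exists (preim_partition f [set: V]); split; first exact: preim_partitionP.
have tr : {in [set: V] & &, equivalence_rel (fun x y => f x == f y)}.
  by split=> // /eqP ->.
move=> s; split=> [sE|[s2 [C CP sC]]].
  split; first exact: edges_of_pairs sE.
  move: sE => /imsetP [[x y]]; rewrite inE in_same_label /= => /andP [fxy xy] ->.
  exists (pblock (preim_partition f [set: V]) x).
    by rewrite pblock_mem // (cover_partition (preim_partitionP _ _)) inE.
  apply/subsetP => z; rewrite !inE => zxy.
  rewrite pblock_equivalence_partition ?inE //.
  by case/orP: zxy => /eqP ->.
have [x [y [xy se]]] := card2_set2 s2; rewrite se in_edges_of //; last exact: same_label_sym.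
have tP := preim_partitionP f [set: V].
have xC : x \in C by apply: (subsetP sC); rewrite se !inE eqxx.
have yC : y \in C by apply: (subsetP sC); rewrite se !inE eqxx orbT.
have := pblock_equivalence_partition tr (in_setT x) (in_setT y).
have /and3P [_ triv _] := tP.
by rewrite -/(preim_partition f [set: V]) (def_pblock triv CP xC) yC in_same_label.
Qed.

(** Each vertex is labelled by its block, so the label type here is [{set V}] and not [V]. *)
Lemma cluster_label E : cluster_graph E -> vertex_pairs E ->
  exists T : eqType, exists f : V -> T, E = edges_of (same_label f).
Proof.
case=> P [partP EP] vE; exists {set V}, (pblock P).
have /and3P [_ triv _] := partP.
have cov x : x \in cover P by rewrite (cover_partition partP) inE.
apply: eq_edge_sets => //; first exact: edges_of_pairs.
move=> x y xy; rewrite in_edges_of ?in_same_label //; last exact: same_label_sym.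
apply/idP/eqP => [/EP [_ [C CP sC]]|e].
  have xC : x \in C by apply: (subsetP sC); rewrite !inE eqxx.
  have yC : y \in C by apply: (subsetP sC); rewrite !inE eqxx orbT.
  by rewrite (def_pblock triv CP xC) (def_pblock triv CP yC).
apply/EP; split; first by rewrite cards2 xy.
exists (pblock P x); first by rewrite pblock_mem.
by apply/subsetP => z; rewrite !inE => /orP [] /eqP ->; last rewrite e; rewrite mem_pblock.
Qed.

Lemma in_edges_avoiding E D x y :
  ([set x; y] \in edges_avoiding E D) = [&& [set x; y] \in E, x \notin D & y \notin D].
Proof. by rewrite !inE subUset !sub1set !inE. Qed.

Lemma edges_avoiding_pairs E D : vertex_pairs E -> vertex_pairs (edges_avoiding E D).
Proof. by move=> vE s; rewrite inE => /andP [/vE]. Qed.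

End EdgeSets.

Definition layer_pairs (V : finType) l (G : 'I_l -> {set {set V}}) (i : nat) : {set V * V} :=
  if insub i is Some j then pairs_of (G j) else set0.

Lemma layer_pairsE (V : finType) l (G : 'I_l -> {set {set V}}) (i : 'I_l) :
  layer_pairs G i = pairs_of (G i).
Proof. by rewrite /layer_pairs valK. Qed.

Lemma layer_pairs_sym (V : finType) l (G : 'I_l -> {set {set V}}) i :
  symmetric_pairs (layer_pairs G i).
Proof.
rewrite /layer_pairs; case: insubP => [j _ _|_]; first exact: pairs_of_sym.
by move=> x y; rewrite !inE.
Qed.

Lemma MLCE_solvableP N l (G : 'I_l -> {set {set 'I_N.+1}}) k d : 0 < l -> multilayer_graph G ->
  MLCE G k d <-> solvable l k d (layer_pairs G).
Proof.
move=> l0 mG; split=> [[M [clG bM [D [Dd cons]]]]|[H [D [Dd comp]]]].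
  pose E i := symdiff (G i) (M i).
  have vM i : vertex_pairs (M i) by case: (clG i).
  have vE i : vertex_pairs (E i) by apply: symdiff_pairs.
  (* Any edited layer could serve as [H], since all of them agree outside [D]. *)
  exists (pairs_of (E (Ordinal l0))), D; split=> // i il.
  rewrite -[i]/(val (Ordinal il)) layer_pairsE; move: (Ordinal il) => {il}i.
  have [T [f fE]] := cluster_label (proj2 (clG i)) (vE i).
  apply: (@completableP _ _ _ _ _ _ _ f).
    apply/eqP/diffs0P => x y; rewrite !in_setC => xD yD xy.
    rewrite in_pairs_of -(in_edges_of (same_label_sym f)) // -fE.
    move/setP: (cons i (Ordinal l0)) => /(_ [set x; y]).
    by rewrite !in_edges_avoiding xD yD !andbT.
  rewrite setUC setUCr card_edits ?leq_double; [|exact: mG|exact: same_label_sym].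
  by rewrite -fE symdiffK; apply: bM.
(* One labelling is chosen per layer; common agreement with [H] outside [D] makes the resulting
   clusterings consistent. *)
have [f fP] : exists f : 'I_l -> {ffun 'I_N.+1 -> 'I_N.+1},
    forall i, (diffs (~: D) (same_label (f i)) H == set0) &&
      (#|diffs (~: D :|: D) (same_label (f i)) (pairs_of (G i))| <= k.*2).
  pose P i (f : {ffun 'I_N.+1 -> 'I_N.+1}) := (diffs (~: D) (same_label f) H == set0) &&
      (#|diffs (~: D :|: D) (same_label f) (pairs_of (G i))| <= k.*2).
  have lab i : exists f, P i f.
    by have /existsP [f fP] := comp i (ltn_ord i); exists f; rewrite /P -layer_pairsE.
  by exists (fun i => xchoose (lab i)) => i; apply: (xchooseP (lab i)).
exists (fun i => symdiff (G i) (edges_of (same_label (f i)))); split.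
- move=> i; split; first by apply: symdiff_pairs => //; apply: edges_of_pairs.
  by rewrite symdiffK; apply: same_label_cluster.
- move=> i; have /andP [_] := fP i; rewrite setUC setUCr.
  by rewrite (card_edits (mG i) (same_label_sym (f i))) leq_double.
exists D; split=> // i j; rewrite !symdiffK; apply: eq_edge_sets.
- apply: edges_avoiding_pairs; exact: edges_of_pairs.
- apply: edges_avoiding_pairs; exact: edges_of_pairs.
move=> x y xy; rewrite !in_edges_avoiding !in_edges_of //; try exact: same_label_sym.
case: (boolP (x \in D)); case: (boolP (y \in D)) => yD xD; rewrite ?andbF //.
have /andP [/diffs0P ei _] := fP i; have /andP [/diffs0P ej _] := fP j.
by rewrite ei ?ej // inE.
Qed.

(** * A loop language with arrays, compiled to the word RAM *)

Inductive hexp :=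
  | HC of nat
  | HN | HL | HK | HD
  | HA of nat & hexp
  | HI of hexp
  | HO of binop & hexp & hexp.

(** [HDig] carries its initialisation and its increment as subprograms, so that semantics, time
    bound and compilation recurse on them like on any command. *)
Inductive hcmd :=
  | HSkip
  | HSet of nat & hexp & hexp
  | HInc of nat & hexp & hexp
  | HSeq of hcmd & hcmd
  | HIf of hexp & hcmd & hcmd
  | HFor of nat & hexp & hcmd
  | HDig of nat & nat & nat & hexp & hexp & hcmd & hcmd & hcmd.

Record inst := Inst { i_n : nat; i_l : nat; i_k : nat; i_d : nat; i_in : nat -> nat }.

(* The cell [a] at index [i]; scalar variables live at index 0. *)
Definition state := nat -> nat -> nat.

Definition upd (s : state) a i v : state :=
  fun b j => if (b == a) && (j == i) then v else s b j.

Notation HV a := (HA a (HC 0)).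

Section Semantics.

Variable I : inst.

Definition cells := i_l I * i_n I * i_n I.

(* Out-of-range input indices wrap around. *)
Fixpoint ev (s : state) (e : hexp) : nat :=
  match e with
  | HC c => c
  | HN => i_n I
  | HL => i_l I
  | HK => i_k I
  | HD => i_d I
  | HA a e => s a (ev s e)
  | HI e => i_in I (ev s e %% cells)
  | HO o e1 e2 => binop_fun o (ev s e1) (ev s e2)
  end.

Definition zero_state : state := fun _ _ => 0.

(** Loop bounds are read in the zero state. For [pure] expressions this is their value in every
    state, so iteration counts depend on the instance alone. *)
Definition hval (e : hexp) := ev zero_state e.

(* [HInc a e b] saturates at the static bound [b].  [HDig] is only used through
   [digits_loop], where [zero] and [inc] make [a] run through all strings of [len]
   digits in base [b]. *)
Fixpoint run (c : hcmd) (s : state) : state :=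
  match c with
  | HSkip => s
  | HSet a e1 e2 => upd s a (ev s e1) (ev s e2)
  | HInc a e b => upd s a (ev s e) (s a (ev s e) + (s a (ev s e) < hval b))
  | HSeq c1 c2 => run c2 (run c1 s)
  | HIf e c1 c2 => if ev s e != 0 then run c1 s else run c2 s
  | HFor v b c =>
      upd (iteri (hval b) (fun i t => run c (upd t v 0 i)) s) v 0 (hval b)
  | HDig a cv jv b len zero inc c =>
      iter (hval b ^ hval len) (fun t => run inc (run c t)) (run zero s)
  end.

End Semantics.

Arguments run : simpl never.

Definition digits_zero a cv jv len :=
  HSeq (HSet cv (HC 0) (HC 0)) (HFor jv len (HSet a (HV jv) (HC 0))).

(** [cv] is the carry. If it survives the last digit, the odometer has wrapped around, and this is
    the exit signal of the compiled loop. *)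
Definition digits_inc a cv jv b len :=
  HSeq (HSet cv (HC 0) (HC 1))
    (HFor jv len
      (HIf (HV cv)
        (HIf (HO OLt (HO OAdd (HA a (HV jv)) (HC 1)) b)
          (HSeq (HInc a (HV jv) b) (HSet cv (HC 0) (HC 0)))
          (HSet a (HV jv) (HC 0)))
        HSkip)).

Definition digits_loop a cv jv b len c :=
  HDig a cv jv b len (digits_zero a cv jv len) (digits_inc a cv jv b len) c.

Definition digit b j i := (j %/ b ^ i) %% b.

Fixpoint writes (c : hcmd) : seq nat :=
  match c with
  | HSkip => [::]
  | HSet a _ _ | HInc a _ _ => [:: a]
  | HSeq c1 c2 | HIf _ c1 c2 => writes c1 ++ writes c2
  | HFor v _ c => v :: writes c
  | HDig _ _ _ _ _ zero inc c => writes zero ++ writes inc ++ writes c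
  end.

Fixpoint pure (e : hexp) : bool :=
  match e with
  | HA _ _ | HI _ => false
  | HO _ e1 e2 => pure e1 && pure e2
  | _ => true
  end.

(** * Frame rule, loop invariants and the odometer *)

Section Run.

Variable I : inst.
Implicit Types (s t : state) (c : hcmd).

Lemma run_skip s : run I HSkip s = s.
Proof. by []. Qed.

Lemma run_seq c1 c2 s : run I (HSeq c1 c2) s = run I c2 (run I c1 s).
Proof. by []. Qed.

Lemma run_set a e1 e2 s : run I (HSet a e1 e2) s = upd s a (ev I s e1) (ev I s e2).
Proof. by []. Qed.

Lemma run_inc a e b s : run I (HInc a e b) s =
  upd s a (ev I s e) (s a (ev I s e) + (s a (ev I s e) < hval I b)).
Proof. by []. Qed.

Lemma run_if e c1 c2 s :
  run I (HIf e c1 c2) s = if ev I s e != 0 then run I c1 s else run I c2 s.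
Proof. by []. Qed.

Lemma run_forE v b c s : run I (HFor v b c) s =
  upd (iteri (hval I b) (fun i t => run I c (upd t v 0 i)) s) v 0 (hval I b).
Proof. by []. Qed.

Lemma run_digE a cv jv b len zero inc c s : run I (HDig a cv jv b len zero inc c) s =
  iter (hval I b ^ hval I len) (fun t => run I inc (run I c t)) (run I zero s).
Proof. by []. Qed.

Lemma upd_same s a i v : upd s a i v a i = v.
Proof. by rewrite /upd !eqxx. Qed.

Lemma upd_other s a i v b j : b != a -> upd s a i v b j = s b j.
Proof. by move=> /negbTE ba; rewrite /upd ba. Qed.

Lemma ev_pure s e : pure e -> ev I s e = hval I e.
Proof. by elim: e => //= o e1 IH1 e2 IH2 /andP [/IH1 -> /IH2 ->]. Qed.

Lemma iteri_ind (P : nat -> state -> Prop) (f : nat -> state -> state) b s :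
  P 0 s -> (forall i t, i < b -> P i t -> P i.+1 (f i t)) -> P b (iteri b f s).
Proof.
move=> P0; elim: b => // b IH PS /=; apply: (PS) => //; apply: IH => i t ib.
by apply: PS; apply: ltnW.
Qed.

Lemma iter_ind (P : nat -> state -> Prop) (f : state -> state) b s :
  P 0 s -> (forall i t, i < b -> P i t -> P i.+1 (f t)) -> P b (iter b f s).
Proof.
move=> P0; elim: b => // b IH PS /=; apply: (PS) => //; apply: IH => i t ib.
by apply: PS; apply: ltnW.
Qed.

Lemma run_frame c s a i : a \notin writes c -> run I c s a i = s a i.
Proof.
elim: c s => //=.
- by move=> b e1 e2 s; rewrite inE => ab; rewrite run_set upd_other.
- by move=> b e1 e2 s; rewrite inE => ab; rewrite run_inc upd_other.
- move=> c1 IH1 c2 IH2 s; rewrite mem_cat negb_or => /andP [a1 a2].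
  by rewrite run_seq IH2 // IH1.
- move=> e c1 IH1 c2 IH2 s; rewrite mem_cat negb_or => /andP [a1 a2].
  by rewrite run_if; case: ifP => _; [apply: IH1|apply: IH2].
- move=> v b c IH s; rewrite inE negb_or => /andP [av ac].
  rewrite run_forE upd_other //.
  apply: (@iteri_ind (fun _ t => t a i = s a i)) => // j t _ <-.
  by rewrite IH // upd_other.
move=> b cv jv base len zero IHz inc IHi c IH s.
rewrite !mem_cat !negb_or => /and3P [az ai ac]; rewrite run_digE.
apply: (@iter_ind (fun _ t => t a i = s a i)) => [|j t _ <-]; first exact: IHz.
by rewrite IHi // IH.
Qed.

Definition agree_off (w : seq nat) s t := forall a i, a \notin w -> t a i = s a i.

(** The invariant concerns the state before the counter is stored. Cells that the loop does not
    write come for free through [agree_off]. *)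
Lemma run_for (P : nat -> state -> Prop) v b c s :
  P 0 s ->
  (forall i t, i < hval I b -> agree_off (v :: writes c) s t -> P i t ->
     P i.+1 (run I c (upd t v 0 i))) ->
  exists2 t, P (hval I b) t & run I (HFor v b c) s = upd t v 0 (hval I b).
Proof.
move=> P0 PS; eexists; last by rewrite run_forE.
pose Q i t := P i t /\ agree_off (v :: writes c) s t.
suff [] : Q (hval I b) (iteri (hval I b) (fun i t => run I c (upd t v 0 i)) s) by [].
apply: iteri_ind => [//|i t ib [Pit ag]]; split; first exact: PS.
move=> a j; rewrite inE negb_or => /andP [av ac].
by rewrite run_frame // upd_other // ag // inE negb_or av.
Qed.

Lemma digits_zeroP a cv jv len s : a != cv -> a != jv -> cv != jv ->
  let t := run I (digits_zero a cv jv len) s in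
  t cv 0 = 0 /\ forall i, i < hval I len -> t a i = 0.
Proof.
move=> acv ajv cvjv /=; rewrite /digits_zero run_seq.
have [||t [t0 tz] ->] := @run_for (fun i t => t cv 0 = 0 /\ forall j, j < i -> t a j = 0)
  jv len (HSet a (HV jv) (HC 0)) (run I (HSet cv (HC 0) (HC 0)) s).
- by rewrite run_set upd_same; split.
- move=> i t _ _ [t0 tz]; rewrite run_set /= upd_same; split.
    by rewrite !upd_other // eq_sym.
  move=> j; rewrite ltnS leq_eqVlt => /predU1P [->|ji]; first by rewrite upd_same.
  by rewrite /upd; case: ifP => //; rewrite (negbTE ajv) /= tz.
rewrite upd_other //; split=> // i il; rewrite upd_other //; exact: tz.
Qed.

(** The carry of an increment reaches position [i] exactly when [b ^ i] divides [j.+1]. *)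
Lemma digit_succ b j i : 0 < b -> digit b j.+1 i =
  if b ^ i %| j.+1 then (if (digit b j i).+1 < b then (digit b j i).+1 else 0)
  else digit b j i.
Proof.
move=> b0; have bi : 0 < b ^ i by rewrite expn_gt0 b0.
rewrite /digit divnS //; case: (b ^ i %| j.+1); last by rewrite add0n.
rewrite add1n -addn1 -modnDml addn1; have := ltn_pmod (j %/ b ^ i) b0.
by rewrite leq_eqVlt => /predU1P [->|lt]; rewrite ?modnn ?ltnn // lt modn_small.
Qed.

Lemma dvdn_pow_succ b j i : 0 < b ->
  (b ^ i.+1 %| j.+1) = (b ^ i %| j.+1) && ~~ ((digit b j i).+1 < b).
Proof.
move=> b0; have bi : 0 < b ^ i by rewrite expn_gt0 b0.
case: (boolP (b ^ i %| j.+1)) => /= [dv|nd]; last first.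
  by apply: contraNF nd => /(dvdn_trans _) -> //; rewrite dvdn_exp2l.
rewrite expnSr -(divnK dv) [b ^ i * b]mulnC dvdn_pmul2r // divnS // dv add1n.
rewrite /digit /dvdn -addn1 -modnDml addn1; have := ltn_pmod (j %/ b ^ i) b0.
by rewrite leq_eqVlt => /predU1P [->|lt]; rewrite ?modnn ?ltnn // lt modn_small.
Qed.

Lemma digits_incP a cv jv b len j s : a != cv -> a != jv -> cv != jv -> pure b ->
  0 < hval I b -> (forall i, i < hval I len -> s a i = digit (hval I b) j i) ->
  let t := run I (digits_inc a cv jv b len) s in
  t cv 0 = (hval I b ^ hval I len %| j.+1) /\
  forall i, i < hval I len -> t a i = digit (hval I b) j.+1 i.
Proof.
move=> acv ajv cvjv pb b0 sd /=; rewrite /digits_inc run_seq.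
set c := HIf _ _ _; set s1 := run I _ s.
have s1a i : s1 a i = s a i by rewrite /s1 run_set upd_other.
(* Positions below [m] already show [j.+1], the others still show [j], and the carry is divisibility
   by the [m]-th power. *)
pose P m t := t cv 0 = (hval I b ^ m %| j.+1) /\
  forall i, i < hval I len -> t a i = digit (hval I b) (if i < m then j.+1 else j) i.
have [||t [tc td] ->] := @run_for P jv len c s1; last 1 first.
- by rewrite upd_other //; split=> // i il; rewrite upd_other // td // il.
- by rewrite /P /s1 run_set upd_same dvd1n; split=> // i il; rewrite upd_other // sd.
move=> m t ml _ [tc td].
have jc : jv != cv by rewrite eq_sym.
have ca : cv != a by rewrite eq_sym.
have ja : jv != a by rewrite eq_sym.
rewrite /c run_if /= !upd_other // tc.
have inr (r : state) : (forall i, i != m -> r a i = t a i) ->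
    r a m = digit (hval I b) j.+1 m ->
    forall i, i < hval I len -> r a i = digit (hval I b) (if i < m.+1 then j.+1 else j) i.
  move=> ri rm i il; have [->|im] := eqVneq i m; first by rewrite ltnSn.
  by rewrite ri // td // (ltnS i m) (leq_eqVlt i m) (negbTE im).
have tm : t a m = digit (hval I b) j m by rewrite td // ltnn.
rewrite /P dvdn_pow_succ //; case: (boolP (_ %| _)) => [dv|nd] /=; last first.
  rewrite !run_skip upd_other // tc (negbTE nd); split=> //.
  apply: inr => [i _|]; first by rewrite upd_other.
  by rewrite digit_succ // (negbTE nd) upd_other.
rewrite run_if /= upd_same !upd_other // (ev_pure _ pb) tm addn1.
case: ltnP => lt /=.
  rewrite run_seq run_inc run_set /= upd_same; split=> //.
  apply: inr => [i im|].
    by rewrite upd_other // upd_same /upd !eqxx /= (negbTE im) (negbTE ajv).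
  rewrite upd_other // upd_same !upd_same upd_other // tm digit_succ // dv lt.
  by rewrite (ltnW lt) addn1.
rewrite run_set /= upd_same !upd_other // tc dv; split=> //.
apply: inr => [i im|]; last by rewrite upd_same digit_succ // dv ltnNge lt.
by rewrite /upd !eqxx /= (negbTE im) (negbTE ajv).
Qed.

(** A positive count of at most [b ^ len] is divisible by [b ^ len] only if equal to it, so the
    carry is raised exactly after the last string. *)
Lemma digits_loop_iter a cv jv b len c s j :
  a != cv -> a != jv -> cv != jv -> pure b -> 0 < hval I b ->
  a \notin writes c -> j <= hval I b ^ hval I len ->
  let t := iter j (fun t => run I (digits_inc a cv jv b len) (run I c t))
             (run I (digits_zero a cv jv len) s) in
  t cv 0 = (j == hval I b ^ hval I len) && (0 < j) /\
  forall i, i < hval I len -> t a i = digit (hval I b) j i.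
Proof.
move=> acv ajv cvjv pb b0 ac; elim: j => [|j IH] jb.
  have [z0 zd] := digits_zeroP len s acv ajv cvjv.
  rewrite /= z0 ltnn andbF; split=> // i il; rewrite zd //.
  by rewrite /digit div0n mod0n.
have [tc td] := IH (ltnW jb); rewrite iterS /=.
set t := iter j _ _ in tc td *.
have [|-> ud] := @digits_incP a cv jv b len j (run I c t) acv ajv cvjv pb b0.
  by move=> i il; rewrite run_frame // td.
split=> //; rewrite andbT; congr nat_of_bool; apply/idP/eqP => [/dvdn_leq|->//].
by move=> /(_ isT) le; apply/eqP; rewrite eqn_leq jb le.
Qed.

(* The invariant P may only depend on the digits through the enumerated
   strings, hence the stability hypothesis. *)
Lemma run_digits (P : nat -> state -> Prop) a cv jv b len c s :
  a != cv -> a != jv -> cv != jv -> pure b -> 0 < hval I b -> a \notin writes c ->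
  (forall j t t', agree_off [:: a; cv; jv] t t' -> P j t -> P j t') ->
  P 0 s ->
  (forall j t, j < hval I b ^ hval I len ->
     agree_off (writes (digits_loop a cv jv b len c)) s t ->
     (forall i, i < hval I len -> t a i = digit (hval I b) j i) -> P j t ->
     P j.+1 (run I c t)) ->
  P (hval I b ^ hval I len) (run I (digits_loop a cv jv b len c) s).
Proof.
move=> acv ajv cvjv pb b0 ac stab P0 PS; rewrite run_digE.
set z := digits_zero a cv jv len; set inc := digits_inc a cv jv b len.
have wz : {subset writes z <= [:: a; cv; jv]}.
  by move=> x; rewrite !inE; do 3!case: eqP => //.
have wi : {subset writes inc <= [:: a; cv; jv]}.
  by move=> x; rewrite !inE; do 5!case: eqP => //.
have frz r : agree_off [:: a; cv; jv] r (run I z r).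
  by move=> x i xn; apply: run_frame; apply: contra xn => /wz.
have fri r : agree_off [:: a; cv; jv] r (run I inc r).
  by move=> x i xn; apply: run_frame; apply: contra xn => /wi.
have wloop : writes (digits_loop a cv jv b len c) = writes z ++ writes inc ++ writes c by [].
suff H j : j <= hval I b ^ hval I len ->
    let t := iter j (fun t => run I inc (run I c t)) (run I z s) in
    P j t /\ agree_off (writes (digits_loop a cv jv b len c)) s t.
  by have [] := H _ (leqnn _).
elim: j => [|j IH] jb.
  split; first exact: stab (frz s) P0.
  move=> x i; rewrite wloop mem_cat negb_or => /andP [xz _].
  exact: run_frame.
have [Pj ag] := IH (ltnW jb); rewrite iterS; cbv zeta.
have [_ td] := digits_loop_iter s acv ajv cvjv pb b0 ac (ltnW jb).
set t := iter j _ _ in Pj ag td *; split.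
  by apply: stab (fri _) _; apply: PS.
move=> x i xn; rewrite -(ag x i xn); move: xn.
rewrite wloop => xn.
have xi : x \notin writes inc.
  by apply: contra xn => xi; rewrite mem_cat; apply/orP; right; rewrite mem_cat xi.
have xc : x \notin writes c.
  by apply: contra xn => xc; rewrite mem_cat; apply/orP; right; rewrite mem_cat xc orbT.
by rewrite !run_frame.
Qed.

End Run.

Lemma digits_surj b len g : 0 < b -> (forall i, i < len -> g i < b) ->
  exists2 j, j < b ^ len & forall i, i < len -> digit b j i = g i.
Proof.
move=> b0; elim: len g => [|len IH] g gb; first by exists 0.
have [|j jb jg] := IH (fun i => g i.+1); first by move=> i; apply: (gb i.+1).
exists (g 0 + j * b).
  have := gb 0 isT; rewrite expnSr; move: jb; move: (b ^ len) => q; nia.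
case=> [|i] il; rewrite /digit.
  by rewrite expn0 divn1 addnC modnMDl modn_small // gb.
by rewrite expnS divnMA addnC divnMDl // (divn_small (gb 0 isT)) addn0; apply: jg.
Qed.

Lemma digit_lt b j i : 0 < b -> digit b j i < b.
Proof. exact: ltn_pmod. Qed.

(** * Compilation to the word RAM and its correctness *)

(** The program below uses the array names 0 to 30. *)
Definition narr := 32.

Definition cell_count_exp :=
  EOp OMul (EOp OMul (ELoad (EConst 1)) (ELoad (EConst 0))) (ELoad (EConst 0)).

(* The arrays are interleaved above the input. *)
Definition addr a e :=
  EOp OAdd (EOp OAdd (EConst 4) cell_count_exp)
           (EOp OAdd (EOp OMul (EConst narr) e) (EConst a)).

Fixpoint comp_exp (e : hexp) : expr :=
  match e with
  | HC c => EConst c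
  | HN => ELoad (EConst 0)
  | HL => ELoad (EConst 1)
  | HK => ELoad (EConst 2)
  | HD => ELoad (EConst 3)
  | HA a e => ELoad (addr a (comp_exp e))
  | HI e => ELoad (EOp OAdd (EConst 4) (EOp OMod (comp_exp e) cell_count_exp))
  | HO o e1 e2 => EOp o (comp_exp e1) (comp_exp e2)
  end.

Definition inc_exp a e b := HO OAdd (HA a e) (HO OLt (HA a e) b).

Fixpoint compile (c : hcmd) : cmd :=
  match c with
  | HSkip => CSkip
  | HSet a e1 e2 => CStore (addr a (comp_exp e1)) (comp_exp e2)
  | HInc a e b => CStore (addr a (comp_exp e)) (comp_exp (inc_exp a e b))
  | HSeq c1 c2 => CSeq (compile c1) (compile c2)
  | HIf e c1 c2 => CIf (comp_exp e) (compile c1) (compile c2)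
  | HFor v b c =>
      CSeq (CStore (addr v (EConst 0)) (EConst 0))
        (CWhile (comp_exp (HO OLt (HV v) b))
          (CSeq (compile c)
             (CStore (addr v (EConst 0)) (comp_exp (HO OAdd (HV v) (HC 1))))))
  | HDig a cv jv b len zero inc c =>
      CSeq (compile zero)
        (CWhile (comp_exp (HO OEq (HV cv) (HC 0))) (CSeq (compile c) (compile inc)))
  end.

Fixpoint wf_exp (e : hexp) : bool :=
  match e with
  | HA a e => (a < narr) && wf_exp e
  | HI e => wf_exp e
  | HO _ e1 e2 => wf_exp e1 && wf_exp e2
  | _ => true
  end.

(* Expressions whose value is bounded by that of the cells and parameters. *)
Fixpoint small (e : hexp) : bool :=
  match e with
  | HC c => c <= 2
  | HO (OEq | OLt) _ _ => true
  | HO (OSub | ODiv | OMod) e _ => small e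
  | HO (OAdd | OMul) _ _ => false
  | _ => true
  end.

Fixpoint wf (c : hcmd) : Prop :=
  match c with
  | HSkip => True
  | HSet a e1 e2 => [&& a < narr, wf_exp e1, wf_exp e2 & small e2]
  | HInc a e b => [&& a < narr, wf_exp e, wf_exp b & pure b]
  | HSeq c1 c2 => wf c1 /\ wf c2
  | HIf e c1 c2 => [/\ wf_exp e, wf c1 & wf c2]
  | HFor v b c => [&& v < narr, v \notin writes c, wf_exp b & pure b] /\ wf c
  | HDig a cv jv b len zero inc c =>
      [/\ [&& a != cv, a != jv, cv != jv, cv < narr, pure b & a \notin writes c],
          (zero = digits_zero a cv jv len /\ inc = digits_inc a cv jv b len),
          wf zero, wf inc & wf c]
  end.

(** Assignments to [small] expressions cannot exceed [X], so it remains to bound the limits of the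
    counters. *)
Fixpoint fits I X (c : hcmd) : Prop :=
  match c with
  | HSkip | HSet _ _ _ => True
  | HInc _ _ b => hval I b <= X
  | HSeq c1 c2 | HIf _ c1 c2 => fits I X c1 /\ fits I X c2
  | HFor _ b c => hval I b <= X /\ fits I X c
  | HDig _ _ _ b _ zero inc c => [/\ 0 < hval I b, fits I X zero, fits I X inc & fits I X c]
  end.

Section Time.

Variable I : inst.

(** A conditional is charged for both branches, so that the bound depends on the instance and not on
    the state. *)
Fixpoint time (c : hcmd) : nat :=
  match c with
  | HSkip => 1
  | HSet a e1 e2 => (cost (addr a (comp_exp e1)) + cost (comp_exp e2)).+1
  | HInc a e b => (cost (addr a (comp_exp e)) + cost (comp_exp (inc_exp a e b))).+1
  | HSeq c1 c2 => time c1 + time c2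
  | HIf e c1 c2 => (cost (comp_exp e) + (time c1 + time c2)).+1
  | HFor v b c =>
      (cost (addr v (EConst 0)) + cost (EConst 0)).+1 +
      (hval I b * (cost (comp_exp (HO OLt (HV v) b)) +
        (time c + (cost (addr v (EConst 0)) + cost (comp_exp (HO OAdd (HV v) (HC 1)))).+1)).+1
       + (cost (comp_exp (HO OLt (HV v) b))).+1)
  | HDig a cv jv b len zero inc c =>
      time zero +
      (hval I b ^ hval I len * (cost (comp_exp (HO OEq (HV cv) (HC 0))) + (time c + time inc)).+1
       + (cost (comp_exp (HO OEq (HV cv) (HC 0)))).+1)
  end.

End Time.

(** [0 < cells I] keeps wrapped input indices inside the input; empty inputs are answered separately
    by [solver]. *)
Record inst_ok (I : inst) (X : nat) : Prop := InstOk {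
  ok_X : 1 < X;
  ok_n : i_n I <= X;
  ok_l : i_l I <= X;
  ok_k : i_k I <= X;
  ok_d : i_d I <= X;
  ok_in : forall b, i_in I b <= X;
  ok_cells : 0 < cells I }.

Record mem_rep (I : inst) (s : state) (m : memory) : Prop := MemRep {
  rep_n : m 0 = i_n I;
  rep_l : m 1 = i_l I;
  rep_k : m 2 = i_k I;
  rep_d : m 3 = i_d I;
  rep_in : forall b, b < cells I -> m (4 + b) = i_in I b;
  rep_arr : forall a i, a < narr -> m (4 + cells I + (narr * i + a)) = s a i }.

Definition bounded_by (X : nat) (s : state) := forall a i, s a i <= X.

Lemma narr_code a b i j : a < narr -> b < narr ->
  (narr * i + a == narr * j + b) = (a == b) && (i == j).
Proof. by rewrite /narr; lia. Qed.

Lemma update_rep I s m a i v : a < narr -> mem_rep I s m ->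
  mem_rep I (upd s a i v) (update m (4 + cells I + (narr * i + a)) v).
Proof.
move=> an [mn ml mk md mi ma].
have low x : x < 4 + cells I -> update m (4 + cells I + (narr * i + a)) v x = m x.
  by move=> lt; rewrite /update ltn_eqF // ltn_addr.
split; rewrite ?low ?ltn_addr ?ltn_add2l //.
  by move=> b bI; rewrite low ?mi // ltn_add2l.
move=> b j bn; rewrite /update /upd eqn_add2l narr_code // ma //.
Qed.

Lemma wordT X w w' B v : 1 < X -> X ^ w < B -> w' <= w -> v <= X ^ w' -> word B v = Some v.
Proof.
move=> X1 wB ww vw; rewrite /word (leq_ltn_trans _ wB) //.
by apply: leq_trans vw _; rewrite leq_pexp2l // ltnW.
Qed.

(** Both powers are at least 2, so even a sum is bounded by their product. *)
Lemma binop_le o X w1 w2 x y : 1 < X -> 0 < w1 -> 0 < w2 -> x <= X ^ w1 -> y <= X ^ w2 ->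
  binop_fun o x y <= X ^ (w1 + w2).
Proof.
move=> X1 w10 w20 xw yw; rewrite expnD.
have p1 : 1 < X ^ w1 by rewrite -(exp1n w1) ltn_exp2r.
have p2 : 1 < X ^ w2 by rewrite -(exp1n w2) ltn_exp2r.
case: o => /=; move: xw yw p1 p2; move: (X ^ w1) (X ^ w2) => a b xw yw p1 p2.
- nia.
- nia.
- exact: leq_mul.
- have := leq_div x y; nia.
- have := leq_mod x y; nia.
- by case: (x == y) => /=; nia.
- by case: (x < y) => /=; nia.
Qed.

Section Eval.

Variables (I : inst) (X B : nat) (s : state) (m : memory).
Hypotheses (ok : inst_ok I X) (rep : mem_rep I s m) (bnd : bounded_by X s).

Definition evals w (e : expr) (v : nat) :=
  [/\ eval B m e = Some v, v <= X ^ w & 0 < w].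

Lemma evals_const w c : c < w -> X ^ w < B -> evals w (EConst c) c.
Proof.
move=> cw wB; have X1 := ok_X ok.
have cX : c <= X ^ w by apply: leq_trans (ltnW cw) (ltnW (ltn_expl _ X1)).
by split; [apply: (wordT X1 wB (leqnn _))| |apply: leq_trans cw].
Qed.

Lemma evals_op o w1 w2 e1 e2 v1 v2 : X ^ (w1 + w2) < B ->
  evals w1 e1 v1 -> evals w2 e2 v2 -> evals (w1 + w2) (EOp o e1 e2) (binop_fun o v1 v2).
Proof.
move=> wB [e1v v1w w10] [e2v v2w w20]; have X1 := ok_X ok.
have le := binop_le o X1 w10 w20 v1w v2w.
by split; rewrite ?addn_gt0 ?w10 //= e1v e2v (wordT X1 wB (leqnn _)).
Qed.

Lemma evals_add w1 w2 e1 e2 v1 v2 : X ^ (w1 + w2) < B ->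
  evals w1 e1 v1 -> evals w2 e2 v2 -> evals (w1 + w2) (EOp OAdd e1 e2) (v1 + v2).
Proof. exact: (@evals_op OAdd). Qed.

Lemma evals_mul w1 w2 e1 e2 v1 v2 : X ^ (w1 + w2) < B ->
  evals w1 e1 v1 -> evals w2 e2 v2 -> evals (w1 + w2) (EOp OMul e1 e2) (v1 * v2).
Proof. exact: (@evals_op OMul). Qed.

Lemma evals_mod w1 w2 e1 e2 v1 v2 : X ^ (w1 + w2) < B ->
  evals w1 e1 v1 -> evals w2 e2 v2 -> evals (w1 + w2) (EOp OMod e1 e2) (v1 %% v2).
Proof. exact: (@evals_op OMod). Qed.

Lemma evals_load w e v : 0 < w -> X ^ w < B -> evals w e v -> m v <= X -> evals w (ELoad e) (m v).
Proof.
move=> w0 wB [ev _ _] mX; have X1 := ok_X ok.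
have le : m v <= X ^ w by apply: leq_trans mX _; rewrite -{1}[X]expn1 leq_pexp2l // ltnW.
by split=> //=; rewrite ev (wordT X1 wB (leqnn _)).
Qed.

Lemma evals_weak w w' e v : w <= w' -> evals w e v -> evals w' e v.
Proof.
move=> ww [ev le w0]; have X1 := ok_X ok; split=> //; last exact: leq_trans ww.
by apply: leq_trans le _; rewrite leq_pexp2l // ltnW.
Qed.

Lemma small_pow w w' : w <= w' -> X ^ w' < B -> X ^ w < B.
Proof.
by move=> ww; apply: leq_ltn_trans; rewrite leq_pexp2l // ltnW // (ok_X ok).
Qed.

Lemma evals_param w j v : j < w -> m j = v -> v <= X -> X ^ w < B ->
  evals w (ELoad (EConst j)) v.
Proof.
move=> jw <- vX wB; apply: evals_load => //; first exact: leq_trans jw.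
exact: evals_const.
Qed.

Lemma evals_cells w : 6 <= w -> X ^ w < B -> evals w cell_count_exp (cells I).
Proof.
move=> w6 wB; apply: (@evals_weak (2 + 2 + 2)) => //.
have B' v : v <= 6 -> X ^ v < B by move=> le; apply: small_pow wB; apply: leq_trans w6.
have p1 : evals 2 (ELoad (EConst 1)) (i_l I).
  by apply: evals_param; rewrite ?(rep_l rep) ?(ok_l ok) ?B'.
have p0 : evals 2 (ELoad (EConst 0)) (i_n I).
  by apply: evals_param; rewrite ?(rep_n rep) ?(ok_n ok) ?B'.
by apply: evals_mul => //; rewrite ?B' //; apply: evals_mul; rewrite ?B'.
Qed.

Lemma evals_addr w a e i : a < narr -> X ^ (w + (12 + narr.*2)) < B -> evals w e i ->
  evals (w + (12 + narr.*2)) (addr a e) (4 + cells I + (narr * i + a)).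
Proof.
move=> an wB ei.
have B' v : v <= w + (12 + narr.*2) -> X ^ v < B by move=> le; apply: small_pow wB.
apply: (@evals_weak (5 + 6 + (narr.+1 + w + narr))); first by lia.
apply: evals_add; rewrite ?B' //; try lia.
  apply: evals_add; rewrite ?B' //; try lia; first by apply: evals_const; rewrite ?B' //; lia.
  by apply: evals_cells; rewrite ?B' //; lia.
apply: evals_add; rewrite ?B' //; try lia; last by apply: evals_const; rewrite ?B' //; lia.
apply: evals_mul; rewrite ?B' //; try lia.
by apply: evals_const; rewrite ?B' //; lia.
Qed.

End Eval.

(** An exponent such that evaluation meets only values up to [X ^ weight e] when cells and
    parameters are at most [X]. In the [HA] case it accounts for the address computation. *)
Fixpoint weight (e : hexp) : nat :=
  match e with
  | HC c => c.+1
  | HA _ e => weight e + (12 + narr.*2)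
  | HI e => 5 + (weight e + 6)
  | HO _ e1 e2 => weight e1 + weight e2
  | _ => 4
  end.

Lemma comp_expP I X B s m e : inst_ok I X -> mem_rep I s m -> bounded_by X s ->
  wf_exp e -> X ^ weight e < B -> evals X B m (weight e) (comp_exp e) (ev I s e).
Proof.
move=> ok rep bnd; have X1 := ok_X ok.
elim: e => [c|||||a e IH|e IH|o e1 IH1 e2 IH2] /=.
- by move=> _; move=> ?; apply: (evals_const _ ok).
- by move=> _ ?; apply: (evals_param ok); rewrite ?(rep_n rep) ?(ok_n ok).
- by move=> _ ?; apply: (evals_param ok); rewrite ?(rep_l rep) ?(ok_l ok).
- by move=> _ ?; apply: (evals_param ok); rewrite ?(rep_k rep) ?(ok_k ok).
- by move=> _ ?; apply: (evals_param ok); rewrite ?(rep_d rep) ?(ok_d ok).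
- move=> /andP [an we] wB; rewrite -(rep_arr rep (ev I s e) an).
  apply: (evals_load ok) => //; first by rewrite addn_gt0 orbT.
    apply: (evals_addr ok rep) => //; apply: IH => //; apply: (small_pow ok _ wB).
    exact: leq_addr.
  by rewrite (rep_arr rep).
- move=> we wB; have lt : ev I s e %% cells I < cells I by rewrite ltn_mod (ok_cells ok).
  rewrite -(rep_in rep lt); apply: (evals_load ok) => //.
    have B' v : v <= 5 + (weight e + 6) -> X ^ v < B by move=> le; apply: (small_pow ok le).
    apply: (evals_add ok) => //; first by apply: (evals_const _ ok) => //; rewrite B' //; lia.
    apply: (evals_mod ok); first by rewrite B' //; lia.
      by apply: IH => //; rewrite B' //; lia.
    by apply: (evals_cells ok rep) => //; rewrite B' //; lia.
  by rewrite (rep_in rep) // (ok_in ok).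
move=> /andP [we1 we2] wB; apply: (evals_op ok) => //.
  by apply: IH1 => //; apply: (small_pow ok _ wB); apply: leq_addr.
by apply: IH2 => //; apply: (small_pow ok _ wB); apply: leq_addl.
Qed.

Arguments comp_exp : simpl never.
Arguments cost : simpl never.

Lemma small_le I X s e : inst_ok I X -> bounded_by X s -> small e -> ev I s e <= X.
Proof.
move=> ok bnd; have X1 := ok_X ok.
elim: e => [c|||||a e IH|e IH|o e1 IH1 e2 IH2] //=.
- by move=> c2; apply: leq_trans X1.
- by move=> _; apply: ok_n.
- by move=> _; apply: ok_l.
- by move=> _; apply: ok_k.
- by move=> _; apply: ok_d.
- by move=> _; apply: ok_in.
case: o => //=.
- by move/IH1; apply: leq_trans; apply: leq_subr.
- by move/IH1; apply: leq_trans; apply: leq_div.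
- by move/IH1; apply: leq_trans; apply: leq_mod.
- by move=> _; apply: leq_trans (leq_b1 _) (ltnW X1).
- by move=> _; apply: leq_trans (leq_b1 _) (ltnW X1).
Qed.

Lemma bounded_upd X s a i v : bounded_by X s -> v <= X -> bounded_by X (upd s a i v).
Proof. by move=> bnd vX b j; rewrite /upd; case: ifP. Qed.

Definition halts B c m T (Q : memory -> Prop) :=
  exists m' t, [/\ exec B c m m' t, t <= T & Q m'].

Lemma halts_seq B c1 c2 m T1 T2 Q R : halts B c1 m T1 Q ->
  (forall m1, Q m1 -> halts B c2 m1 T2 R) -> halts B (CSeq c1 c2) m (T1 + T2) R.
Proof.
case=> [m1 [t1 [e1 le1 q]]] /(_ m1 q) [m2 [t2 [e2 le2 r]]].
by exists m2, (t1 + t2); split; [apply: ExecSeq e1 e2|apply: leq_add|].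
Qed.

Lemma halts_while B e c N T (J : nat -> memory -> Prop) i m :
  (forall i m, i < N -> J i m -> (exists2 v, eval B m e = Some v & v != 0) /\
     halts B c m T (J i.+1)) ->
  (forall m, J N m -> eval B m e = Some 0) ->
  i <= N -> J i m ->
  halts B (CWhile e c) m ((N - i) * (cost e + T).+1 + (cost e).+1) (J N).
Proof.
move=> step last iN; move: {2}(N - i) (erefl (N - i)) => r.
elim: r i iN m => [|r IH] i iN m rE Ji.
  have iE : i = N by lia.
  subst i; exists m, (cost e).+1; split; rewrite ?rE //.
  exact: ExecWhileEnd (last m Ji).
have lt : i < N by lia.
have [[v ev v0] [m1 [t1 [x1 le1 J1]]]] := step i m lt Ji.
have [//|||m2 [t2 [x2 le2 J2]]] := IH i.+1 _ m1; [by lia|by []|].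
exists m2, (cost e + t1 + t2).+1; split=> //.
  exact: ExecWhileStep ev v0 x1 x2.
rewrite (_ : N - i = (N - i.+1).+1) ?mulSn; last by lia.
by move: le1 le2; move: ((N - i.+1) * _) => z; lia.
Qed.

Definition simulates I X s (m : memory) := mem_rep I s m /\ bounded_by X s.

Lemma halts_store I X B s m a e1 (e2 : hexp) v T : inst_ok I X -> simulates I X s m ->
  a < narr -> wf_exp e1 -> wf_exp e2 -> X ^ (weight e1 + (12 + narr.*2)) < B ->
  X ^ weight e2 < B -> ev I s e2 = v -> v <= X ->
  (cost (addr a (comp_exp e1)) + cost (comp_exp e2)).+1 <= T ->
  halts B (CStore (addr a (comp_exp e1)) (comp_exp e2)) m T
    (simulates I X (upd s a (ev I s e1) v)).
Proof.
move=> ok [rep bnd] an w1 w2 B1 B2 ve vX leT.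
have B1' : X ^ weight e1 < B by apply: (small_pow ok _ B1); apply: leq_addr.
have [ea _ _] := evals_addr ok rep an B1 (comp_expP ok rep bnd w1 B1').
have [ev2 _ _] := comp_expP ok rep bnd w2 B2.
eexists; eexists; split; first exact: ExecStore ea ev2.
  exact: leT.
by rewrite ve; split; [apply: update_rep|apply: bounded_upd].
Qed.

(** [w] is chosen before the instance. With [X] polynomial in the parameters, words of logarithmic
    length therefore suffice. *)
Lemma comp_correct c : wf c -> exists w, forall I X B s m,
  inst_ok I X -> fits I X c -> X ^ w < B -> simulates I X s m ->
  halts B (compile c) m (time I c) (simulates I X (run I c s)).
Proof.
elim: c => [|a e1 e2|a e b|c1 IH1 c2 IH2|e c1 IH1 c2 IH2|v b c IH|a cv jv b len z IHz inc IHi c IH] /=.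
- move=> _; exists 0 => I X B s m ok _ _ sim.
  by exists m, 1; split=> //; apply: ExecSkip.
- case/and4P => an w1 w2 sm; exists (weight e1 + (12 + narr.*2) + weight e2).
  move=> I X B s m ok _ wB sim; rewrite run_set.
  apply: halts_store => //; try by apply: (small_pow ok _ wB); rewrite ?leq_addl ?leq_addr.
  by apply: (small_le ok) => //; case: sim.
- case/and4P => an w1 w2 pb; exists (weight e + (12 + narr.*2) + weight (inc_exp a e b)).
  move=> I X B s m ok bX wB sim; rewrite run_inc.
  apply: (@halts_store I X B s m a e (inc_exp a e b) _ _ ok sim) => //.
  + by rewrite /= an w1.
  + by apply: (small_pow ok _ wB); rewrite leq_addr.
  + by apply: (small_pow ok _ wB); rewrite leq_addl.
  + by rewrite /= (ev_pure _ _ pb).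
  by case: sim => _ /(_ a (ev I s e)); case: ltnP => [lt _|_]; rewrite ?addn0 // addn1; apply: leq_trans bX.
- case=> /IH1 [w1 C1] /IH2 [w2 C2]; exists (w1 + w2) => I X B s m ok [f1 f2] wB sim.
  rewrite run_seq; apply: halts_seq => [|m1 sim1].
    by apply: (C1 I X B s m) => //; apply: (small_pow ok _ wB); apply: leq_addr.
  by apply: (C2 I X B _ m1) => //; apply: (small_pow ok _ wB); apply: leq_addl.
- case=> we /IH1 [w1 C1] /IH2 [w2 C2]; exists (weight e + (w1 + w2)).
  move=> I X B s m ok [f1 f2] wB sim; have [rep bnd] := sim.
  have B1 : X ^ weight e < B by apply: (small_pow ok _ wB); lia.
  have [ee _ _] := comp_expP ok rep bnd we B1.
  rewrite run_if; case: (boolP (ev I s e != 0)) => e0.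
    have [|m' [t [x le sim']]] := C1 I X B s m ok f1 _ sim; first by apply: (small_pow ok _ wB); lia.
    exists m', (cost (comp_exp e) + t).+1; split=> //; last by lia.
    by apply: ExecIf ee _; rewrite e0.
  have [|m' [t [x le sim']]] := C2 I X B s m ok f2 _ sim; first by apply: (small_pow ok _ wB); lia.
  exists m', (cost (comp_exp e) + t).+1; split=> //; last by lia.
  by apply: ExecIf ee _; rewrite (negbTE e0).
- case=> /and4P [vn vc wb pb] /IH [w C].
  pose cond := HO OLt (HV v) b; pose stp := HO OAdd (HV v) (HC 1).
  exists (w + (weight cond + (weight stp + (weight (HC 0) + (12 + narr.*2))))).
  move=> I X B s m ok [bX fc] wB sim; rewrite run_forE.
  have B' z : z <= w + (weight cond + (weight stp + (weight (HC 0) + (12 + narr.*2)))) ->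
     X ^ z < B by move=> le; apply: (small_pow ok le).
  set f := fun i t => run I c (upd t v 0 i).
  (* The counter already holds [i] when the guard is tested, hence the outer [upd]. *)
  pose J i := simulates I X (upd (iteri i f s) v 0 i).
  have wcond : wf_exp cond by rewrite /= vn wb.
  apply: (@halts_seq _ _ _ _ _ _ (J 0)).
    apply: (@halts_store I X B s m v (HC 0) (HC 0) _ _ ok sim) => //; try by rewrite B' //; lia.
  move=> m1 J0; rewrite -{1}[hval I b]subn0.
  apply: (@halts_while B (comp_exp cond) _ (hval I b) _ J) => //.
    move=> i m' ib [rep bnd].
    split.
      have [|ee _ _] := @comp_expP I X B _ m' cond ok rep bnd wcond; first by rewrite B' //; lia.
      by exists 1 => //; rewrite ee /= upd_same (ev_pure _ _ pb) ib.
    apply: halts_seq => [|m2 sim2].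
      by apply: (C I X B _ m' ok fc _ (conj rep bnd)); rewrite B' //; lia.
    rewrite /J /= -/f.
    have -> : upd (f i (iteri i f s)) v 0 i.+1 =
       upd (run I c (upd (iteri i f s) v 0 i)) v (ev I (run I c (upd (iteri i f s) v 0 i)) (HC 0)) i.+1.
      by [].
    apply: (@halts_store I X B _ m2 v (HC 0) stp _ _ ok sim2) => //; try by rewrite B' //; lia.
    + by rewrite /= vn.
    + by rewrite /= run_frame // upd_same addn1.
    by apply: leq_trans ib bX.
  move=> m' [rep bnd].
  have [|ee _ _] := @comp_expP I X B _ m' cond ok rep bnd wcond; first by rewrite B' //; lia.
  by rewrite ee /= upd_same (ev_pure _ _ pb) ltnn.
case=> /and5P [acv ajv cvjv cvn /andP [pb ac]] [zE iE] /IHz [wz Cz] /IHi [wi Ci] /IH [w C].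
pose cond := HO OEq (HV cv) (HC 0).
exists (wz + (wi + (w + weight cond))) => I X B s m ok [b0 fz fi fc] wB sim.
have B' y : y <= wz + (wi + (w + weight cond)) -> X ^ y < B.
  by move=> le; apply: (small_pow ok le).
rewrite run_digE; set f := fun t => _; pose J i := simulates I X (iter i f (run I z s)).
(* The guard is true before each of the [b ^ len] rounds and false after the last one. *)
have cvE i : i <= hval I b ^ hval I len ->
   iter i f (run I z s) cv 0 = (i == hval I b ^ hval I len) && (0 < i).
  by move=> il; rewrite /f zE iE; have [] := digits_loop_iter s acv ajv cvjv pb b0 ac il.
apply: (@halts_seq _ _ _ _ _ _ (J 0)).
  by apply: (Cz I X B s m) => //; rewrite B' //; lia.
move=> m1 J0; rewrite -{1}[hval I b ^ _]subn0.
have condB : X ^ weight cond < B by rewrite B' //; lia.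
have wcond : wf_exp cond by rewrite /= cvn.
apply: (@halts_while B (comp_exp cond) _ (hval I b ^ hval I len) _ J) => //.
  move=> i m' ib [rep bnd]; split.
    have [ee _ _] := comp_expP ok rep bnd wcond condB.
    by exists 1 => //; rewrite ee /= cvE ?(ltn_eqF ib) // ltnW.
  apply: halts_seq => [|m2 sim2].
    by apply: (C I X B _ m' ok fc _ (conj rep bnd)); rewrite B' //; lia.
  by apply: (Ci I X B _ m2 ok fi _ sim2); rewrite B' //; lia.
move=> m' [rep bnd].
have [ee _ _] := comp_expP ok rep bnd wcond condB.
by rewrite ee /= cvE // eqxx expn_gt0 b0.
Qed.

(** * The program *)

(* H, D: current graph and marked vertices; W: unmarked vertices under test;
   A, R: graph and representatives of the inner search; F, Q: found flag and code
   of the violated pair; I1, I2: choice strings of the inner and outer search. *)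
Notation aH := 0 (only parsing).
Notation aD := 1 (only parsing).
Notation aW := 2 (only parsing).
Notation aA := 3 (only parsing).
Notation aR := 4 (only parsing).
Notation aF := 5 (only parsing).
Notation aQ := 6 (only parsing).
Notation aX := 7 (only parsing).
Notation aY := 8 (only parsing).
Notation aZ := 9 (only parsing).
Notation aOK := 10 (only parsing).
Notation aAG := 11 (only parsing).
Notation aDS := 12 (only parsing).
Notation aI1 := 13 (only parsing).
Notation aC1 := 14 (only parsing).
Notation aJ1 := 15 (only parsing).
Notation aI2 := 16 (only parsing).
Notation aC2 := 17 (only parsing).
Notation aJ2 := 18 (only parsing).
Notation aBAD := 19 (only parsing).
Notation aFAIL := 20 (only parsing).
Notation aL := 21 (only parsing).
Notation aCNT := 22 (only parsing).
Notation aANS := 23 (only parsing).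
Notation vI := 24 (only parsing).
Notation vV := 25 (only parsing).
Notation vU := 26 (only parsing).
Notation vQ := 27 (only parsing).
Notation vT := 28 (only parsing).
Notation vTT := 29 (only parsing).
Notation vM := 30 (only parsing).

(** Truth means being nonzero, so product and sum act as conjunction and disjunction; [hdiff]
    normalises both sides before comparing. *)
Notation hand := (HO OMul).
Notation hor := (HO OAdd).
Notation heq := (HO OEq).
Notation hnot e := (HO OEq e (HC 0)).
Notation hdiff e1 e2 := (hnot (heq (hnot e1) (hnot e2))).
Notation set_var a e := (HSet a (HC 0) e).
Notation nn := (HO OMul HN HN).
Notation row := (HO ODiv (HV vQ) HN).
Notation col := (HO OMod (HV vQ) HN).
Notation cell e1 e2 := (HO OAdd (HO OMul e1 HN) e2).
Notation in_scope e := (hor (HA aW e) (HA aD e)).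
Notation input_cell := (HI (HO OAdd (HO OMul (HO OMul (HV vI) HN) HN) (HV vQ))).

Definition inner_len := HO OAdd (HO OAdd HK HK) (HC 1).
Definition outer_len := HO OAdd (HO OAdd (HO OAdd HK HK) HD) (HC 1).
Definition string_len := HO OAdd outer_len outer_len.
Definition base_exp :=
  HO OMul (HC 64) (HO OMul (HO OAdd HK (HC 1)) (HO OAdd HK (HC 1))).

Definition search v b cond f x :=
  HSeq (set_var f (HC 0))
    (HFor v b (HIf cond (HSeq (set_var f (HC 1)) (set_var x (HV v))) HSkip)).

Definition reps :=
  HFor vU HN
    (HSeq (HSet aR (HV vU) (HC 0))
      (HFor vV HN
        (HIf (hand (in_scope (HV vV)) (hor (HA aA (cell (HV vU) (HV vV))) (heq (HV vU) (HV vV))))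
           (HSet aR (HV vU) (HV vV)) HSkip))).

Definition violation_exp :=
  hand (hand (in_scope row) (in_scope col))
    (hand (hnot (heq row col))
       (hnot (heq (hnot (HA aA (HV vQ))) (hnot (heq (HA aR row) (HA aR col)))))).

Definition find_violation := HSeq reps (search vQ nn violation_exp aF aQ).

Definition toggle_prog a :=
  HSeq (HSet a (cell (HV aX) (HV aY)) (hnot (HA a (cell (HV aX) (HV aY)))))
       (HSet a (cell (HV aY) (HV aX)) (hnot (HA a (cell (HV aY) (HV aX))))).

Definition edit_prog :=
  HSeq (set_var aX (HO ODiv (HV aQ) HN))
  (HSeq (set_var aY (HO OMod (HV aQ) HN))
  (HSeq (HIf (HA aA (HV aQ))
          (HIf (HO OLt (HA aR (HV aX)) (HA aR (HV aY)))
             (set_var aZ (HA aR (HV aY))) (set_var aZ (HA aR (HV aX))))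
          (set_var aZ (HA aR (HV aX))))
  (HSeq (HIf (HA aI1 (HV vT))
          (HIf (heq (HA aI1 (HV vT)) (HC 1)) (set_var aY (HV aZ)) (set_var aX (HV aZ)))
          HSkip)
     (toggle_prog aA)))).

Definition scope_pair :=
  hand (hand (in_scope row) (in_scope col)) (hnot (heq row col)).

(** Saturating the number of differences at 2k + 1 loses nothing, because only whether it exceeds 2k
    matters. *)
Definition compare_prog :=
  HFor vQ nn
    (HIf scope_pair
      (HSeq (HIf (hand (hand (HA aW row) (HA aW col)) (hdiff (HA aA (HV vQ)) (HA aH (HV vQ))))
               (set_var aAG (HC 0)) HSkip)
            (HIf (hdiff (HA aA (HV vQ)) input_cell) (HInc aDS (HC 0) inner_len) HSkip))
      HSkip).

Definition test_prog :=
  HSeq (set_var aAG (HC 1)) (HSeq (set_var aDS (HC 0)) (HSeq compare_prog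
    (HIf (hand (HV aAG) (HO OLt (HV aDS) inner_len)) (set_var aOK (HC 1)) HSkip))).

Definition inner_body := HSeq find_violation (HIf (HV aF) edit_prog test_prog).

Definition start_prog :=
  HFor vQ nn (HIf (hand (HA aW row) (HA aW col))
    (HSet aA (HV vQ) (HA aH (HV vQ))) (HSet aA (HV vQ) input_cell)).

Definition inner_try := HSeq start_prog (HFor vT inner_len inner_body).

Definition check_layer :=
  HSeq (set_var aOK (HC 0)) (digits_loop aI1 aC1 aJ1 (HC 3) inner_len inner_try).

Definition shrink_prog :=
  HFor vM HN (HIf (HA aW (HV vM))
    (HSeq (HSet aW (HV vM) (HC 0)) (HSeq check_layer
       (HIf (HV aOK) (HSet aW (HV vM) (HC 1)) HSkip))) HSkip).

Definition list_prog src :=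
  HSeq (set_var aCNT (HC 0))
    (HFor vV HN (HIf (HA src (HV vV))
      (HSeq (HSet aL (HV aCNT) (HV vV)) (HInc aCNT (HC 0) HN)) HSkip)).

Definition layers_prog :=
  HSeq (set_var aFAIL (HC 0))
    (HFor vI HL (HSeq check_layer
       (HIf (hnot (HV aOK)) (HSeq (set_var aFAIL (HC 1)) (set_var aBAD (HV vI))) HSkip))).

Definition unmarked_prog := HFor vV HN (HSet aW (HV vV) (hnot (HA aD (HV vV)))).

Definition branch_prog :=
  HSeq (set_var vI (HV aBAD)) (HSeq shrink_prog (HSeq (list_prog aW)
  (HSeq (set_var aX (HA aI2 (HO OAdd (HV vTT) (HV vTT))))
  (HSeq (set_var aY (HA aI2 (HO OAdd (HO OAdd (HV vTT) (HV vTT)) (HC 1))))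
  (HIf (hand (HO OLt (HV aX) (HV aCNT)) (HO OLt (HV aY) (HV aCNT)))
    (HSeq (set_var aX (HA aL (HV aX))) (HSeq (set_var aY (HA aL (HV aY)))
      (HIf (heq (HV aX) (HV aY)) (HSet aD (HV aX) (HC 1)) (toggle_prog aH))))
    HSkip))))).

Definition accept_prog :=
  HSeq (list_prog aD) (HIf (HO OLt (HV aCNT) (HO OAdd HD (HC 1))) (set_var aANS (HC 1)) HSkip).

Definition outer_body :=
  HSeq unmarked_prog (HSeq layers_prog (HIf (HV aFAIL) branch_prog accept_prog)).

Definition init_prog :=
  HSeq (set_var vI (HC 0)) (HSeq (HFor vQ nn (HSet aH (HV vQ) input_cell))
    (HFor vV HN (HSet aD (HV vV) (HC 0)))).

Definition outer_try := HSeq init_prog (HFor vTT outer_len outer_body).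

Definition main_prog :=
  HSeq (set_var aANS (HC 0)) (digits_loop aI2 aC2 aJ2 base_exp string_len outer_try).

(** * Correctness of the program *)

Lemma nz_mul x y : (x * y != 0) = (x != 0) && (y != 0).
Proof. by rewrite muln_eq0 negb_or. Qed.

Lemma nz_add x y : (x + y != 0) = (x != 0) || (y != 0).
Proof. by rewrite addn_eq0 negb_and. Qed.

Lemma nz_bool (b : bool) : (nat_of_bool b != 0) = b.
Proof. by case: b. Qed.

Lemma z_bool (b : bool) : (nat_of_bool b == 0) = ~~ b.
Proof. by case: b. Qed.

Lemma eq_bool (b c : bool) : (nat_of_bool b == nat_of_bool c) = (b == c).
Proof. by case: b; case: c. Qed.

Definition nzE := (nz_mul, nz_add, nz_bool, z_bool, eq_bool).

Lemma count_iotaS (P : pred nat) j : count P (iota 0 j.+1) = count P (iota 0 j) + P j.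
Proof. by rewrite -addn1 iotaD count_cat /= addn0. Qed.

Lemma has_iotaS (P : pred nat) j : has P (iota 0 j.+1) = has P (iota 0 j) || P j.
Proof. by rewrite -addn1 iotaD has_cat /= orbF. Qed.

Lemma has_iota_ord (P : pred nat) j : has P (iota 0 j) = [exists i : 'I_j, P i].
Proof.
apply/hasP/existsP => [[i]|[i Pi]]; last by exists (i : nat); rewrite // mem_iota ltn_ord.
by rewrite mem_iota => ij Pi; exists (Ordinal ij).
Qed.

Lemma saturating_inc b c : minn b c + (minn b c < b) = minn b (c + 1).
Proof. lia. Qed.

Lemma saturated_lt b c : (minn b.+1 c < b.+1) = (c <= b).
Proof. lia. Qed.

Lemma notin_cons (a b : nat) s : (a \notin b :: s) = (a != b) && (a \notin s).
Proof. by rewrite inE negb_or. Qed.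

Lemma notin_cat (a : nat) s t : (a \notin s ++ t) = (a \notin s) && (a \notin t).
Proof. by rewrite mem_cat negb_or. Qed.

Section Correctness.

Variables (I : inst) (N : nat).
Notation n := N.+1.
Notation V := 'I_N.+1.
Hypothesis nE : i_n I = n.
Variable Gs : nat -> {set V * V}.
Hypothesis inE_cell : forall i q, i < i_l I -> q < n * n ->
  (i_in I (i * n * n + q) != 0) = (pair_of N q \in Gs i).
Hypothesis symG : forall i, symmetric_pairs (Gs i).

Notation l := (i_l I).
Notation k := (i_k I).
Notation d := (i_d I).
Notation run := (run I).

Definition vset (s : state) a : {set V} := [set v : V | s a v != 0].
Definition mat (s : state) a : {set V * V} := [set p : V * V | s a (p.1 * n + p.2) != 0].

Lemma in_vset s a v : v < n -> (inord v \in vset s a) = (s a v != 0).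
Proof. by move=> vn; rewrite inE inordK. Qed.

Lemma in_mat s a (x y : V) : ((x, y) \in mat s a) = (s a (x * n + y) != 0).
Proof. by rewrite inE. Qed.

Lemma div_lt q : q < n * n -> q %/ n < n.
Proof. by move=> qn; rewrite ltn_divLR. Qed.

Lemma in_mat_pair s a q : q < n * n -> (pair_of N q \in mat s a) = (s a q != 0).
Proof. by move=> qn; rewrite in_mat !inordK ?div_lt ?ltn_pmod // -divn_eq. Qed.

Lemma vset_eq s t a : (forall i, t a i = s a i) -> vset t a = vset s a.
Proof. by move=> e; apply/setP => v; rewrite !inE e. Qed.

Lemma mat_eq s t a : (forall i, t a i = s a i) -> mat t a = mat s a.
Proof. by move=> e; apply/setP => v; rewrite !inE e. Qed.

Lemma mat_run c s a : a \notin writes c -> mat (run c s) a = mat s a.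
Proof. by move=> ac; apply: mat_eq => i; apply: run_frame. Qed.

Lemma mat_upd_other s a b i v : b != a -> mat (upd s a i v) b = mat s b.
Proof. by move=> ba; apply: mat_eq => j; apply: upd_other. Qed.

Lemma vset_upd_other s a b i v : b != a -> vset (upd s a i v) b = vset s b.
Proof. by move=> ba; apply: vset_eq => j; apply: upd_other. Qed.

Lemma hval_nn : hval I nn = n * n.
Proof. by rewrite /hval /= nE. Qed.

Lemma hval_inner : hval I inner_len = k.*2.+1.
Proof. by rewrite /hval /= addnn addn1. Qed.

Lemma hval_outer : hval I outer_len = (k.*2 + d).+1.
Proof. by rewrite /hval /= addnn addn1. Qed.

Lemma hval_string : hval I string_len = ((k.*2 + d).+1).*2.
Proof. by rewrite -addnn -!hval_outer. Qed.

Lemma hval_base : hval I base_exp = digit_base k.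
Proof. by rewrite /hval /= /digit_base !addn1. Qed.

Lemma searchP (P : pred nat) v b cond f x s : f != x -> f != v -> x != v ->
  (forall i t, i < hval I b -> agree_off [:: v; f; x] s t ->
     (ev I (upd t v 0 i) cond != 0) = P i) ->
  let t := run (search v b cond f x) s in
  (t f 0 != 0) = isSome (last_sat P (hval I b)) /\
  forall i, last_sat P (hval I b) = Some i -> t x 0 = i.
Proof.
move=> fx fv xv cP /=; rewrite /search run_seq run_set /=.
set s1 := upd s f 0 0.
have [||t [tf tx] ->] := @run_for I (fun j t => (t f 0 != 0) = isSome (last_sat P j) /\
    forall i, last_sat P j = Some i -> t x 0 = i) v b
    (HIf cond (HSeq (set_var f (HC 1)) (set_var x (HV v))) HSkip) s1.
- by rewrite /s1 upd_same.
- move=> i t ib ag [tf tx]; rewrite run_if cP //; last first.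
    move=> a j; rewrite !inE !negb_or => /and3P [av af ax].
    by rewrite ag ?inE ?negb_or ?av ?af // /s1 upd_other.
  rewrite /=; case: ifP => _.
    rewrite run_seq !run_set /= !(upd_other _ _ _ _ fx) upd_same; split=> // _ [<-].
    by rewrite upd_same upd_other 1?eq_sym // upd_same.
  by rewrite !run_skip !upd_other.
by rewrite !upd_other.
Qed.

(** ** One layer *)

Lemma repsP s u : u < n ->
  run reps s aR u = rep (vset s aW :|: vset s aD) (mat s aA) (inord u).
Proof.
move=> un; set S := _ :|: _; set A := mat s aA.
have [||t tR ->] := @run_for I (fun j t => forall u, u < j -> t aR u = rep S A (inord u))
   vU HN (HSeq (HSet aR (HV vU) (HC 0))
      (HFor vV HN
        (HIf (hand (in_scope (HV vV)) (hor (HA aA (cell (HV vU) (HV vV))) (heq (HV vU) (HV vV))))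
           (HSet aR (HV vU) (HV vV)) HSkip))) s.
- by [].
- move=> i t; rewrite /hval /= nE => iN ag tR; rewrite run_seq run_set /= upd_same.
  set s1 := upd _ aR i 0; have s1E : s1 = upd (upd t vU 0 i) aR i 0 by [].
  pose P v := (inord v \in S) && (((inord i : V, inord v) \in A) || (inord i == inord v :> V)).
  have [||r [rR ro] ->] := @run_for I (fun j r => r aR i = odflt 0 (last_sat P j) /\
      forall u, u != i -> r aR u = t aR u) vV HN
      (HIf (hand (in_scope (HV vV)) (hor (HA aA (cell (HV vU) (HV vV))) (heq (HV vU) (HV vV))))
           (HSet aR (HV vU) (HV vV)) HSkip) s1.
  + by rewrite s1E upd_same; split=> // u' ui; rewrite /upd /= (negbTE ui).
  + move=> j r; rewrite /hval /= nE => jN agr [rR ro].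
    rewrite run_if /= nE.
    have e a x : a \notin [:: vU; vV; aR] -> upd r vV 0 j a x = s a x.
      rewrite !inE !negb_or => /and3P [aU aV aRn].
      rewrite upd_other // agr ?inE ?negb_or ?aV ?aRn // s1E !upd_other //.
      by rewrite ag //= !inE !negb_or aU aV aRn.
    have eU : upd r vV 0 j vU 0 = i by rewrite upd_other // agr // s1E /upd.
    rewrite (e aW) // (e aD) // (e aA) // eU upd_same !nzE.
    have -> : [&& (s aW j != 0) || (s aD j != 0) & (s aA (i * n + j) != 0) || (i == j)] = P j.
      rewrite /P in_setU !in_vset //; congr andb.
      by rewrite in_mat !inordK // -val_eqE /= !inordK.
    rewrite /=; case: ifP => _.
      rewrite run_set /= eU upd_same; split=> [|u' ui]; first by rewrite upd_same.
      by rewrite /upd /= (negbTE ui) ro.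
    by rewrite !run_skip; split=> [|u' ui]; rewrite upd_other // ro.
  move=> u'; rewrite ltnS leq_eqVlt => /predU1P [->|ui]; rewrite upd_other //.
    by rewrite rR /hval /= nE.
  by rewrite ro ?tR // ltn_eqF.
by rewrite upd_other // tR // /hval /= nE.
Qed.

Lemma find_violationP s :
  let t := run find_violation s in
  let r := last_violation (vset s aW :|: vset s aD) (mat s aA) in
  (t aF 0 != 0) = isSome r /\ forall q, r = Some q -> t aQ 0 = q.
Proof.
rewrite /find_violation run_seq /= /last_violation -hval_nn.
apply: searchP => // q t; rewrite hval_nn => qn ag /=.
have e a x : a \notin [:: vQ; aF; aQ] -> upd t vQ 0 q a x = run reps s a x.
  by move=> an; rewrite upd_other ?ag //; move: an; rewrite inE negb_or => /andP [].
have eQ : upd t vQ 0 q vQ 0 = q by rewrite upd_same.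
rewrite !nzE nE eQ !(e aW) // !(e aD) // !(e aA) // !(e aR) //.
rewrite !repsP ?div_lt ?ltn_pmod // !(@run_frame _ reps) //.
set S := _ :|: _; rewrite /violation /pair_of /= /S !in_setU !in_vset ?div_lt ?ltn_pmod //.
rewrite -/(pair_of N q) in_mat_pair // -!andbA.
congr [&& _, _ & _ && _]; first by rewrite -val_eqE /= !inordK ?div_lt ?ltn_pmod.
by case: (s aA q == 0); case: (rep _ _ _ == _).
Qed.

Lemma toggleP s a x y : a != aX -> a != aY -> s aX 0 = x -> s aY 0 = y -> x < n -> y < n ->
  mat (run (toggle_prog a) s) a = toggle (mat s a) (inord x, inord y).
Proof.
move=> aX' aY' sx sy xn yn.
have cell_eq (u v : V) u' v' : u' < n -> v' < n ->
    (u * n + v == u' * n + v') = ((u, v) == (inord u', inord v')).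
  move=> un vn; rewrite xpair_eqE -!val_eqE /= !inordK //.
  apply/eqP/andP => [e|[/eqP -> /eqP ->] //].
  have := congr1 (divn^~ n) e; have := congr1 (modn^~ n) e.
  by rewrite /= !modnMDl !divnMDl // !modn_small ?divn_small // !addn0 => -> ->.
apply/setP => -[u v]; have Xa : aX != a by rewrite eq_sym.
have Ya : aY != a by rewrite eq_sym.
rewrite in_mat /toggle_prog run_seq !run_set /= !(upd_other _ _ _ _ Xa) !(upd_other _ _ _ _ Ya).
rewrite sx sy nE [in RHS]inE [in RHS]inE in_mat /= /upd eqxx !cell_eq //.
have [e1|_] := eqVneq (u, v) (inord y, inord x).
  rewrite nzE; case: e1 => -> ->; rewrite !inordK //.
  have -> : (y * n + x == x * n + y) = ((inord y, inord x) == (inord x, inord y) :> V * V).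
    by rewrite -(cell_eq (inord y) (inord x)) // !inordK.
  (* If the two vertices coincide, both stores hit the same cell and cancel, just like the two
     flips. *)
  case: ((inord y, inord x) =P (inord x, inord y)) => [[/(congr1 val) /=]|_] /=.
    by rewrite !inordK // => -> _; rewrite nzE !addbT !negbK.
  by rewrite addbF addbT negbK.
rewrite /= addbF; case: ((u, v) =P (inord x, inord y)) => [[-> ->]|_] /=; last by rewrite addbF.
by rewrite nzE addbT !inordK // negbK.
Qed.

Lemma modn_cell i q : i < l -> q < n * n -> (i * n * n + q) %% cells I = i * n * n + q.
Proof.
move=> il qn; rewrite modn_small // /cells nE -!mulnA.
by apply: (@leq_trans (i.+1 * (n * n))); rewrite ?leq_mul2r ?il ?orbT // (mulSn i) addnC ltn_add2r.
Qed.

Lemma editP s q :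
  let S := vset s aW :|: vset s aD in let A := mat s aA in
  symmetric_pairs A -> last_violation S A = Some q -> s aQ 0 = q ->
  (forall u, u < n -> s aR u = rep S A (inord u)) ->
  mat (run edit_prog s) aA = toggle A (edit_of S A (pair_of N q) (s aI1 (s vT 0))).
Proof.
move=> S A sA /last_sat_some [qn vio _] sQ sR.
have [zn _ _ _ _] := third_spec sA vio.
have xn := div_lt qn; have yn : q %% n < n by rewrite ltn_pmod.
set c := s aI1 (s vT 0); set z := third S A _ in zn.
pose s2 := upd (upd s aX 0 (q %/ n)) aY 0 (q %% n).
pose s3 := upd s2 aZ 0 z.
rewrite /edit_prog 4!run_seq; set t := run (HIf _ _ HSkip) _.
have -> : t = if c is c'.+1 then if c' is 0 then upd s3 aY 0 z else upd s3 aX 0 z else s3.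
  rewrite /t; have -> : run (set_var aY (HO OMod (HV aQ) HN))
      (run (set_var aX (HO ODiv (HV aQ) HN)) s) = s2.
    by rewrite !run_set /= !upd_other // nE sQ.
  have -> : run (HIf (HA aA (HV aQ)) (HIf (HO OLt (HA aR (HV aX)) (HA aR (HV aY)))
        (set_var aZ (HA aR (HV aY))) (set_var aZ (HA aR (HV aX))))
      (set_var aZ (HA aR (HV aX)))) s2 = s3.
    have e a x : a \notin [:: aX; aY] -> s2 a x = s a x.
      by rewrite !inE !negb_or => /andP [aX' aY']; rewrite /s2 !upd_other.
    have eX : s2 aX 0 = q %/ n by [].
    have eY : s2 aY 0 = q %% n by [].
    rewrite !run_if !run_set /= eX eY !(e aR) // (e aA) // e // sQ !sR // nz_bool.
    by rewrite /s3 /z /third in_mat_pair //=; do 2!case: ifP => //.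
  have e3 : s3 aI1 (s3 vT 0) = c by [].
  rewrite !run_if !run_set /= e3 nz_bool.
  by case: c {e3 t} => [|[|c]].
case: c t => [|[|c]] _.
- by rewrite (@toggleP s3 aA (q %/ n) (q %% n)).
- by rewrite (@toggleP (upd s3 aY 0 z) aA (q %/ n) z).
by rewrite (@toggleP (upd s3 aX 0 z) aA z (q %% n)).
Qed.

Lemma count_pairs (X : {set V * V}) : count (fun q => pair_of N q \in X) (iota 0 (n * n)) = #|X|.
Proof.
rewrite cardE -size_filter -(size_map (fun p : V * V => p.1 * n + p.2)).
apply/perm_size/uniq_perm.
- by rewrite filter_uniq ?iota_uniq.
- rewrite map_inj_uniq ?enum_uniq // => -[x y] [u v] /= e.
  by rewrite -(pair_ofK x y) -(pair_ofK u v) e.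
move=> q; rewrite mem_filter mem_iota /=; apply/andP/mapP.
  case=> qX qn; exists (pair_of N q); rewrite ?mem_enum //=.
  by rewrite !inordK ?div_lt ?ltn_pmod // -divn_eq.
by case=> -[x y]; rewrite mem_enum => xy ->; rewrite pair_ofK xy pair_code_lt.
Qed.

Lemma compareP s : s vI 0 < l -> s aAG 0 = 1 -> s aDS 0 = 0 ->
  let S := vset s aW :|: vset s aD in let t := run compare_prog s in
  (t aAG 0 != 0) = (diffs (vset s aW) (mat s aA) (mat s aH) == set0) /\
  (t aDS 0 < k.*2.+1) = (#|diffs S (mat s aA) (Gs (s vI 0))| <= k.*2).
Proof.
move=> il sAG sDS S /=; set i := s vI 0 in il *.
set A := mat s aA; set H := mat s aH; set W := vset s aW.
pose P q := pair_of N q \in diffs W A H; pose P' q := pair_of N q \in diffs S A (Gs i).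
rewrite /compare_prog; set c := HIf _ _ _.
have [||t [tAG tDS] ->] := @run_for I (fun j t =>
    (t aAG 0 != 0) = ~~ has P (iota 0 j) /\
    t aDS 0 = minn k.*2.+1 (count P' (iota 0 j))) vQ nn c s.
- by rewrite sAG sDS minn0.
- move=> q t; rewrite hval_nn => qn ag [tAG tDS].
  have e a x : a \notin [:: vQ; aAG; aDS] -> upd t vQ 0 q a x = s a x.
    rewrite !inE !negb_or => /and3P [aV aG aS].
    by rewrite upd_other // ag //= !inE !negb_or aV aG aS.
  have eQ : upd t vQ 0 q vQ 0 = q by rewrite upd_same.
  have inW := in_vset s aW; have inD := in_vset s aD.
  have PE : P q = [&& s aW (q %/ n) != 0, s aW (q %% n) != 0, q %/ n != q %% n
       & (s aA q != 0) != (s aH q != 0)].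
    rewrite /P /pair_of in_diffs !inW ?div_lt ?ltn_pmod // -/(pair_of N q).
    rewrite !in_mat_pair //; congr [&& _, _, _ & _].
    by rewrite -val_eqE /= !inordK ?div_lt ?ltn_pmod.
  have PE' : P' q = [&& (s aW (q %/ n) != 0) || (s aD (q %/ n) != 0),
       (s aW (q %% n) != 0) || (s aD (q %% n) != 0), q %/ n != q %% n
       & (s aA q != 0) != (i_in I (i * n * n + q) != 0)].
    rewrite /P' /pair_of in_diffs !in_setU !inW ?inD ?div_lt ?ltn_pmod // -/(pair_of N q).
    rewrite in_mat_pair // inE_cell //; congr [&& _, _, _ & _].
    by rewrite -val_eqE /= !inordK ?div_lt ?ltn_pmod.
  have cellq : (i * n * n + q) %% cells I = i * n * n + q.
    by rewrite modn_cell.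
  rewrite has_iotaS count_iotaS negb_or PE PE' run_if /= eQ nE !(e aW) // !(e aD) // !nzE.
  case: ifP => sc; last first.
    rewrite !run_skip !upd_other // tAG tDS; split.
      apply/esym/andb_idr => _; apply: contraFN sc => /and4P [-> -> -> _] //.
    case: (boolP [&& _, _, _ & _]) => [/and4P [w1 w2 w3 _]|]; last by rewrite addn0.
    by rewrite w1 w2 w3 in sc.
  move/andP: sc => [/andP [-> ->] ->]; rewrite run_seq.
  set u := upd t vQ 0 q in e eQ *; set r := run _ u.
  have rE : (r aAG 0 != 0) = (u aAG 0 != 0) &&
      ~~ [&& s aW (q %/ n) != 0, s aW (q %% n) != 0 & (s aA q != 0) != (s aH q != 0)].
    rewrite /r run_if /= eQ nE !(e aW) // (e aA) // (e aH) // !nzE -andbA.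
    rewrite (inj_eq negb_inj).
    by case: ifP => _; rewrite ?andbT // run_set /= ?upd_same andbF.
  have ro a x : a != aAG -> r a x = u a x.
    by move=> aG; rewrite /r run_frame //= !inE.
  rewrite run_if /= !(ro vQ) // !(ro vI) // (ro aA) // eQ nE (e aA) // (e vI) // cellq !nzE.
  rewrite !(inj_eq negb_inj); case: ifP => _ /=.
    rewrite run_inc /= upd_same upd_other // rE ro // /u !upd_other // tAG tDS hval_inner.
    by rewrite saturating_inc !(inj_eq negb_inj).
  by rewrite !run_skip rE ro // /u !upd_other // tAG tDS addn0 !(inj_eq negb_inj).
rewrite !upd_other // tAG tDS hval_nn has_count -leqNgt leqn0 !count_pairs cards_eq0.
split=> //; apply: saturated_lt.
Qed.

Lemma testP s : s vI 0 < l ->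
  let S := vset s aW :|: vset s aD in
  last_violation S (mat s aA) = None ->
  (run test_prog s aOK 0 != 0) = (s aOK 0 != 0) ||
    inner_goal k (Gs (s vI 0)) (mat s aH) (vset s aD) (vset s aW) (mat s aA).
Proof.
move=> il S none; rewrite /test_prog 3!run_seq.
set s1 := run (set_var aDS _) _.
have e a : a \notin [:: aAG; aDS] -> forall x, s1 a x = s a x.
  by rewrite !inE !negb_or => /andP [aG aS] x; rewrite /s1 !run_set !upd_other.
have [|//|//|] := @compareP s1; first by rewrite e.
rewrite /= !(@vset_eq s s1) ?(@mat_eq s s1) //; try exact: e.
rewrite (e vI) // => tAG tDS; rewrite run_if /= !nzE addnn addn1 tAG tDS.
rewrite /inner_goal none eqxx /= -/S; case: ifP => [|_].
  by rewrite run_set /= ?upd_same orbT.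
by rewrite run_skip run_frame // e // orbF.
Qed.

Lemma inner_bodyP s : s vI 0 < l -> symmetric_pairs (mat s aA) ->
  let t := run inner_body s in
  mat t aA = inner_step (vset s aD) (vset s aW) (mat s aA) (s aI1 (s vT 0)) /\
  (t aOK 0 != 0) = (s aOK 0 != 0) ||
    inner_goal k (Gs (s vI 0)) (mat s aH) (vset s aD) (vset s aW) (mat s aA).
Proof.
move=> il sA /=; rewrite /inner_body run_seq; have [] := find_violationP s.
set s1 := run find_violation s => sF sQ.
have e a : a \notin writes find_violation -> forall x, s1 a x = s a x.
  by move=> an x; apply: run_frame.
have eS : vset s1 aW :|: vset s1 aD = vset s aW :|: vset s aD.
  by congr (_ :|: _); apply: vset_eq; apply: e.
have eA : mat s1 aA = mat s aA by apply: mat_eq; apply: e.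
rewrite run_if /= sF /inner_step /inner_goal.
case E: last_violation => [q|] /=.
  have := @editP s1 q; rewrite eS eA !(e aI1) // (e vT) // => -> //.
  - by rewrite orbF run_frame // e.
  - exact: sQ.
  move=> u un; rewrite /s1 /find_violation run_seq run_frame //; exact: repsP.
rewrite (mat_eq (s := s1)) ?eA; last by move=> x; apply: run_frame.
split=> //; rewrite testP ?eS ?eA ?(e vI) ?(e aOK) //.
by rewrite /inner_goal !(@vset_eq s s1) ?(@mat_eq s s1) ?E //; apply: e.
Qed.

Lemma start_progP s : s vI 0 < l ->
  mat (run start_prog s) aA = start_graph (Gs (s vI 0)) (mat s aH) (vset s aW).
Proof.
move=> il; rewrite /start_prog; set c := HIf _ _ _; set B := start_graph _ _ _.
have [||t tA ->] := @run_for I (fun j t => forall q, q < j -> (t aA q != 0) = (pair_of N q \in B))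
    vQ nn c s.
- by [].
- move=> q t; rewrite hval_nn => qn ag tA.
  have e a x : a \notin [:: vQ; aA] -> upd t vQ 0 q a x = s a x.
    rewrite !inE !negb_or => /andP [aV aG].
    by rewrite upd_other // ag //= !inE !negb_or aV aG.
  have eQ : upd t vQ 0 q vQ 0 = q by rewrite upd_same.
  have PE : pair_of N q \in B = if (s aW (q %/ n) != 0) && (s aW (q %% n) != 0)
      then s aH q != 0 else i_in I (s vI 0 * n * n + q) != 0.
    rewrite inE inE_cell // in_mat_pair // /pair_of /=.
    by rewrite !in_vset ?div_lt ?ltn_pmod.
  move=> q'; rewrite ltnS leq_eqVlt => /predU1P [->|q'q].
    rewrite PE run_if /= eQ nE !(e aW) // nzE; case: ifP => _.
      by rewrite run_set /= eQ upd_same e.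
    by rewrite run_set /= eQ upd_same (e vI) // nE modn_cell.
  rewrite run_if; rewrite -tA //; case: ifP => _; rewrite run_set /= eQ /upd /=.
    by rewrite (ltn_eqF q'q).
  by rewrite (ltn_eqF q'q).
apply/setP => -[x y]; rewrite in_mat upd_other // tA ?pair_ofK // hval_nn.
exact: pair_code_lt.
Qed.

Lemma inner_walk_sym G H D W g t : symmetric_pairs G -> symmetric_pairs H ->
  symmetric_pairs (@inner_walk N G H D W g t).
Proof.
move=> sG sH; elim: t => [|t IH] /=; first exact: start_graph_sym.
by rewrite /inner_step; case: last_violation => // q; apply: toggle_sym.
Qed.

Lemma inner_success_ext kk G H D W g g' : (forall i, i < kk.*2.+1 -> g i = g' i) ->
  @inner_success N kk G H D W g = inner_success kk G H D W g'.
Proof.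
move=> e; apply: eq_existsb => t; rewrite (@inner_walk_ext _ _ _ _ _ _ g') // => i it.
by apply: e; apply: ltn_trans it (ltn_ord t).
Qed.

Lemma inner_tryP s : s vI 0 < l -> symmetric_pairs (mat s aH) ->
  (run inner_try s aOK 0 != 0) = (s aOK 0 != 0) ||
    inner_success k (Gs (s vI 0)) (mat s aH) (vset s aD) (vset s aW) (s aI1).
Proof.
move=> il sH; rewrite /inner_try run_seq; set s1 := run start_prog s.
have e a : a \notin writes start_prog -> forall x, s1 a x = s a x.
  by move=> an x; apply: run_frame.
set G := Gs _; set H := mat s aH; set D := vset s aD; set W := vset s aW.
set w := inner_walk G H D W (s aI1).
have [||t [_ tOK] ->] := @run_for I (fun j t => mat t aA = w j /\
    (t aOK 0 != 0) = (s aOK 0 != 0) || has (fun i => inner_goal k G H D W (w i)) (iota 0 j))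
    vT inner_len inner_body s1.
- by rewrite start_progP // e // orbF.
- move=> j t; rewrite hval_inner => jk ag [tA tOK].
  have e1 a x : a \notin vT :: writes inner_body ++ writes start_prog ->
      upd t vT 0 j a x = s a x.
    rewrite notin_cons notin_cat => /and3P [aT ab as_].
    have aB : a \notin vT :: writes inner_body by rewrite notin_cons aT ab.
    by rewrite upd_other // ag // e.
  have eA : mat (upd t vT 0 j) aA = w j by rewrite mat_upd_other.
  have ul : upd t vT 0 j vI 0 < l by rewrite e1.
  have uA : symmetric_pairs (mat (upd t vT 0 j) aA).
    by rewrite eA; exact: (inner_walk_sym _ _ _ _ (symG _) sH).
  have eW a : a \notin vT :: writes inner_body ++ writes start_prog ->
      vset (upd t vT 0 j) a = vset s a by move=> an; apply: vset_eq => x; apply: e1.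
  have eH : mat (upd t vT 0 j) aH = H by apply: mat_eq => x; apply: e1.
  have [] := inner_bodyP ul uA.
  rewrite upd_same eA eH !eW // (e1 vI) // (e1 aI1) // upd_other // tOK => -> ->.
  by rewrite has_iotaS orbA.
by rewrite upd_other // tOK hval_inner has_iota_ord.
Qed.

Lemma check_layerP s : s vI 0 < l -> symmetric_pairs (mat s aH) ->
  (run check_layer s aOK 0 != 0) =
    completable k (Gs (s vI 0)) (mat s aH) (vset s aD) (vset s aW).
Proof.
move=> il sH; rewrite /check_layer run_seq run_set /=; set s1 := upd s aOK 0 0.
set G := Gs _; set H := mat s aH; set D := vset s aD; set W := vset s aW.
set f := inner_success k G H D W.
have := @run_digits I (fun j t => (t aOK 0 != 0) = has (fun i => f (digit 3 i)) (iota 0 j))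
  aI1 aC1 aJ1 (HC 3) inner_len inner_try s1.
have -> : hval I (HC 3) = 3 by [].
rewrite hval_inner => -> //.
- apply/idP/idP => [/hasP [j _ ok]|].
    by apply/(inner_searchP k D W (symG _) sH); exists (digit 3 j) => // i; apply: digit_lt.
  case/(inner_searchP k D W (symG _) sH) => g g3 ok.
  (* A walk reads only its first 2k + 1 choices, so the infinite guide may be replaced by an
     enumerated string. *)
  have [j jb jg] := @digits_surj 3 k.*2.+1 g isT (fun i _ => g3 i).
  apply/hasP; exists j; first by rewrite mem_iota.
  by rewrite /f (@inner_success_ext _ _ _ _ _ _ g).
- by move=> j t t' ag; rewrite ag.
move=> j t jb ag tI tOK; have e a x : a \notin aOK :: writes (digits_loop aI1 aC1 aJ1 (HC 3) inner_len inner_try) ->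
    t a x = s a x.
  by rewrite notin_cons => /andP [aO an]; rewrite ag // /s1 upd_other.
rewrite inner_tryP ?(e vI) //; last by rewrite (@mat_eq s) // => x; apply: e.
rewrite !(@vset_eq s t) ?(@mat_eq s t) //; try by move=> x; apply: e.
rewrite tOK has_iotaS; congr orb.
by apply: inner_success_ext => i ik; apply: tI.
Qed.

Lemma shrinkP s : s vI 0 < l -> symmetric_pairs (mat s aH) -> vset s aW = ~: vset s aD ->
  vset (run shrink_prog s) aW = shrink k Gs (s vI 0) (mat s aH) (vset s aD) n.
Proof.
move=> il sH sW; rewrite /shrink_prog; set c := HIf _ _ _.
set i := s vI 0 in il *; set H := mat s aH in sH *; set D := vset s aD in sW *.
have [||t tW ->] := @run_for I (fun j t => vset t aW = shrink k Gs i H D j) vM HN c s.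
- by [].
- move=> v t; rewrite /hval /= nE => vn ag tW.
  set t1 := upd t vM 0 v; set U := shrink k Gs i H D v in tW *.
  have t1v : t1 vM 0 = v by rewrite /t1 upd_same.
  have t1W x : t1 aW x = t aW x by rewrite /t1 upd_other.
  rewrite run_if /= t1v t1W -in_vset // tW; case: ifP => [vU|_] /=; last first.
    by rewrite -tW; apply: vset_eq.
  rewrite 2!run_seq run_set /= t1v.
  set t2 := upd t1 aW v 0.
  have t2W : vset t2 aW = U :\ inord v.
    apply/setP => x; rewrite in_setD1 -tW !inE /t2 /upd /= -val_eqE /= inordK //.
    by case: (_ == v).
  have e a x : a \notin vM :: writes c -> t2 a x = s a x.
    rewrite notin_cons => /andP [aM ac]; rewrite /t2 /t1 !upd_other //.
      by rewrite ag // notin_cons aM.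
    by apply: contraNneq ac => ->.
  have eH : mat t2 aH = H by apply: mat_eq => x; apply: e.
  have eD : vset t2 aD = D by apply: vset_eq => x; apply: e.
  have := @check_layerP t2; rewrite eH eD t2W (e vI) // -/i => /(_ il sH) ok.
  set t3 := run check_layer t2 in ok *.
  have t3E a x : a \notin writes check_layer -> t3 a x = t2 a x by move=> an; apply: run_frame.
  rewrite run_if /= ok; case: ifP => _ /=.
    have t2v : t2 vM 0 = v by [].
    apply/setP => x; rewrite run_set /= (t3E vM) // t2v -tW !inE /upd /= t3E // /t2 /upd /=.
    case: (x =P v :> nat) => [->|_]; last by rewrite t1W.
    by move: vU; rewrite -tW in_vset // => ->.
  by rewrite -t2W; apply: vset_eq => x; apply: t3E.
by rewrite vset_upd_other // tW /hval /= nE.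
Qed.

(** ** The outer search *)

Lemma list_progP src s : src != aCNT -> src != aL -> src != vV ->
  let L := listing (vset s src) in let t := run (list_prog src) s in
  t aCNT 0 = size L /\ forall i, i < size L -> t aL i = nth 0 L i.
Proof.
move=> sC sL sV L /=; rewrite /list_prog run_seq run_set /=.
set s1 := upd s aCNT 0 0; set c := HIf _ _ _.
pose P v := inord v \in vset s src; pose lst j := [seq v <- iota 0 j | P v].
have [||t [tC tL] ->] := @run_for I (fun j t => t aCNT 0 = size (lst j) /\
    forall i, i < size (lst j) -> t aL i = nth 0 (lst j) i) vV HN c s1.
- by rewrite /s1 upd_same.
- move=> j t; rewrite /hval /= nE => jn ag [tC tL].
  have lstS : lst j.+1 = if P j then rcons (lst j) j else lst j.
    by rewrite /lst -addn1 iotaD filter_cat /= add0n; case: (P j); rewrite ?cats0 // cats1.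
  set t1 := upd t vV 0 j.
  have tV : t1 vV 0 = j by rewrite /t1 upd_same.
  have t1E a x : a != vV -> t1 a x = t a x by move=> aV; rewrite /t1 upd_other.
  have tS : (t1 src j != 0) = P j.
    rewrite t1E // ag; last by rewrite /= !notin_cons sV sC sL.
    by rewrite /s1 upd_other // /P in_vset.
  have cn : size (lst j) < n.
    by apply: leq_ltn_trans jn; rewrite size_filter (leq_trans (count_size _ _)) // size_iota.
  rewrite run_if /= tV tS lstS; case: ifP => _; last first.
    by rewrite run_skip t1E //; split=> // i il; rewrite t1E // tL.
  rewrite run_seq run_set run_inc /= tV (t1E aCNT) // tC.
  rewrite size_rcons; split.
    by rewrite upd_same upd_other // t1E // tC /hval /= nE cn addn1.
  move=> i; rewrite ltnS leq_eqVlt => ic; rewrite upd_other // nth_rcons.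
  case/predU1P: ic => [->|il]; first by rewrite ltnn eqxx upd_same.
  by rewrite il /upd /= (ltn_eqF il) t1E // tL.
by move: tC tL; rewrite /hval /= nE => tC tL; rewrite upd_other.
Qed.

Lemma layersP s : symmetric_pairs (mat s aH) -> vset s aW = ~: vset s aD ->
  let r := last_bad_layer l k Gs (mat s aH) (vset s aD) in
  let t := run layers_prog s in
  (t aFAIL 0 != 0) = isSome r /\ forall i, r = Some i -> t aBAD 0 = i.
Proof.
move=> sH sW; rewrite /layers_prog run_seq run_set /= /last_bad_layer.
set H := mat s aH in sH *; set D := vset s aD in sW *; set s1 := upd s aFAIL 0 0.
set c := HSeq check_layer _; set P := fun i => _.
have [||t [tF tB] ->] := @run_for I (fun j t => (t aFAIL 0 != 0) = isSome (last_sat P j) /\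
    forall i, last_sat P j = Some i -> t aBAD 0 = i) vI HL c s1.
- by rewrite /s1 upd_same.
- move=> i t il ag [tF tB]; rewrite /c run_seq; set t1 := upd t vI 0 i.
  have e a x : a \notin [:: aFAIL, aBAD, vI & writes check_layer] -> t1 a x = s a x.
    rewrite 3!notin_cons => /and4P [aF aB aI an]; rewrite /t1 upd_other // ag.
      by rewrite /s1 upd_other.
    rewrite notin_cons aI -[writes c]/(writes check_layer ++ [:: aFAIL; aBAD]).
    by rewrite notin_cat an !notin_cons aF aB.
  have eH : mat t1 aH = H by apply: mat_eq => x; apply: e.
  have eD : vset t1 aD = D by apply: vset_eq => x; apply: e.
  have eW : vset t1 aW = ~: D by rewrite -sW; apply: vset_eq => x; apply: e.
  have := @check_layerP t1; rewrite eH eD eW /t1 upd_same -/t1 => /(_ il sH) ok.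
  set t2 := run check_layer t1 in ok *.
  have e2 a x : a \notin writes check_layer -> t2 a x = t1 a x by move=> an; apply: run_frame.
  rewrite run_if /= nz_bool -[t2 aOK 0 == 0]negbK ok -/(P i); case: ifP => Pi.
    rewrite run_seq !run_set; split=> // _ [<-].
    by rewrite upd_same /= upd_other // e2 // /t1 upd_same.
  by rewrite !run_skip !e2.
by rewrite !upd_other.
Qed.

Lemma branchP s i : symmetric_pairs (mat s aH) -> vset s aW = ~: vset s aD ->
  last_bad_layer l k Gs (mat s aH) (vset s aD) = Some i -> s aBAD 0 = i ->
  let t := run branch_prog s in
  (mat t aH, vset t aD) = outer_step l k Gs (mat s aH, vset s aD)
    (s aI2 (s vTT 0 + s vTT 0)) (s aI2 (s vTT 0 + s vTT 0 + 1)).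
Proof.
move=> sH sW bad sB /=; rewrite bad; have [il _ _] := last_sat_some bad.
rewrite /branch_prog; do 5 rewrite run_seq.
(* The scan over the layers has moved [vI] past the end, so it is reset to the bad layer before the
   tests of the minimisation. *)
set s1 := run (set_var vI _) s; set s2 := run shrink_prog s1; set s3 := run (list_prog aW) s2.
set H := mat s aH in sH bad *; set D := vset s aD in sW bad *.
have e1 a x : a != vI -> s1 a x = s a x by move=> aI; rewrite /s1 run_set upd_other.
have s1I : s1 vI 0 = i by rewrite /s1 run_set upd_same.
have e3 a x : a \notin vI :: writes shrink_prog ++ writes (list_prog aW) -> s3 a x = s a x.
  rewrite notin_cons notin_cat => /and3P [aI a2 a3].
  by rewrite /s3 run_frame // /s2 run_frame // e1.
have h1 : mat s1 aH = H by apply: mat_eq => x; apply: e1.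
have d1 : vset s1 aD = D by apply: vset_eq => x; apply: e1.
have w1 : vset s1 aW = ~: D by rewrite -sW; apply: vset_eq => x; apply: e1.
have := @shrinkP s1; rewrite h1 d1 w1 s1I => /(_ il sH erefl) w2.
have [c3 l3] := @list_progP aW s2 isT isT isT.
rewrite -/s2 in w2; rewrite w2 -/s3 in c3 l3.
set L := listing _ in c3 l3 *; set a := s aI2 _; set b := s aI2 _.
set s5 := run (set_var aY _) _.
have e5 x y : x \notin [:: aX; aY] -> s5 x y = s3 x y.
  by rewrite !notin_cons => /and3P [xX xY _]; rewrite /s5 !run_set !upd_other.
have sX : s5 aX 0 = a by rewrite /s5 !run_set /= /upd /= !e3.
have sY : s5 aY 0 = b by rewrite /s5 !run_set /= /upd /= !e3.
rewrite run_if /= nzE !nz_bool sX sY (e5 aCNT) // c3.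
have h3 t : (forall x, t aH x = s3 aH x) -> mat t aH = H.
  by move=> th; apply: mat_eq => x; rewrite th e3.
have d3 t : (forall x, t aD x = s3 aD x) -> vset t aD = D.
  by move=> th; apply: vset_eq => x; rewrite th e3.
case: ifP => [/andP [aL bL]|_]; last by rewrite run_skip h3 ?d3 // => x; apply: e5.
rewrite 2!run_seq; set s7 := run (set_var aY _) _.
have s7X : s7 aX 0 = nth 0 L a.
  by rewrite /s7 !run_set /= /upd /= sX e5 // l3.
have s7Y : s7 aY 0 = nth 0 L b.
  by rewrite /s7 !run_set /= /upd /= sY e5 // l3.
have e7 x y : x \notin [:: aX; aY] -> s7 x y = s3 x y.
  by move=> xn; rewrite -e5 //; move: xn; rewrite !notin_cons => /and3P [xX xY _]; rewrite /s7 !run_set !upd_other.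
have an := listing_lt aL; have bn := listing_lt bL.
rewrite run_if /= nz_bool s7X s7Y; case: ifP => _.
  rewrite run_set /= s7X mat_upd_other // h3; last by move=> x; apply: e7.
  congr pair; rewrite -(d3 s7) => [|y]; last exact: e7.
  apply/setP => x; rewrite in_setU1 !inE -val_eqE /= inordK // /upd /=.
  by case: (_ == nth 0 L a).
rewrite (@toggleP s7 aH (nth 0 L a) (nth 0 L b)) // h3; last by move=> x; apply: e7.
congr pair; apply: d3 => x; rewrite run_frame //; exact: e7.
Qed.

Lemma acceptP s : (run accept_prog s aANS 0 != 0) = (s aANS 0 != 0) || (#|vset s aD| <= d).
Proof.
rewrite /accept_prog run_seq; have [c _] := @list_progP aD s isT isT isT.
rewrite run_if /= nz_bool c size_listing addn1 ltnS; case: ifP => _.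
  by rewrite run_set /= ?upd_same orbT.
by rewrite run_skip run_frame // orbF.
Qed.

Lemma unmarkedP s : vset (run unmarked_prog s) aW = ~: vset s aD.
Proof.
rewrite /unmarked_prog; set c := HSet _ _ _.
have [||t tW ->] := @run_for I (fun j t => forall v, v < j -> (t aW v != 0) = (s aD v == 0)) vV HN c s.
- by [].
- move=> i t _ ag tW v; rewrite run_set /= upd_same.
  rewrite ltnS leq_eqVlt => /predU1P [->|vi].
    by rewrite upd_same upd_other // ag // nz_bool.
  by rewrite /upd /= (ltn_eqF vi) tW.
by apply/setP => x; rewrite !inE upd_other // negbK tW // /hval /= nE.
Qed.

Lemma outer_bodyP s : symmetric_pairs (mat s aH) ->
  let t := run outer_body s in let HD := (mat s aH, vset s aD) in
  (mat t aH, vset t aD) = outer_step l k Gs HD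
    (s aI2 (s vTT 0 + s vTT 0)) (s aI2 (s vTT 0 + s vTT 0 + 1)) /\
  (t aANS 0 != 0) = (s aANS 0 != 0) || outer_goal l k d Gs HD.
Proof.
move=> sH; cbv zeta; rewrite /outer_body 2!run_seq.
set s1 := run unmarked_prog s; set s2 := run layers_prog s1.
have e1 a x : a \notin writes unmarked_prog -> s1 a x = s a x by move=> an; apply: run_frame.
have e2 a x : a \notin writes unmarked_prog ++ writes layers_prog -> s2 a x = s a x.
  by rewrite notin_cat => /andP [a1 a2]; rewrite /s2 run_frame // e1.
have h1 : mat s1 aH = mat s aH by apply: mat_eq => x; apply: e1.
have d1 : vset s1 aD = vset s aD by apply: vset_eq => x; apply: e1.
have w1 : vset s1 aW = ~: vset s aD by apply: unmarkedP.
have h2 : mat s2 aH = mat s aH by apply: mat_eq => x; apply: e2.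
have d2 : vset s2 aD = vset s aD by apply: vset_eq => x; apply: e2.
have w2 : vset s2 aW = ~: vset s2 aD.
  by rewrite d2 -w1; apply: vset_eq => x; apply: run_frame.
have [] := @layersP s1; rewrite ?h1 ?d1 // => sF sB.
set O := outer_step _ _ _ _ _ _.
rewrite run_if /= sF /outer_goal /=; case E: last_bad_layer => [i|] /=.
  have := @branchP s2 i; rewrite h2 d2 => /(_ sH _ E (sB i E)) -> //; last by rewrite -d2.
  by rewrite run_frame // !e2 // orbF.
have -> : O = (mat s aH, vset s aD) by rewrite /O /outer_step E.
rewrite acceptP d2 e2 //; split=> //; congr pair.
  by rewrite -h2; apply: mat_eq => x; apply: run_frame.
by rewrite -d2; apply: vset_eq => x; apply: run_frame.
Qed.

Hypothesis l_gt0 : 0 < l.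

Lemma init_progP s : let t := run init_prog s in mat t aH = Gs 0 /\ vset t aD = set0.
Proof.
rewrite /init_prog 2!run_seq /=; set s1 := run (set_var _ _) s; set c := HFor vQ _ _.
split.
  rewrite mat_run // {}/c.
  have [||t tH ->] := @run_for I (fun j t => forall q, q < j -> (t aH q != 0) = (pair_of N q \in Gs 0))
      vQ nn (HSet aH (HV vQ) input_cell) s1.
  - by [].
  - move=> q t; rewrite hval_nn => qn ag tH q'; rewrite run_set /= upd_same.
    have -> : upd t vQ 0 q vI 0 = 0 by rewrite upd_other // ag // /s1 run_set upd_same.
    rewrite nE modn_cell //.
    rewrite ltnS leq_eqVlt => /predU1P [->|lt]; first by rewrite upd_same inE_cell.
    by rewrite /upd /= (ltn_eqF lt) tH.
  apply/setP => -[x y]; rewrite in_mat upd_other // tH ?pair_ofK // hval_nn.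
  exact: pair_code_lt.
have [||t tD ->] := @run_for I (fun j t => forall v, v < j -> t aD v = 0)
    vV HN (HSet aD (HV vV) (HC 0)) (run c s1).
- by [].
- move=> i t _ _ tD v; rewrite run_set /= upd_same ltnS leq_eqVlt.
  move=> /predU1P [->|lt]; first by rewrite upd_same.
  by rewrite /upd /= (ltn_eqF lt) tD.
by apply/setP => x; rewrite !inE upd_other // tD // /hval /= nE.
Qed.

Lemma outer_step_sym HD a b : symmetric_pairs HD.1 ->
  symmetric_pairs (outer_step l k Gs HD a b : {set V * V} * {set V}).1.
Proof.
case: HD => H D sH /=; case: last_bad_layer => // i.
by case: ifP => // _; case: ifP => // _; apply: toggle_sym.
Qed.

Lemma outer_walk_sym g t : symmetric_pairs (outer_walk l k Gs g t).1.
Proof. by elim: t => [|t IH] /=; [apply: symG|apply: outer_step_sym]. Qed.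

Lemma outer_success_ext g g' : (forall i, i < ((k.*2 + d).+1).*2 -> g i = g' i) ->
  outer_success l k d Gs g = outer_success l k d Gs g'.
Proof.
move=> e; apply: eq_existsb => t; rewrite (@outer_walk_ext _ _ _ _ _ g') // => i it.
by apply: e; apply: leq_trans it _; rewrite leq_double ltnW // ltn_ord.
Qed.

Lemma outer_tryP s :
  (run outer_try s aANS 0 != 0) = (s aANS 0 != 0) || outer_success l k d Gs (s aI2).
Proof.
rewrite /outer_try run_seq; have [h1 d1] := init_progP s; set s1 := run init_prog s in h1 d1 *.
have e a x : a \notin writes init_prog -> s1 a x = s a x by move=> an; apply: run_frame.
set w := outer_walk l k Gs (s aI2).
have [||t [_ tA] ->] := @run_for I (fun j t => (mat t aH, vset t aD) = w j /\
    (t aANS 0 != 0) = (s aANS 0 != 0) || has (fun i => outer_goal l k d Gs (w i)) (iota 0 j))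
    vTT outer_len outer_body s1.
- by rewrite h1 d1 e // orbF.
- move=> j t; rewrite hval_outer => jk ag [tw tA].
  have uw : (mat (upd t vTT 0 j) aH, vset (upd t vTT 0 j) aD) = w j.
    by rewrite mat_upd_other // vset_upd_other.
  have [] := @outer_bodyP (upd t vTT 0 j).
    by rewrite -[mat _ _]/((mat (upd t vTT 0 j) aH, vset (upd t vTT 0 j) aD).1) uw; apply: outer_walk_sym.
  rewrite uw upd_same !(upd_other t _ _ _ (isT : aI2 != vTT)) !ag // !e // => -> ->.
  by rewrite upd_other // tA has_iotaS orbA addnn addn1.
by rewrite upd_other // tA hval_outer has_iota_ord.
Qed.

Lemma main_progP s : (run main_prog s aANS 0 != 0) <-> solvable l k d Gs.
Proof.
rewrite /main_prog run_seq run_set /=; set s1 := upd s aANS 0 0.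
set f := outer_success l k d Gs.
have b0 : 0 < digit_base k by rewrite /digit_base.
have := @run_digits I (fun j t => (t aANS 0 != 0) = has (fun i => f (digit (digit_base k) i)) (iota 0 j))
  aI2 aC2 aJ2 base_exp string_len outer_try s1.
rewrite hval_base hval_string => -> //.
- split.
    case/hasP => j _ ok; apply/(outer_searchP k d l_gt0 (fun i _ => symG i)).
    by exists (digit (digit_base k) j) => // i; apply: digit_lt.
  case/(outer_searchP k d l_gt0 (fun i _ => symG i)) => g gb ok.
  have [j jb jg] := @digits_surj (digit_base k) ((k.*2 + d).+1).*2 g b0 (fun i _ => gb i).
  apply/hasP; exists j; first by rewrite mem_iota.
  by rewrite /f (@outer_success_ext _ g).
- by move=> j t t' ag; rewrite ag.
move=> j t jb ag tI tA; rewrite outer_tryP tA has_iotaS; congr orb.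
exact: outer_success_ext.
Qed.

End Correctness.

(** * Running time *)

Definition nonempty I := 0 < i_n I /\ 0 < i_l I.

(** A uniform big-O over nonempty instances; positivity of [f] lets it absorb constant overheads. *)
Definition time_bound (f : inst -> nat) c :=
  (forall I, nonempty I -> 0 < f I) /\
  exists K, forall I, nonempty I -> time I c <= K * f I.

Lemma time_bound_le f g c : (exists K, forall I, nonempty I -> f I <= K * g I) ->
  (forall I, nonempty I -> 0 < g I) -> time_bound f c -> time_bound g c.
Proof.
move=> [K le] g0 [f0 [K' le']]; split=> //; exists (K' * K) => I ne.
by apply: leq_trans (le' I ne) _; rewrite -mulnA leq_mul2l le ?orbT.
Qed.

Lemma time_bound_const f c : (forall I, nonempty I -> 0 < f I) ->
  (forall I J, time I c = time J c) -> time_bound f c.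
Proof.
(* As the time is the same for all instances, a dummy one supplies the constant. *)
move=> f0 e; split=> //; exists (time (Inst 0 0 0 0 id) c) => I ne.
by rewrite (e I (Inst 0 0 0 0 id)) leq_pmulr // f0.
Qed.

Lemma time_bound_seq f c1 c2 : time_bound f c1 -> time_bound f c2 ->
  time_bound f (HSeq c1 c2).
Proof.
move=> [f0 [K1 le1]] [_ [K2 le2]]; split=> //; exists (K1 + K2) => I ne /=.
by rewrite mulnDl leq_add ?le1 ?le2.
Qed.

Lemma time_bound_if f e c1 c2 : time_bound f c1 -> time_bound f c2 ->
  time_bound f (HIf e c1 c2).
Proof.
move=> [f0 [K1 le1]] [_ [K2 le2]]; split=> //.
exists ((cost (comp_exp e)).+1 + (K1 + K2)) => I ne /=.
by move: (f0 I ne) (le1 I ne) (le2 I ne); move: (cost _) => z; nia.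
Qed.

Lemma time_bound_for f v b c : (forall I, nonempty I -> 0 < hval I b) -> time_bound f c ->
  time_bound (fun I => hval I b * f I) (HFor v b c).
Proof.
move=> b0 [f0 [K le]]; split=> [I ne|]; first by rewrite muln_gt0 b0 ?f0.
rewrite /=; set z1 := (_ + _).+1; set z2 := cost (comp_exp _); set z3 := (_ + _).+1.
exists (z1 + (z2 + K + z3).+1 + z2.+1) => I ne.
have := b0 I ne; have := f0 I ne; have := le I ne.
move: (hval I b) (f I) (time I c) => B F T TF F0 B0.
have h1 : z1 <= z1 * (B * F) by rewrite leq_pmulr // muln_gt0 B0.
have h3 : z2.+1 <= z2.+1 * (B * F) by rewrite leq_pmulr // muln_gt0 B0.
have h2 : B * (z2 + (T + z3)).+1 <= (z2 + K + z3).+1 * (B * F).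
  rewrite mulnCA leq_mul2l; apply/orP; right.
  by move: TF F0; clear; nia.
by rewrite !mulnDl; move: h1 h2 h3; lia.
Qed.

Lemma time_bound_dig f a cv jv b len z inc c : (forall I, nonempty I -> 0 < hval I b) ->
  time_bound f z -> time_bound f inc -> time_bound f c ->
  time_bound (fun I => hval I b ^ hval I len * f I) (HDig a cv jv b len z inc c).
Proof.
move=> b0 [f0 [Kz lez]] [_ [Ki lei]] [_ [K le]].
have p0 I : nonempty I -> 0 < hval I b ^ hval I len by move=> ne; rewrite expn_gt0 b0.
split=> [I ne|]; first by rewrite muln_gt0 p0 ?f0.
rewrite /=; set z2 := cost (comp_exp _); exists (Kz + (z2 + (K + Ki)).+1 + z2.+1) => I ne.
have := p0 I ne; have := f0 I ne; have := le I ne; have := lez I ne; have := lei I ne.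
move: (_ ^ _) (f I) (time I c) (time I z) (time I inc) => B F T Tz Ti TiF TzF TF F0 B0.
have h1 : Tz <= Kz * (B * F) by apply: leq_trans TzF _; rewrite leq_mul2l leq_pmull ?orbT.
have h3 : z2.+1 <= z2.+1 * (B * F) by rewrite leq_pmulr // muln_gt0 B0.
have h2 : B * (z2 + (T + Ti)).+1 <= (z2 + (K + Ki)).+1 * (B * F).
  rewrite mulnCA leq_mul2l; apply/orP; right.
  by move: TF TiF F0; clear; nia.
by rewrite !mulnDl; move: h1 h2 h3; lia.
Qed.

Ltac loop_free := do ?[apply: time_bound_if|apply: time_bound_seq]; by apply: time_bound_const.

(** The hypothesis on [len] lets the cost of the body absorb that of advancing the odometer. *)
Lemma time_bound_digits f a cv jv b len c : (forall I, nonempty I -> 0 < hval I b) ->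
  (forall I, nonempty I -> 0 < hval I len) ->
  (exists K, forall I, nonempty I -> hval I len <= K * f I) -> time_bound f c ->
  time_bound (fun I => hval I b ^ hval I len * f I) (digits_loop a cv jv b len c).
Proof.
move=> b0 l0 lenf fc; have f0 := proj1 fc.
have lf c' : time_bound (fun=> 1) c' -> time_bound f (HFor jv len c').
  move=> c1; apply: (@time_bound_le (fun I => hval I len * 1)) => //.
    by case: lenf => K le; exists K => I ne; rewrite muln1 le.
  exact: time_bound_for.
apply: time_bound_dig => //; apply: time_bound_seq.
- by apply: time_bound_const.
- by apply: lf; apply: time_bound_const.
- by apply: time_bound_const.
by apply: lf; loop_free.
Qed.

Definition pair_cost I := i_n I * i_n I.
Definition try_cost I := hval I inner_len * pair_cost I.
Definition check_cost I := 3 ^ hval I inner_len * try_cost I.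
(** A step tests every layer once and minimises with at most n further tests; the product of n and l
    dominates both numbers on nonempty instances. *)
Definition step_cost I := i_n I * i_l I * check_cost I.
Definition walk_cost I := hval I outer_len * step_cost I.
Definition main_cost I := hval I base_exp ^ hval I string_len * walk_cost I.

Lemma inner_len_gt0 I : 0 < hval I inner_len. Proof. by rewrite hval_inner. Qed.
Lemma outer_len_gt0 I : 0 < hval I outer_len. Proof. by rewrite hval_outer. Qed.

Lemma pair_cost_gt0 I : nonempty I -> 0 < pair_cost I.
Proof. by case=> n0 _; rewrite muln_gt0 n0. Qed.

Lemma try_cost_gt0 I : nonempty I -> 0 < try_cost I.
Proof. by move=> ne; rewrite muln_gt0 inner_len_gt0 pair_cost_gt0. Qed.

Lemma check_cost_gt0 I : nonempty I -> 0 < check_cost I.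
Proof. by move=> ne; rewrite muln_gt0 expn_gt0 try_cost_gt0. Qed.

Lemma step_cost_gt0 I : nonempty I -> 0 < step_cost I.
Proof.
move=> ne; rewrite /step_cost lt0n muln_eq0 negb_or -!lt0n check_cost_gt0 //.
by case: ne => n0 l0; rewrite muln_gt0 n0 l0.
Qed.

Lemma walk_cost_gt0 I : nonempty I -> 0 < walk_cost I.
Proof. by move=> ne; rewrite muln_gt0 outer_len_gt0 step_cost_gt0. Qed.

Lemma pair_le_try I : nonempty I -> pair_cost I <= try_cost I.
Proof. by move=> ne; rewrite leq_pmull // inner_len_gt0. Qed.

Lemma try_le_check I : nonempty I -> try_cost I <= check_cost I.
Proof. by move=> ne; rewrite leq_pmull // expn_gt0. Qed.

Lemma time_bound_mono f g c : (forall I, nonempty I -> f I <= g I) -> time_bound f c ->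
  time_bound g c.
Proof.
move=> fg fc; have f0 := proj1 fc; apply: time_bound_le fc.
  by exists 1 => I ne; rewrite mul1n fg.
by move=> I ne; apply: leq_trans (fg I ne); apply: f0.
Qed.

Lemma time_one_for v b c g : (forall I, nonempty I -> 0 < hval I b) ->
  (forall I, nonempty I -> hval I b <= g I) -> time_bound (fun=> 1) c ->
  time_bound g (HFor v b c).
Proof.
move=> b0 bg c1; apply: time_bound_mono (time_bound_for v b0 c1) => I ne.
by rewrite muln1 bg.
Qed.

Lemma hval_nn_gt0 I : nonempty I -> 0 < hval I (HO OMul HN HN).
Proof. exact: pair_cost_gt0. Qed.

Lemma hval_n_gt0 I : nonempty I -> 0 < hval I HN.
Proof. by case. Qed.

Lemma hval_l_gt0 I : nonempty I -> 0 < hval I HL.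
Proof. by case. Qed.

Lemma time_inner_body : time_bound pair_cost inner_body.
Proof.
apply: time_bound_seq; first apply: time_bound_seq.
- apply: (@time_bound_mono (fun I => hval I HN * i_n I)) => //.
  apply: time_bound_for; first exact: hval_n_gt0.
  apply: time_bound_seq; first by apply: time_bound_const => // I; apply: hval_n_gt0.
  by apply: time_one_for => //; [exact: hval_n_gt0|loop_free].
- apply: time_bound_seq; first by apply: time_bound_const => //; exact: pair_cost_gt0.
  by apply: time_one_for => //; [exact: hval_nn_gt0|loop_free].
apply: time_bound_if.
  apply: (@time_bound_mono (fun=> 1)); first exact: pair_cost_gt0.
  loop_free.
do 2![apply: time_bound_seq; first by apply: time_bound_const => //; exact: pair_cost_gt0].
apply: time_bound_seq; first by apply: time_one_for => //; [exact: hval_nn_gt0|loop_free].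
apply: (@time_bound_mono (fun=> 1)); first exact: pair_cost_gt0.
loop_free.
Qed.

Lemma time_check_layer : time_bound check_cost check_layer.
Proof.
apply: time_bound_seq; first by apply: time_bound_const => //; exact: check_cost_gt0.
apply: (@time_bound_digits try_cost _ _ _ (HC 3) inner_len) => //;
  try by move=> I _; apply: inner_len_gt0.
  by exists 1 => I ne; rewrite mul1n leq_pmulr // pair_cost_gt0.
apply: time_bound_seq; last first.
  apply: (@time_bound_for pair_cost) time_inner_body => I _; exact: inner_len_gt0.
apply: (time_bound_mono pair_le_try).
by apply: time_one_for => //; [exact: hval_nn_gt0|loop_free].
Qed.

Lemma check_le_step I : nonempty I -> check_cost I <= step_cost I.
Proof. by case=> n0 l0; rewrite leq_pmull // muln_gt0 n0. Qed.

Lemma n_le_step I : nonempty I -> i_n I <= step_cost I.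
Proof.
move=> ne; apply: leq_trans (check_le_step ne); apply: leq_trans (try_le_check ne).
by apply: leq_trans (pair_le_try ne); rewrite leq_pmulr //; case: ne.
Qed.

Lemma time_list src : time_bound step_cost (list_prog src).
Proof.
apply: time_bound_seq; first by apply: time_bound_const => //; exact: step_cost_gt0.
by apply: time_one_for; [exact: hval_n_gt0|exact: n_le_step|loop_free].
Qed.

Lemma time_outer_body : time_bound step_cost outer_body.
Proof.
have one c : time_bound (fun=> 1) c -> time_bound step_cost c.
  by apply: time_bound_mono; exact: step_cost_gt0.
have chk1 c : time_bound (fun=> 1) c -> time_bound check_cost c.
  by apply: time_bound_mono; exact: check_cost_gt0.
apply: time_bound_seq.
  by apply: time_one_for; [exact: hval_n_gt0|exact: n_le_step|loop_free].
apply: time_bound_seq.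
  apply: time_bound_seq; first by apply: one; loop_free.
  apply: (@time_bound_mono (fun I => hval I HL * check_cost I)).
    by move=> I [n0 l0]; rewrite /step_cost leq_mul2r leq_pmull ?orbT.
  apply: time_bound_for; first exact: hval_l_gt0.
  by apply: time_bound_seq; [exact: time_check_layer|apply: chk1; loop_free].
apply: time_bound_if; last first.
  by apply: time_bound_seq; [exact: time_list|apply: one; loop_free].
apply: time_bound_seq; first by apply: one; loop_free.
apply: time_bound_seq.
  apply: (@time_bound_mono (fun I => hval I HN * check_cost I)).
    by move=> I [n0 l0]; rewrite /step_cost leq_mul2r leq_pmulr ?orbT.
  apply: time_bound_for; first exact: hval_n_gt0.
  apply: time_bound_if; last by apply: chk1; loop_free.
  apply: time_bound_seq; first by apply: chk1; loop_free.
  by apply: time_bound_seq; [exact: time_check_layer|apply: chk1; loop_free].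
apply: time_bound_seq; first exact: time_list.
by apply: one; loop_free.
Qed.

Lemma hval_base_gt0 I : nonempty I -> 0 < hval I base_exp.
Proof. by rewrite hval_base /digit_base. Qed.

Lemma time_main : time_bound main_cost main_prog.
Proof.
apply: time_bound_seq.
  apply: time_bound_const => // I ne.
  by rewrite muln_gt0 expn_gt0 hval_base_gt0 ?walk_cost_gt0.
apply: (@time_bound_digits walk_cost _ _ _ base_exp string_len); first exact: hval_base_gt0.
- by move=> I _; rewrite hval_string.
- exists 2 => I ne; rewrite hval_string -hval_outer -mul2n leq_mul2l /=.
  by rewrite leq_pmulr // step_cost_gt0.
apply: time_bound_seq; last first.
  apply: (@time_bound_for step_cost) time_outer_body => I _; exact: outer_len_gt0.
have sw I : nonempty I -> step_cost I <= walk_cost I.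
  by move=> _; rewrite leq_pmull // outer_len_gt0.
apply: (@time_bound_mono step_cost) => //.
apply: time_bound_seq; first by apply: time_bound_const => //; exact: step_cost_gt0.
apply: time_bound_seq.
  apply: (@time_bound_mono pair_cost).
    move=> I ne; apply: leq_trans (check_le_step ne); apply: leq_trans (try_le_check ne).
    exact: pair_le_try.
  by apply: time_one_for => //; [exact: hval_nn_gt0|loop_free].
by apply: time_one_for; [exact: hval_n_gt0|exact: n_le_step|loop_free].
Qed.

Lemma wf_main : wf main_prog.
Proof. by do !split. Qed.

Section Bound.

Variable I : inst.
Let z := i_n I + i_l I + i_k I + i_d I + 2.
(** The exponent comes from the base of the outer odometer: 64 is at most z^6 because z is at least
    2, and (k+1)^2 is at most z^2. The other limits need at most z^3. *)
Let X := z ^ 8.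

Let z2 : 1 < z. Proof. by rewrite /z addn2. Qed.

Lemma pow_le_bound i : i <= 8 -> z ^ i <= X.
Proof. by move=> i8; rewrite /X leq_pexp2l // ltnW. Qed.

Lemma param_le_bound x : x <= z -> x <= X.
Proof. by move=> xz; apply: leq_trans (pow_le_bound (isT : 1 <= 8)); rewrite expn1. Qed.

Lemma hval_base_le : hval I base_exp <= X.
Proof.
rewrite hval_base /digit_base /X (_ : 8 = 6 + 2) // expnD leq_mul //.
  by rewrite -[64]/(2 ^ 6) leq_exp2r.
by rewrite -mulnn leq_mul // /z; lia.
Qed.

Lemma hval_string_le : hval I string_len <= X.
Proof.
rewrite hval_string; apply: leq_trans (pow_le_bound (isT : 3 <= 8)).
apply: (@leq_trans (4 * z)); first by rewrite /z; lia.
by rewrite expnS mulnC leq_mul2l -[4]/(2 ^ 2) leq_exp2r ?z2 ?orbT.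
Qed.

Lemma hval_nn_le : hval I (HO OMul HN HN) <= X.
Proof.
apply: leq_trans (pow_le_bound (isT : 2 <= 8)); rewrite -mulnn.
by apply: leq_mul; rewrite /z /=; lia.
Qed.

Lemma hval_inner_le : hval I inner_len <= X.
Proof.
apply: leq_trans hval_string_le; rewrite hval_inner hval_string; lia.
Qed.

Lemma hval_outer_le : hval I outer_len <= X.
Proof.
apply: leq_trans hval_string_le; rewrite hval_outer hval_string; lia.
Qed.

Lemma bound3 : hval I (HC 3) <= X.
Proof.
apply: leq_trans (pow_le_bound (isT : 2 <= 8)).
by apply: (@leq_trans (2 ^ 2)); rewrite // leq_exp2r.
Qed.

Lemma fits_digits a cv jv b len c : 0 < hval I b -> hval I b <= X -> hval I len <= X ->
  fits I X c -> fits I X (digits_loop a cv jv b len c).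
Proof. by move=> b0 bX lX cX; do !split. Qed.

Lemma fits_check : fits I X check_layer.
Proof.
have h1 := hval_nn_le; have h2 := hval_inner_le; have h3 := bound3.
have h4 : hval I HN <= X by apply: param_le_bound; rewrite /z /hval /=; lia.
split=> //; apply: fits_digits => //; by do !split.
Qed.

Lemma fits_main : fits I X main_prog.
Proof.
have h1 := hval_nn_le; have h2 := hval_inner_le; have h3 := hval_outer_le.
have h4 : hval I HN <= X by apply: param_le_bound; rewrite /z /hval /=; lia.
have h5 : hval I HL <= X by apply: param_le_bound; rewrite /z /hval /=; lia.
have h6 := fits_check; split=> //; apply: fits_digits.
- by rewrite hval_base.
- exact: hval_base_le.
- exact: hval_string_le.
by move: h6; rewrite /outer_try /outer_body /layers_prog /branch_prog /shrink_prog;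
   move: check_layer => c h6; do !split.
Qed.

Lemma bound_gt1 : 1 < X.
Proof. by apply: leq_trans z2 _; apply: param_le_bound. Qed.

Lemma inst_ok_bound : (forall b, i_in I b <= 1) -> 0 < cells I -> inst_ok I X.
Proof.
move=> in1 c0; split=> //; first exact: bound_gt1.
- by apply: param_le_bound; rewrite /z; lia.
- by apply: param_le_bound; rewrite /z; lia.
- by apply: param_le_bound; rewrite /z; lia.
- by apply: param_le_bound; rewrite /z; lia.
by move=> b; apply: leq_trans (in1 b) (ltnW bound_gt1).
Qed.

End Bound.

(** * Solving MLCE *)

Definition inst_of n l (G : 'I_l -> {set {set 'I_n}}) k d : inst :=
  Inst n l k d (fun b => encode G k d b.+4).

Lemma encode_zero n l (G : 'I_l -> {set {set 'I_n}}) k d b :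
  l * n * n <= b -> encode G k d b.+4 = 0.
Proof.
move=> lb; rewrite /=; case: existsP => // -[i /existsP [u /existsP [v /andP [/eqP e _]]]].
exfalso; move: lb; rewrite {}e; have := ltn_ord i; have := ltn_ord u; have := ltn_ord v.
move: (nat_of_ord i) (nat_of_ord u) (nat_of_ord v) => {}i {}u {}v vn un il.
have h1 : i * n + u < l * n by nia.
by nia.
Qed.

(** Dividing twice by the number of vertices recovers layer, row and column, so the existential in
    [encode] has only one candidate. *)
Lemma encode_cell N l (G : 'I_l -> {set {set 'I_N.+1}}) k d i q :
  i < l -> q < N.+1 * N.+1 ->
  (i_in (inst_of G k d) (i * N.+1 * N.+1 + q) != 0) = (pair_of N q \in layer_pairs G i).
Proof.
move=> il qn; rewrite -[i]/(val (Ordinal il)) layer_pairsE; move: (Ordinal il) => {il}i.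
rewrite nz_bool /=; set x := pair_of N q.
have qE : q = x.1 * N.+1 + x.2.
  by rewrite /x /= !inordK ?ltn_pmod ?ltn_divLR // -divn_eq.
move: x qE => [x y] /= ->; rewrite in_pairs_of.
apply/existsP/idP => [[j /existsP [u /existsP [v /andP [/eqP e uv]]]]|xy]; last first.
  by exists i; apply/existsP; exists x; apply/existsP; exists y; rewrite xy andbT; apply/eqP; ring.
have e1 := congr1 (divn^~ N.+1) e; have e2 := congr1 (modn^~ N.+1) e.
move: e1 e2; rewrite addnA -mulnDl /= !divnMDl // !modnMDl !(divn_small (ltn_ord _)).
rewrite !(modn_small (ltn_ord _)) !addn0 => e1 /val_inj e2.
have e3 := congr1 (divn^~ N.+1) e1; have e4 := congr1 (modn^~ N.+1) e1.
move: e3 e4; rewrite /= !divnMDl // !modnMDl !(divn_small (ltn_ord _)).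
rewrite !(modn_small (ltn_ord _)) !addn0 => /val_inj e3 /val_inj e4.
by rewrite e2 e3 e4.
Qed.

Lemma encode_rep n l (G : 'I_l -> {set {set 'I_n}}) k d :
  mem_rep (inst_of G k d) zero_state (encode G k d).
Proof.
split=> // a i _; rewrite (_ : 4 + cells _ + _ = (l * n * n + (narr * i + a)).+4).
  by rewrite encode_zero // leq_addr.
by rewrite /cells /=; ring.
Qed.

Lemma MLCE_empty n l (G : 'I_l -> {set {set 'I_n}}) k d : multilayer_graph G ->
  l * n = 0 -> MLCE G k d.
Proof.
move=> mG /eqP; rewrite muln_eq0 => /orP [/eqP l0|/eqP n0].
  have no (i : 'I_l) : False by case: i => i; rewrite l0.
  exists (fun=> set0); split; try by move=> i; case: (no i).
  by exists set0; rewrite cards0; split=> // i; case: (no i).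
have G0 i : G i = set0.
  apply/setP => e; rewrite inE; apply/negbTE/negP => /mG e2.
  by have := max_card (mem e); rewrite e2 card_ord n0.
have d0 : @symdiff 'I_n set0 set0 = set0 by apply/setP => e; rewrite in_symdiff inE.
exists (fun=> set0); split.
- move=> i; rewrite /cluster_editing_set G0 d0; split; first by move=> e; rewrite inE.
  exists set0; split.
    rewrite (_ : [set: _] = set0); last by apply/setP => x; exfalso; have := ltn_ord x; lia.
    apply/and3P; split; last by rewrite inE.
      by rewrite /cover big_set0.
    by rewrite /trivIset /cover !big_set0 cards0.
  by move=> e; rewrite inE; split=> // -[_ [C]]; rewrite inE.
- by move=> i; rewrite cards0.
by exists set0; rewrite cards0; split=> // i j; rewrite !G0.
Qed.

(** [HV 23] is the answer flag [aANS]. Inputs without vertices or without layers are always solvable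
    and bypass the main program. *)
Definition solver : cmd :=
  CIf (EOp OMul (ELoad (EConst 1)) (ELoad (EConst 0)))
    (CSeq (compile main_prog) (CStore (EConst 0) (comp_exp (HV 23))))
    (CStore (EConst 0) (EConst 1)).

Lemma solver_correct : exists w K, forall n l (G : 'I_l -> {set {set 'I_n}}) k d,
  multilayer_graph G -> exists m t,
    [/\ exec ((n + l + k + d + 2) ^ w) solver (encode G k d) m t,
        t <= K * ((if l * n == 0 then 0 else main_cost (inst_of G k d)) + 1)
      & m 0 != 0 <-> MLCE G k d].
Proof.
have [w0 main_ok] := comp_correct wf_main; have [_ [K0 time_ok]] := time_main.
pose W := w0 + weight (HV 23) + 6; pose c1 := cost (comp_exp (HV 23)).
(* The factor 8 stems from the cell bound [z ^ 8], the successor makes the inequality strict, and 20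
   covers the commands around the main program. [W] also leaves room for the product in the
   emptiness test. *)
exists (8 * W).+1, (K0 + c1 + 20) => n l G k d mG; pose I := inst_of G k d.
set z := n + l + k + d + 2; set B := z ^ (8 * W).+1.
have z2 : 1 < z by rewrite /z addn2.
have X2 : 1 < z ^ 8 := bound_gt1 I.
have zB v : v <= W -> (z ^ 8) ^ v < B.
  by move=> vW; rewrite -expnM ltn_exp2l // ltnS leq_mul2l.
have small v : v <= z ^ 8 * z ^ 8 -> v < B.
  move=> vX; apply: leq_ltn_trans vX _; rewrite mulnn.
  by apply: zB; rewrite /W; lia.
have lX : l <= z ^ 8 by apply: (@param_le_bound I); rewrite /=; lia.
have nX : n <= z ^ 8 by apply: (@param_le_bound I); rewrite /=; lia.
have one v : v <= z ^ 8 -> v < B.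
  by move=> vX; apply: small; apply: leq_trans vX _; rewrite leq_pmulr // ltnW.
have test : eval B (encode G k d) (EOp OMul (ELoad (EConst 1)) (ELoad (EConst 0))) = Some (l * n).
  have B0 : word B 0 = Some 0 by rewrite /word one.
  have B1 : word B 1 = Some 1 by rewrite /word one // ltnW.
  by rewrite /= B0 B1 /= /word (one l) // (one n) // small // leq_mul.
case: (posnP (l * n)) => [ln0|ln_gt0].
  exists (update (encode G k d) 0 1); eexists; split.
  - apply: ExecIf test _; rewrite ln0 /=; apply: ExecStore.
      by rewrite /= /word one.
    by rewrite /= /word one // ltnW.
  - by rewrite muln1; apply: leq_trans (leq_addl _ _).
  by split=> // _; apply: MLCE_empty.
have l0 : 0 < l by move: ln_gt0; rewrite muln_gt0 => /andP [].
case: n => [|N] in G mG I z B z2 X2 zB small lX nX one test ln_gt0 *.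
  by rewrite muln0 in ln_gt0.
have cells0 : 0 < cells I by rewrite /cells /= !muln_gt0 l0.
have ok : inst_ok I (z ^ 8).
  by apply: (@inst_ok_bound I) => // b; rewrite /I /=; apply: leq_b1.
have [||m1 [t1 [x1 le1 [rep1 bnd1]]]] := main_ok I (z ^ 8) B zero_state (encode G k d) ok (fits_main I).
- by apply: zB; rewrite /W; lia.
- by split=> //; apply: encode_rep.
have wB : (z ^ 8) ^ weight (HV 23) < B by apply: zB; rewrite /W; lia.
have [e2 _ _] := comp_expP ok rep1 bnd1 (isT : wf_exp (HV 23)) wB.
exists (update m1 0 (run I main_prog zero_state 23 0)); eexists; split.
- apply: ExecIf test _; rewrite -lt0n ln_gt0; apply: ExecSeq x1 _.
  by apply: ExecStore e2; rewrite /= /word one.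
- have := time_ok I (conj (isT : 0 < i_n I) (l0 : 0 < i_l I)).
  rewrite -/I -/c1; move: le1; move: (main_cost I) (time I main_prog) => F T.
  move=> tT TF; rewrite mulnDr muln1.
  have KF : K0 * F <= (K0 + c1 + 20) * F by rewrite leq_mul2r -addnA leq_addr orbT.
  apply: (@leq_trans (5 + (T + (1 + c1).+1)).+1); first by rewrite ltnS !leq_add2l leq_add2r.
  apply: (@leq_trans (K0 * F + (K0 + c1 + 20))); last by rewrite leq_add2r.
  by move: TF; move: (K0 * F) c1 {KF} => a c Ta; clear -Ta; lia.
rewrite /update /=.
have := @main_progP I N erefl (layer_pairs G) _ (layer_pairs_sym G) l0 zero_state.
move=> h; rewrite h; first exact: (iff_sym (MLCE_solvableP k d l0 mG)).
by move=> i q il qn; apply: encode_cell.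
Qed.

Lemma MLCE_solvable_in_le T T' : (forall n l k d, T n l k d <= T' n l k d) ->
  MLCE_solvable_in T -> MLCE_solvable_in T'.
Proof.
move=> le [p [w P]]; exists p, w => n l G k d mG; have [m [t [x tT ok]]] := P n l G k d mG.
by exists m, t; split=> //; apply: leq_trans (le _ _ _ _).
Qed.

Lemma main_cost_le : exists K, forall I,
  main_cost I <= K * (maxn 2 (i_k I) ^ (72 * (i_k I + i_d I)) * i_n I ^ 3 * i_l I).
Proof.
have [e eE] : exists e, e = 24 by exists 24.
exists (2 ^ e) => I; set y := maxn 2 (i_k I).
rewrite /main_cost /walk_cost /step_cost /check_cost /try_cost /pair_cost.
rewrite hval_base hval_string hval_outer hval_inner.
move: (i_n I) (i_l I) (i_k I) (i_d I) @y => n l k d y.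
set E := (k.*2 + d).+1; set F := k.*2.+1.
have y2 : 1 < y by rewrite leq_max.
have ky : k <= y by rewrite leq_maxr.
(* The exponent is 6 for the factor 64 and 2 for each factor [k.+1]. *)
have base : digit_base k <= y ^ 10.
  rewrite (_ : 10 = 6 + 2 + 2) // !expnD -mulnA leq_mul //.
    by rewrite -[64]/(2 ^ 6) leq_exp2r.
  have : k.+1 <= y ^ 2 by rewrite -mulnn; nia.
  by move=> h; rewrite leq_mul.
have e1 : digit_base k ^ E.*2 <= y ^ (20 * E).
  rewrite (_ : 20 * E = 10 * E.*2); last by lia.
  by rewrite expnM leq_exp2r // double_gt0.
have e2 : E <= y ^ E by rewrite ltnW // ltn_expl.
have e3 : 3 ^ F <= y ^ (2 * F).
  rewrite expnM leq_exp2r //; apply: (@leq_trans (2 ^ 2)); rewrite // leq_exp2r //.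
have e4 : F <= y ^ F by rewrite ltnW // ltn_expl.
(* The exponents add up to 48 k + 21 d + 24. For positive [k + d] the 24 is absorbed by 24 (k + d),
   which gives 72; for [k + d = 0] the base [y] is 2, and the constant factor [2 ^ e] pays for
   it. *)
have pw : y ^ (20 * E) * (y ^ E * (y ^ (2 * F) * y ^ F)) <= 2 ^ e * y ^ (72 * (k + d)).
  rewrite -!expnD; apply: (@leq_trans (y ^ (e + 48 * (k + d)))).
    by rewrite leq_pexp2l ?(ltnW y2) // eE /E /F; lia.
  rewrite (_ : 72 * (k + d) = e * (k + d) + 48 * (k + d)); last by rewrite eE; lia.
  move: (48 * (k + d)) => r; rewrite (expnD y e) (expnD y (e * _)) mulnA leq_mul2r; apply/orP; right.
  case: (posnP (k + d)) => [kd0|kd_gt0].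
    have k0 : k = 0 by lia.
    by rewrite kd0 muln0 expn0 muln1 /y k0.
  by rewrite -[y ^ e]mul1n leq_mul ?expn_gt0 // leq_pexp2l ?(ltnW y2) // leq_pmulr.
apply: (@leq_trans (y ^ (20 * E) * (y ^ E * (y ^ (2 * F) * y ^ F)) * (n ^ 3 * l))).
  rewrite (_ : _ * (E * _) = digit_base k ^ E.*2 * (E * (3 ^ F * F)) * (n ^ 3 * l)); last by ring.
  by rewrite leq_mul2r !leq_mul ?orbT.
rewrite (_ : 2 ^ e * _ = 2 ^ e * y ^ (72 * (k + d)) * (n ^ 3 * l)); last by rewrite !mulnA.
by rewrite leq_mul2r pw orbT.
Qed.

(** * A computable parameter function and the final bounds *)

Definition power_prog C : cmd :=
  CSeq (CStore (EConst 2) (EOp OMul (EConst C) (EOp OAdd (ELoad (EConst 0)) (ELoad (EConst 1)))))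
  (CSeq (CStore (EConst 3) (EConst 1))
  (CSeq (CWhile (ELoad (EConst 2))
     (CSeq (CStore (EConst 3) (EOp OMul (ELoad (EConst 3)) (EOp OAdd (ELoad (EConst 0)) (EConst 2))))
           (CStore (EConst 2) (EOp OSub (ELoad (EConst 2)) (EConst 1)))))
     (CStore (EConst 0) (EOp OMul (EConst C) (EOp OAdd (ELoad (EConst 3)) (EConst 1)))))).

(** [k + 2] dominates [maxn 2 k] and can be computed without a comparison. *)
Lemma power_computable C : computable2 (fun k d => C * ((k + 2) ^ (C * (k + d)) + 1)).
Proof.
exists (power_prog C) => x y; set M := C * (x + y).
(* The sum exceeds every value that occurs during the computation. *)
have [B BE] : exists B, B = (C + x + y + M + (x + 2) ^ M + C * ((x + 2) ^ M + 1) + 10).+1.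
  by eexists.
have wB v : v < B -> word B v = Some v by move=> vB; rewrite /word vB.
have c0 : word B 0 = Some 0 by apply: wB; rewrite BE.
have c1 : word B 1 = Some 1 by apply: wB; rewrite BE; lia.
have c2 : word B 2 = Some 2 by apply: wB; rewrite BE; lia.
have c3 : word B 3 = Some 3 by apply: wB; rewrite BE; lia.
have cC : word B C = Some C by apply: wB; rewrite BE; lia.
have cx : word B x = Some x by apply: wB; rewrite BE; lia.
have cy : word B y = Some y by apply: wB; rewrite BE; lia.
have cM : word B M = Some M by apply: wB; rewrite BE; lia.
have cP i : i <= M -> word B ((x + 2) ^ i) = Some ((x + 2) ^ i).
  move=> iM; apply: wB; have : (x + 2) ^ i <= (x + 2) ^ M by rewrite leq_pexp2l // addn2.
  by rewrite BE; lia.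
pose J i (m : memory) := [/\ m 0 = x, m 2 = M - i & m 3 = (x + 2) ^ i].
pose m0 : memory := fun a => if a == 0 then x else if a == 1 then y else 0.
pose m1 := update m0 2 M; pose m2 := update m1 3 1.
have x1 : exec B (CStore (EConst 2) (EOp OMul (EConst C) (EOp OAdd (ELoad (EConst 0)) (ELoad (EConst 1)))))
    m0 m1 9.
  apply: ExecStore; first by rewrite /= c2.
  by rewrite /= c0 c1 cC /= cx cy (wB (x + y)) ?cM // BE; lia.
have x2 : exec B (CStore (EConst 3) (EConst 1)) m1 m2 3.
  by apply: ExecStore; rewrite /= ?c3 ?c1.
have J0 : J 0 m2 by split; rewrite ?subn0.
have step i m : i < M -> J i m ->
    (exists2 v, eval B m (ELoad (EConst 2)) = Some v & v != 0) /\
    halts B (CSeq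
      (CStore (EConst 3) (EOp OMul (ELoad (EConst 3)) (EOp OAdd (ELoad (EConst 0)) (EConst 2))))
      (CStore (EConst 2) (EOp OSub (ELoad (EConst 2)) (EConst 1)))) m 100 (J i.+1).
  move=> iM [j0 j2 j3]; have cMi v : v <= M -> word B v = Some v by move=> vM; apply: wB; rewrite BE; lia.
  split; first by exists (M - i); rewrite /= ?c2 ?j2 ?cMi ?leq_subr // -lt0n subn_gt0.
  exists (update (update m 3 ((x + 2) ^ i.+1)) 2 (M - i.+1)); eexists; split.
  - apply: ExecSeq; apply: ExecStore; rewrite /= ?c3 ?c2 //.
      rewrite j3 c0 /= (cP i (ltnW iM)) j0 cx (wB (x + 2)); last by rewrite BE; lia.
      by rewrite -expnSr cP.
    by rewrite /update /= j2 cMi ?leq_subr // c1 -subnDA addn1 cMi ?leq_subr.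
  - by [].
  by split; rewrite /update.
have last m : J M m -> eval B m (ELoad (EConst 2)) = Some 0.
  by move=> [_ j2 _]; rewrite /= c2 j2 subnn.
have [m3 [t [x3 _ [m30 m32 m33]]]] := halts_while step last (leq0n _) J0.
exists B, (update m3 0 (C * ((x + 2) ^ M + 1))); eexists; split=> //.
apply: ExecSeq x1 _; apply: ExecSeq x2 _; apply: ExecSeq x3 _.
apply: ExecStore; first by rewrite /= c0.
rewrite /= c3 m33 cP // c1 cC !wB // BE; lia.
Qed.

(* The base is max(2, k): for k <= 1 the literal k ^ (k + d) would be 0 or 1.
   The summand 1 only matters for n = 0 or l = 0. *)
Theorem theorem1 :
  MLCE_FPT /\
  exists C : nat,
    MLCE_solvable_in
      (fun n l k d => C * (maxn 2 k ^ (C * (k + d)) * n ^ 3 * l + 1)).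
Proof.
have [C solv] : exists C : nat,
    MLCE_solvable_in
      (fun n l k d => C * (maxn 2 k ^ (C * (k + d)) * n ^ 3 * l + 1)).
  have [w [K ok]] := solver_correct; have [K' le'] := main_cost_le.
  (* [K * K'] is the factor of the main term, [K] that of the additive constant, and 72 the factor
     in the exponent; one constant covers all three. *)
  exists (K * K' + K + 72), solver, w => n l G k d mG.
  have [m [t [x tK ans]]] := ok n l G k d mG; exists m, t; split=> //.
  apply: leq_trans tK _; rewrite !mulnDr !muln1; set C := K * K' + K + 72.
  apply: leq_add; last by rewrite /C -addnA addnC -addnA leq_addr.
  case: ifP => _; first by rewrite muln0.
  apply: (@leq_trans (K * (K' * (maxn 2 k ^ (72 * (k + d)) * n ^ 3 * l)))).
    by rewrite leq_mul2l (le' (inst_of G k d)) orbT.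
  rewrite mulnA leq_mul //; first by rewrite /C -addnA leq_addr.
  apply: leq_mul => //; apply: leq_mul => //.
  apply: leq_pexp2l; first by rewrite leq_max.
  by rewrite -mulnDr leq_mul2r leq_addl orbT.
split; last by exists C.
exists (fun k d => C * ((k + 2) ^ (C * (k + d)) + 1)), 2; split; first exact: power_computable.
apply: MLCE_solvable_in_le solv => n l k d; rewrite -[X in _ <= X]mulnA leq_mul2l; apply/orP; right.
set S := input_size n l; have S0 : 0 < S by [].
(* The input size bounds only l n^2, hence the exponent 2: the square of l n^2 is n^3 l times n l,
   and the second factor is positive unless both sides are trivial. *)
have nl : n ^ 3 * l <= S ^ 2.
  apply: (@leq_trans ((l * n * n) ^ 2)); last by rewrite leq_exp2r // /S /input_size leq_addl.
  rewrite (_ : (l * n * n) ^ 2 = n ^ 3 * l * (n * l)); last by ring.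
  by case: (posnP (n * l)) => [|nl0]; [move/eqP; rewrite muln_eq0 => /orP [] /eqP ->; rewrite ?muln0|rewrite leq_pmulr].
rewrite mulnDl mul1n; apply: leq_add; last by rewrite expn_gt0 S0.
rewrite -mulnA leq_mul //; case: (posnP (C * (k + d))) => [->|E0]; first by rewrite !expn0.
by rewrite leq_exp2r // geq_max leq_addl leq_addr.
Qed.
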